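(* There exists a function $f\in\mathcal{B}$ of finite order such that $f$ does not have the area property near infinity.
   Context: For an entire function $f:\mathbb{C}\to\mathbb{C}$, the order is $\rho(f)=\limsup_{z\to\infty}\frac{\log_+\log_+|f(z)|}{\log|z|}\in[0,\infty]$, where $\log_+x=\max(0,\log x)$. The set of singular values $S(f)$ is the smallest closed set $S\subset\mathbb{C}$ such that $f:f^{-1}(\mathbb{C}\setminus S)\to\mathbb{C}\setminus S$ is a covering map; equivalently, the closure in $\mathbb{C}$ of the set of all critical and finite asymptotic values of $f$. The Eremenko-Lyubich class $\mathcal{B}$ is the set of transcendental entire functions $f$ for which $S(f)$ is bounded. A function $f\in\mathcal{B}$ has the area property near infinity if $\int_{f^{-1}(K)\setminus\mathbb{D}}\frac{dx\,dy}{|z|^2}<\infty$ for every compact subset $K$ of the unbounded connected component of $\mathbb{C}\setminus S(f)$, where $\mathbb{D}$ is the unit disc and $z=x+iy$. *)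

(* Defs.v *)
From HB Require Import structures.
From mathcomp Require Import all_boot all_order all_algebra.
From mathcomp Require Import all_classical all_reals all_analysis.
From mathcomp Require Import complex.

Set Implicit Arguments.
Unset Strict Implicit.
Unset Printing Implicit Defensive.

Import Order.TTheory GRing.Theory Num.Theory.
Import numFieldNormedType.Exports.

Local Open Scope classical_set_scope.
Local Open Scope ring_scope.

(* R[i] carries no topology under its own name; typed as a numFieldType it
   inherits the norm topology and the normed-module structure over itself that
   MathComp-Analysis gives to every numFieldType. *)
Definition Cplx (R : realType) : numFieldType := R[i].

(* The modulus with values in R; `|z| itself has values in R[i]. *)
Definition cabs (R : realType) (z : Cplx R) : R := ComplexField.Normc.normc z.

(* The scalar increments range over Cplx R, so derivability in the direction 1
   is complex differentiability. *)
Definition entire (R : realType) (f : Cplx R -> Cplx R) : Prop :=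
  forall z : Cplx R, derivable f z 1.

Definition transcendental_entire (R : realType) (f : Cplx R -> Cplx R) : Prop :=
  entire f /\ ~ exists p : {poly Cplx R}, forall z, f z = p.[z].

(* ln is 0 on nonpositive reals, hence logp 0 = 0. *)
Definition logp (R : realType) (x : R) : R := Num.max 0 (ln x).

Definition cinfty (R : realType) : set (set (Cplx R)) :=
  filter_from [set: R] (fun M => [set z | M < cabs z]).
Arguments cinfty R : clear implicits.

Definition growth_order (R : realType) (f : Cplx R -> Cplx R) : \bar R :=
  limf_esup (fun z => (logp (logp (cabs (f z))) / ln (cabs z))%:E) (cinfty R).

Definition homeomorphism_on (T T' : topologicalType) (f : T -> T')
    (A : set T) (B : set T') : Prop :=
  exists g : T' -> T,
    [/\ forall x, A x -> B (f x) /\ g (f x) = x,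
        forall y, B y -> A (g y) /\ f (g y) = y,
        {within A, continuous f} & {within B, continuous g}].

(* The sheets over V are the members of F. *)
Definition evenly_covered (T T' : topologicalType) (f : T -> T')
    (V : set T') : Prop :=
  exists F : set (set T),
    [/\ forall W, F W -> open W,
        trivIset F id,
        f @^-1` V = \bigcup_(W in F) W &
        forall W, F W -> homeomorphism_on f W V].

(* For U open: f : f @^-1` U -> U is a covering map. *)
Definition covering_over (T T' : topologicalType) (f : T -> T')
    (U : set T') : Prop :=
  forall w, U w ->
    exists V : set T', [/\ open V, V w, V `<=` U & evenly_covered f V].

Definition singular_values (R : realType) (f : Cplx R -> Cplx R) :
    set (Cplx R) :=
  \bigcap_(S in [set S | closed S /\ covering_over f (~` S)]) S.

(* Being a covering map is local on the base, so the intersection above is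
   itself one of the sets S. *)
Lemma singular_values_smallest (R : realType) (f : Cplx R -> Cplx R) :
  [/\ closed (singular_values f),
      covering_over f (~` singular_values f) &
      forall S, closed S -> covering_over f (~` S) ->
        singular_values f `<=` S].
Proof.
split; first by apply: closed_bigI => S [].
- move=> w /= Sw.
  have [S [[cS covS] nSw]] :
      exists S, (closed S /\ covering_over f (~` S)) /\ ~ S w.
    apply: contrapT => nS; apply: Sw => S hS.
    by apply: contrapT => nSw; apply: nS; exists S.
  have [V [oV Vw VS eV]] := covS w nSw.
  exists V; split=> // v Vv sv; exact: (VS v Vv) (sv S (conj cS covS)).
- by move=> S cS covS z; apply.
Qed.

Definition class_B (R : realType) (f : Cplx R -> Cplx R) : Prop :=
  transcendental_entire f /\ bounded_set (singular_values f).

Definition unbounded_component (R : realType) (A W : set (Cplx R)) : Prop :=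
  (exists2 x, A x & W = connected_component A x) /\ ~ bounded_set W.

(* The integral of dx dy / |z|^2 over A. *)
Definition log_area (R : realType) (A : set (Cplx R)) : \bar R :=
  (\int[lebesgue_measure \x lebesgue_measure]_(p in
      [set p : measurableTypeR R * measurableTypeR R | A (Complex p.1 p.2)])
    ((cabs (Complex p.1 p.2) ^+ 2)^-1)%R%:E)%E.

(* For f in class B the complement of singular_values f has exactly one
   unbounded component W. *)
Definition area_property (R : realType) (f : Cplx R -> Cplx R) : Prop :=
  forall W K : set (Cplx R),
    unbounded_component (~` singular_values f) W ->
    compact K -> K `<=` W ->
    (log_area ((f @^-1` K) `\` [set z | (cabs z < 1)%R]) < +oo)%E.

(* Main.v *)
(* Write e(u) = exp(2 pi u).  For a large integer N the map
   psi(a) = iN + a - (N - 1)/a is injective on the right half-plane; near a = 7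
   its derivative has order N, so that psi attaches to the half-plane, through a
   narrow neck at iN, a room of diameter comparable with N in which Re a stays
   bounded.  The two preimages a, b of z are the roots of a quadratic polynomial,
   hence the symmetric function e(a) + e(b) is entire in z.  The function
     F(z) = e(z) + sum_k (e(a_k) + e(b_k) - 1 - e(z)),   N_k = B^(2k+1),
   has one room at each scale N_k.  Since ab = 1 - N, the roots at z = 0 are -i
   and -i(N - 1); as e(-i) = 1, the k-th summand decays geometrically away from
   |z| ~ N_k, and at that scale F(z) is e(a_k) up to a small relative and a
   bounded absolute error.  In the coordinate a the function F o psi is C^1-close
   to e as long as Re a >= 4, so F has inverse branches on discs
   |w - w0| < c |w0| for all large w0, and S(F) is bounded.  Each room contains a
   square of side comparable with N_k, at distance comparable with N_k from 0,
   which F maps into one fixed compact set: every k contributes the same amount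
   to the logarithmic area. *)
Require Import Defs.
From HB Require Import structures.
From mathcomp Require Import all_boot all_order all_algebra.
From mathcomp Require Import all_classical all_reals all_analysis.
From mathcomp Require Import measurable_realfun complex ring lra zify.

Set Implicit Arguments.
Unset Strict Implicit.
Unset Printing Implicit Defensive.

Import Order.TTheory GRing.Theory Num.Theory.
Import numFieldNormedType.Exports.

Local Open Scope classical_set_scope.
Local Open Scope ring_scope.

(** * The exponential of period i *)

(** The product 1 - N of the roots is dictated by the need to make a summand negligible on both
    sides of its scale. For |z| much larger than N the small root tends to 0; for |z| much smaller
    it tends to its value at z = 0. As e(a) = e(z)/e(b), the single correction - 1 - e(z) serves
    both sides only if that value is a period of e, and the product 1 - N makes it -i. The critical
    points of psi, a = i sqrt(N - 1) and its opposite, lie on the imaginary axis, where |e| = 1: the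
    neck is pinched where e is bounded. The delicate term in the coordinate a is e(b), since b moves
    at speed (N - 1)/|a|^2, which may be of order N. But Re b = - (N - 1) Re a/|a|^2, so |e(b)|
    decays exponentially in the very quantity that measures this speed. The other rooms enter
    through exponents of size O(1/B). With B above 10^6 all errors together stay below half of the
    derivative 2 pi e(a), which is what a Newton iteration with frozen slope requires. *)

Section Modulus.
Context {R : realType}.
Implicit Types (z w : Cplx R) (x y : R).

Lemma cabs_normr z : `|z| = (cabs z)%:C%C.
Proof. by rewrite normc_def /cabs; case: z. Qed.

Lemma cabs_ge0 z : 0 <= cabs z.
Proof. by case: z => x y; rewrite /cabs /= sqrtr_ge0. Qed.

Lemma cabs0 : cabs (0 : Cplx R) = 0.
Proof. exact: ComplexField.Normc.normc0. Qed.

Lemma cabs1 : cabs (1 : Cplx R) = 1.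
Proof. exact: ComplexField.Normc.normc1. Qed.

Lemma cabs_eq0 z : cabs z = 0 -> z = 0.
Proof. exact: ComplexField.Normc.eq0_normc. Qed.

Lemma cabs_gt0 z : z != 0 -> 0 < cabs z.
Proof.
by move=> z0; rewrite lt_def cabs_ge0 andbT; apply: contra z0 => /eqP/cabs_eq0 ->.
Qed.

Lemma cabsM z w : cabs (z * w) = cabs z * cabs w.
Proof. exact: ComplexField.Normc.normcM. Qed.

Lemma cabsV z : cabs z^-1 = (cabs z)^-1.
Proof. exact: ComplexField.Normc.normcV. Qed.

Lemma cabsN z : cabs (- z) = cabs z.
Proof. exact: normcN. Qed.

Lemma cabsD z w : cabs (z + w) <= cabs z + cabs w.
Proof. exact: le_normcD. Qed.

Lemma cabsB z w : cabs (z - w) <= cabs z + cabs w.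
Proof. by rewrite -(cabsN w) cabsD. Qed.

Lemma cabs_distC z w : cabs (z - w) = cabs (w - z).
Proof. by rewrite -cabsN opprB. Qed.

Lemma cabs_lbD z w : cabs z - cabs w <= cabs (z + w).
Proof. by rewrite lerBlDr -{1}(addrK w z) cabsB. Qed.

Lemma cabs_lbB z w : cabs z - cabs w <= cabs (z - w).
Proof. by rewrite -(cabsN w) cabs_lbD. Qed.

Lemma cabs_dist_trans w z u : cabs (z - u) <= cabs (z - w) + cabs (w - u).
Proof. by have := cabsD (z - w) (w - u); rewrite addrA subrK. Qed.

Lemma cabs_sqr z : cabs z ^+ 2 = complex.Re z ^+ 2 + complex.Im z ^+ 2.
Proof. by case: z => x y; rewrite /cabs /= sqr_sqrtr // addr_ge0 // sqr_ge0. Qed.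

Lemma cReM z w : complex.Re (z * w) =
  complex.Re z * complex.Re w - complex.Im z * complex.Im w.
Proof. by case: z; case: w. Qed.

Lemma cImM z w : complex.Im (z * w) =
  complex.Re z * complex.Im w + complex.Im z * complex.Re w.
Proof. by case: z; case: w => a b c d /=. Qed.

Lemma cReD z w : complex.Re (z + w) = complex.Re z + complex.Re w.
Proof. by case: z; case: w. Qed.

Lemma cImD z w : complex.Im (z + w) = complex.Im z + complex.Im w.
Proof. by case: z; case: w. Qed.

Lemma cReN z : complex.Re (- z) = - complex.Re z.
Proof. by case: z. Qed.

Lemma cImN z : complex.Im (- z) = - complex.Im z.
Proof. by case: z. Qed.

Lemma cabs_Re z : `|complex.Re z| <= cabs z.
Proof.
rewrite -ler_sqr ?nnegrE ?cabs_ge0 // cabs_sqr real_normK ?num_real //.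
by rewrite lerDl sqr_ge0.
Qed.

Lemma cabs_Im z : `|complex.Im z| <= cabs z.
Proof.
rewrite -ler_sqr ?nnegrE ?cabs_ge0 // cabs_sqr real_normK ?num_real //.
by rewrite lerDr sqr_ge0.
Qed.

Lemma cabs_le_ReIm z : cabs z <= `|complex.Re z| + `|complex.Im z|.
Proof.
rewrite -ler_sqr ?nnegrE ?cabs_ge0 ?addr_ge0 // cabs_sqr sqrrD.
rewrite !real_normK ?num_real //.
have : 0 <= `|complex.Re z| * `|complex.Im z| by rewrite mulr_ge0.
by rewrite mulr2n; lra.
Qed.

Lemma cabs_real x : cabs (x%:C%C : Cplx R) = `|x|.
Proof. by rewrite /cabs /= expr0n addr0 sqrtr_sqr. Qed.

Lemma cplx_ext z w :
  complex.Re z = complex.Re w -> complex.Im z = complex.Im w -> z = w.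
Proof. by case: z; case: w => a b c d /= -> ->. Qed.

End Modulus.

Section Exponential.
Context {R : realType}.
Implicit Types (u v z : Cplx R) (x y : R).

(* The exponential with period i; it takes the value 1 on i times the integers. *)
Definition ce (z : Cplx R) : Cplx R :=
  Complex (expR (2 * pi * complex.Re z) * cos (2 * pi * complex.Im z))
          (expR (2 * pi * complex.Re z) * sin (2 * pi * complex.Im z)).

Lemma ceD u v : ce (u + v) = ce u * ce v.
Proof.
apply: cplx_ext; rewrite ?cReM ?cImM /= ?cReD ?cImD !mulrDr expRD ?cosD ?sinD; ring.
Qed.

Lemma cabs_ce z : cabs (ce z) = expR (2 * pi * complex.Re z).
Proof.
apply/eqP; rewrite -(eqrXn2 (n := 2)) ?cabs_ge0 ?expR_ge0 //.
by rewrite cabs_sqr /= !exprMn -mulrDr cos2Dsin2 mulr1.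
Qed.

Lemma cabs_ce_gt0 z : 0 < cabs (ce z).
Proof. by rewrite cabs_ce expR_gt0. Qed.

Lemma ce0 : ce 0 = 1.
Proof. by apply: cplx_ext; rewrite /= !mulr0 expR0 ?cos0 ?sin0 !mul1r. Qed.

Lemma ce_neq0 z : ce z != 0.
Proof. by apply/eqP => h; have := cabs_ce_gt0 z; rewrite h cabs0 ltxx. Qed.

Lemma ceN z : ce (- z) = (ce z)^-1.
Proof.
by apply: (mulfI (ce_neq0 z)); rewrite -ceD subrr ce0 mulfV ?ce_neq0.
Qed.

Lemma ce_inat (n : nat) : ce (Complex 0 n%:R) = 1.
Proof.
elim: n => [|n IH]; first by rewrite -[RHS]ce0.
have -> : Complex 0 n.+1%:R = Complex 0 n%:R + Complex 0 1 :> Cplx R.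
  by apply: cplx_ext; rewrite ?cReD ?cImD /= ?addr0 // -natr1.
rewrite ceD IH mul1r; apply: cplx_ext => /=; rewrite mulr0 expR0 mulr1 mul1r.
  by rewrite mulr_natl cos2pi.
by rewrite mulr_natl sin2pi.
Qed.

Lemma tau_gt0 : 0 < 2 * pi :> R. Proof. by rewrite mulr_gt0 // pi_gt0. Qed.
Lemma tau_ge4 : 4 <= 2 * pi :> R. Proof. by have := @pi_ge2 R; lra. Qed.
Lemma tau_le8 : 2 * pi <= 8 :> R. Proof. by have := @pihalf_lt2 R; lra. Qed.

Lemma sin_mvt y : exists2 t, `|t| <= `|y| & sin y = y * cos t.
Proof.
wlog y0 : y / 0 < y => [hw|].
  case: (ltgtP y 0) => [y0|y0|->]; last by exists 0; rewrite ?normr0 // sin0 mul0r.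
    have [t ht e] := hw (- y) ltac:(by rewrite oppr_gt0).
    by exists t; rewrite ?normrN in ht * => //; rewrite -[y in sin y]opprK sinN e mulNr opprK.
  exact: hw.
have [t ht e] := @MVT R sin cos 0 y y0 (fun x _ => is_derive_sin x)
  (continuous_subspaceT (@continuous_sin R)).
exists t; last by rewrite -[LHS]subr0 -{1}sin0 e subr0 mulrC.
by move: ht; rewrite in_itv /= => /andP[t0 ty]; rewrite !ger0_norm ?ltW.
Qed.

Lemma abs_sin_le y : `|sin y| <= `|y|.
Proof.
have [t _ ->] := sin_mvt y.
by rewrite normrM -[leRHS]mulr1 ler_wpM2l // cos_max.
Qed.

Lemma one_sub_cos_le y : `|cos y - 1| <= y ^+ 2 / 2.
Proof.
have -> : cos y = 1 - 2 * sin (y / 2) ^+ 2.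
  have := cos_mulr2n (y / 2); rewrite cos2sin2 => h.
  have e : (y / 2) *+ 2 = y by rewrite mulr2n; field.
  by rewrite -{1}e h mulr2n; field.
have := abs_sin_le (y / 2); rewrite -ler_sqr ?nnegrE // !real_normK ?num_real // => h.
have e4 : (y / 2) ^+ 2 = y ^+ 2 / 4 by field.
rewrite e4 in h; rewrite ler_norml; have := sqr_ge0 (sin (y / 2)).
lra.
Qed.

Lemma abs_cos_sub1_le y : `|cos y - 1| <= `|y|.
Proof.
case: (lerP `|y| 2) => hy.
  apply: le_trans (one_sub_cos_le y) _.
  by rewrite -[y ^+2]real_normK ?num_real //; have := normr_ge0 y; nra.
apply: le_trans (ltW hy); apply: le_trans (ler_normB _ _) _.
by rewrite normr1; have := cos_max y; lra.
Qed.

Lemma sin_sub_le y : `|sin y - y| <= y ^+ 2.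
Proof.
have [t ht ->] := sin_mvt y.
have -> : y * cos t - y = y * (cos t - 1) by ring.
rewrite normrM -[y ^+ 2]real_normK ?num_real // expr2.
by apply: ler_wpM2l => //; apply: le_trans (abs_cos_sub1_le t) ht.
Qed.

Lemma expR_sub1_np x : x <= 0 -> `|expR x - 1| <= `|x|.
Proof.
move=> x0; rewrite (ler0_norm x0) ler0_norm; last by rewrite subr_le0 expR_le1.
by have := expR_ge1Dx x; lra.
Qed.

Lemma expR_sub1D_le x : `|x| <= 1 / 2 -> `|expR x - 1 - x| <= 2 * x ^+ 2.
Proof.
rewrite ler_norml => /andP[h1 h2].
have e1 := expR_ge1Dx x; have e2 := expR_ge1Dx (- x).
have e0 := expR_gt0 x; have hm := expRxMexpNx_1 x.
have : expR x * (1 - x) <= 1 by rewrite -[leRHS]hm ler_wpM2l ?expR_ge0.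
move=> h; rewrite ger0_norm; last by lra.
have hx : 0 < 1 - x by lra.
have h' : expR x <= (1 - x)^-1 by rewrite -[leRHS]mul1r ler_pdivlMr.
have : (1 - x)^-1 <= 1 + x + 2 * x ^+ 2.
  rewrite -[leLHS]mul1r ler_pdivrMr //.
  have : 0 <= x ^+ 2 * (1 - 2 * x) by rewrite mulr_ge0 ?sqr_ge0 //; lra.
  lra.
lra.
Qed.

(** On the left half-plane the exponential has modulus at most 1, so the linear bound holds without
    restricting |v|. The constant 16 adds 8, a bound for 2 pi, once for the real and once for the
    imaginary part. *)
Lemma ce_sub1_np v : complex.Re v <= 0 -> cabs (ce v - 1) <= 16 * cabs v.
Proof.
move=> hv; set X := 2 * pi * complex.Re v; set Y := 2 * pi * complex.Im v.
have X0 : X <= 0 by rewrite mulr_ge0_le0 // ltW ?tau_gt0.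
have eX : 0 <= expR X <= 1 by rewrite expR_ge0 expR_le1.
pose p : Cplx R := Complex (cos Y - 1) (sin Y).
have -> : ce v - 1 = (expR X - 1)%:C%C + (expR X)%:C%C * p.
  by apply: cplx_ext; rewrite /= -/X -/Y; ring.
apply: le_trans (cabsD _ _) _; rewrite cabsM !cabs_real.
have hp : cabs p <= `|Y|.
  rewrite -ler_sqr ?nnegrE ?cabs_ge0 // cabs_sqr /= real_normK ?num_real //.
  have -> : (cos Y - 1) ^+ 2 + sin Y ^+ 2 = 2 * (1 - cos Y).
    by rewrite sin2cos2; ring.
  by have := one_sub_cos_le Y; rewrite ler_norml => /andP[h _]; lra.
have hX := expR_sub1_np X0.
have nX : `|X| <= 8 * cabs v.
  rewrite /X normrM (gtr0_norm tau_gt0); apply: ler_pM => //.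
  - exact: ltW tau_gt0.
  - exact: tau_le8.
  - exact: cabs_Re.
have nY : `|Y| <= 8 * cabs v.
  rewrite /Y normrM (gtr0_norm tau_gt0); apply: ler_pM => //.
  - exact: ltW tau_gt0.
  - exact: tau_le8.
  - exact: cabs_Im.
have : `|expR X| * cabs p <= `|Y|.
  rewrite ger0_norm ?expR_ge0 //; apply: le_trans hp.
  by rewrite -[leRHS]mul1r ler_wpM2r ?cabs_ge0 //; case/andP: eX.
lra.
Qed.

(** A mean value inequality needing bounds at the two end points only: factoring out the value at
    the point of larger real part leaves an increment in the left half-plane. *)
Lemma ce_lip (M : R) u v : cabs (ce u) <= M -> cabs (ce v) <= M ->
  cabs (ce u - ce v) <= 16 * M * cabs (u - v).
Proof.
wlog h : u v / complex.Re u <= complex.Re v => [hw hu hv|hu hv].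
  case: (lerP (complex.Re u) (complex.Re v)) => h; first exact: hw.
  by rewrite cabs_distC (cabs_distC u); apply: hw => //; exact: ltW.
have -> : ce u - ce v = ce v * (ce (u - v) - 1).
  by rewrite mulrBr -ceD mulr1; congr (ce _ - _); ring.
rewrite cabsM mulrAC mulrC; apply: ler_pM; rewrite ?cabs_ge0 //.
by apply: ce_sub1_np; rewrite cReD cReN subr_le0.
Qed.

(** Taylor remainder of order two. Real and imaginary parts together cost 3 (X^2 + Y^2), that is 3
    (2 pi)^2 |v|^2 with (2 pi)^2 at most 64; 256 is a round upper bound. *)
Lemma ce_sub1D_le v : cabs v <= 1 / 16 ->
  cabs (ce v - 1 - (2 * pi)%:C%C * v) <= 256 * cabs v ^+ 2.
Proof.
move=> hv; set X := 2 * pi * complex.Re v; set Y := 2 * pi * complex.Im v.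
have t0 := tau_gt0; have t8 := tau_le8.
have nX : `|X| <= 1 / 2.
  rewrite /X normrM (gtr0_norm tau_gt0).
  have := le_trans (cabs_Re v) hv; have := normr_ge0 (complex.Re v); nra.
apply: le_trans (cabs_le_ReIm _) _.
have -> : complex.Re (ce v - 1 - (2 * pi)%:C%C * v : Cplx R) =
   (expR X - 1 - X) * cos Y + (1 + X) * (cos Y - 1).
  by rewrite !(cReD, cReN, cReM) /= -/X -/Y; rewrite /X; ring.
have -> : complex.Im (ce v - 1 - (2 * pi)%:C%C * v : Cplx R) =
   (expR X - 1) * sin Y + (sin Y - Y).
  by rewrite !(cImD, cImN, cImM) /= -/X -/Y; rewrite /Y; ring.
have h1 := expR_sub1D_le nX; have h2 := cos_max Y.
have h3 := one_sub_cos_le Y; have h4 := abs_sin_le Y; have h5 := sin_sub_le Y.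
have h6 : `|expR X - 1| <= 2 * `|X|.
  have -> : expR X - 1 = (expR X - 1 - X) + X by ring.
  apply: le_trans (ler_normD _ _) _.
  rewrite -[X^+2]real_normK ?num_real // in h1; have := normr_ge0 X; nra.
have h7 : `|1 + X| <= 2 by apply: le_trans (ler_normD _ _) _; rewrite normr1; lra.
have b1 : `|(expR X - 1 - X) * cos Y + (1 + X) * (cos Y - 1)| <=
   2 * X ^+ 2 + Y ^+ 2.
  apply: le_trans (ler_normD _ _) _; rewrite !normrM; apply: lerD.
    by rewrite -[leRHS]mulr1; apply: ler_pM.
  have -> : Y ^+ 2 = 2 * (Y ^+ 2 / 2) by field.
  exact: ler_pM.
have b2 : `|(expR X - 1) * sin Y + (sin Y - Y)| <= X ^+ 2 + 2 * Y ^+ 2.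
  apply: le_trans (ler_normD _ _) _; rewrite !normrM.
  have : `|expR X - 1| * `|sin Y| <= 2 * `|X| * `|Y| by apply: ler_pM.
  have := sqr_ge0 (`|X| - `|Y|); rewrite sqrrB !real_normK ?num_real //.
  rewrite mulr2n; lra.
have hs : X ^+ 2 + Y ^+ 2 = (2 * pi) ^+ 2 * cabs v ^+ 2.
  by rewrite cabs_sqr /X /Y; ring.
have : (2 * pi) ^+ 2 * cabs v ^+ 2 <= 64 * cabs v ^+ 2.
  by apply: ler_wpM2r; [exact: sqr_ge0|nra].
have := sqr_ge0 X; have := sqr_ge0 Y; have := sqr_ge0 (cabs v); lra.
Qed.

End Exponential.

(** * Complex derivatives and series *)

Section Topology.
Context {R : realType}.
Implicit Types (z w : Cplx R) (x y : R).

(** Balls of [Cplx R] have radii in [R[i]]; a positive element of [R[i]] is real, so real radii and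
    [cabs] describe the same neighbourhoods. *)
Lemma nbhs_cabsP z (A : set (Cplx R)) :
  nbhs z A <-> exists2 e : R, 0 < e & forall w, cabs (w - z) < e -> A w.
Proof.
split=> [|[e e0 he]].
  move=> /nbhs_ballP[e /= e0 he].
  exists (complex.Re e); first by move: e0; rewrite ltcE /= => /andP[].
  move=> w hw; apply: he; rewrite -ball_normE /= distrC cabs_normr.
  by move: e0; rewrite !ltcE /= => /andP[/eqP -> _]; rewrite eqxx.
apply/nbhs_ballP; exists (e%:C%C); first by rewrite /= ltcR.
move=> w; rewrite -ball_normE /= distrC cabs_normr ltcR => hw; exact: he.
Qed.

Lemma cvg_cabsP (T : Type) (F : set_system T) {FF : Filter F} (f : T -> Cplx R) z :
  f @ F --> z <-> forall e : R, 0 < e -> \forall t \near F, cabs (f t - z) < e.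
Proof.
split=> [h e e0|h A /nbhs_cabsP[e e0 he]].
  by apply: (h [set w | cabs (w - z) < e]); apply/nbhs_cabsP; exists e.
by apply: filterS (h e e0) => t; apply: he.
Qed.

Definition ccont (f : Cplx R -> Cplx R) z :=
  forall e : R, 0 < e -> exists2 d : R, 0 < d &
    forall w, cabs (w - z) < d -> cabs (f w - f z) < e.

Lemma ccontP (f : Cplx R -> Cplx R) z : {for z, continuous f} <-> ccont f z.
Proof.
have [P Q] := @cvg_cabsP (Cplx R) (nbhs z) (nbhs_filter z) f (f z).
split=> [h e e0|h]; first by have /nbhs_cabsP := P h e e0.
by apply: Q => e e0; apply/nbhs_cabsP; exact: h.
Qed.

Lemma ccontD f g z : ccont f z -> ccont g z -> ccont (fun w => f w + g w) z.
Proof.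
move=> /ccontP cf /ccontP cg; apply/ccontP.
exact: (@cvgD _ _ _ (nbhs z) (nbhs_filter z) _ _ _ _ cf cg).
Qed.

Lemma ccontM f g z : ccont f z -> ccont g z -> ccont (fun w => f w * g w) z.
Proof.
move=> /ccontP cf /ccontP cg; apply/ccontP.
exact: (@cvgM _ _ (nbhs z) (nbhs_filter z) _ _ _ _ cf cg).
Qed.

Lemma ccont_cst (c : Cplx R) z : ccont (fun=> c) z.
Proof. by move=> e e0; exists 1 => // w _; rewrite subrr cabs0. Qed.

Lemma ccont_comp f g z : ccont g z -> ccont f (g z) -> ccont (f \o g) z.
Proof.
move=> cg cf e e0; have [d d0 hd] := cf e e0; have [d' d'0 hd'] := cg d d0.
by exists d' => // w /hd' /hd.
Qed.

Lemma cabs_ball_open z x : open [set w : Cplx R | cabs (w - z) < x].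
Proof.
rewrite openE => w /= hw; apply/nbhs_cabsP; exists (x - cabs (w - z)).
  by rewrite subr_gt0.
by move=> v hv /=; have := cabs_dist_trans w v z; lra.
Qed.

(** Caratheodory's form of differentiability: the difference quotient extends continuously to [z].
    Sums, products and compositions then reduce to algebraic identities between the quotients. *)
Definition caratheodory (f : Cplx R -> Cplx R) z :=
  exists2 phi : Cplx R -> Cplx R, ccont phi z &
    forall w, f w - f z = phi w * (w - z).

Lemma caratheodory_derivable f z : caratheodory f z -> derivable f z 1.
Proof.
case=> phi cphi hphi; apply/cvg_ex; exists (phi z).
have h : (fun h : Cplx R => phi (h + z)) @ 0^' --> phi z.
  apply: cvg_within_filter; apply/cvg_cabsP => e e0.
  have [d d0 hd] := cphi e e0.
  apply/nbhs_cabsP; exists d => // w; rewrite subr0 => hw.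
  by apply: hd; rewrite addrK.
apply: cvg_trans h; apply: near_eq_cvg; near=> h.
have h0 : h != 0 by near: h; exact: nbhs_dnbhs_neq.
rewrite /= /GRing.scale /= mulr1 hphi addrK mulrCA mulVf ?mulr1 //.
Unshelve. all: by end_near. Qed.

Lemma caratheodory_cont f z : caratheodory f z -> ccont f z.
Proof.
by move=> /caratheodory_derivable /derivable1_diffP /differentiable_continuous /ccontP.
Qed.

Lemma caratheodoryM f g z :
  caratheodory f z -> caratheodory g z -> caratheodory (fun w => f w * g w) z.
Proof.
move=> cf; have kf := caratheodory_cont cf.
case: cf => p cp hp [q cq hq].
exists (fun w => p w * g z + f w * q w).
  by apply: ccontD; apply: ccontM => //; exact: ccont_cst.
move=> w; transitivity ((f w - f z) * g z + f w * (g w - g z)); first by ring.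
by rewrite hp hq; ring.
Qed.

Lemma caratheodoryD f g z :
  caratheodory f z -> caratheodory g z -> caratheodory (fun w => f w + g w) z.
Proof.
case=> p cp hp [q cq hq]; exists (fun w => p w + q w); first exact: ccontD.
move=> w; transitivity ((f w - f z) + (g w - g z)); first by ring.
by rewrite hp hq; ring.
Qed.

Lemma caratheodory_cst (c : Cplx R) z : caratheodory (fun=> c) z.
Proof. by exists (fun=> 0) => [|w]; [exact: ccont_cst|rewrite subrr mul0r]. Qed.

Lemma caratheodory_id z : caratheodory id z.
Proof. by exists (fun=> 1) => [|w]; [exact: ccont_cst|rewrite mul1r]. Qed.

Lemma caratheodory_comp f g z : caratheodory g z -> caratheodory f (g z) ->
  caratheodory (f \o g) z.
Proof.
move=> cg; have kg := caratheodory_cont cg.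
case: cg => q cq hq [p cp hp].
exists (fun w => p (g w) * q w); last by move=> w /=; rewrite hp hq mulrA.
by apply: ccontM => //; apply: (ccont_comp kg cp).
Qed.

End Topology.

(** * Complex series dominated by a geometric series of ratio 1/2 *)

Section ComplexSeries.
Context {R : realType}.
Implicit Types (u v : nat -> Cplx R).

(** Summing real and imaginary parts reduces convergence to real series; the value is meaningful
    under [geo_bounded], the summability condition used throughout. *)
Definition csum u : Cplx R :=
  Complex (limn (series (fun n => complex.Re (u n))))
          (limn (series (fun n => complex.Im (u n)))).

Definition geo_bounded u := exists C : R, forall n, cabs (u n) <= C / 2 ^+ n.

Lemma geo_tail (C : R) (m n : nat) : 0 <= C ->
  \sum_(m <= i < m + n) C / 2 ^+ i <= 2 * C / 2 ^+ m.
Proof.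
move=> C0; suff -> : \sum_(m <= i < m + n) C / 2 ^+ i =
    2 * C / 2 ^+ m - 2 * C / 2 ^+ (m + n).
  by rewrite gerBl divr_ge0 ?exprn_ge0 ?mulr_ge0.
elim: n => [|n IH]; first by rewrite addn0 big_geq ?subrr.
rewrite addnS big_nat_recr ?leq_addr //= IH exprS invfM.
set x := (2 ^+ (m + n))^-1; set y := (2 ^+ m)^-1; lra.
Qed.

Lemma real_geo_series (x : nat -> R) (C : R) : (forall n, `|x n| <= C / 2 ^+ n) ->
  forall m, `|limn (series x) - \sum_(0 <= i < m) x i| <= 2 * C / 2 ^+ m.
Proof.
move=> hx m.
have C0 : 0 <= C by apply: le_trans (normr_ge0 (x 0%N)) _; have := hx 0%N; rewrite expr0 divr1.
have cx : cvgn (series x).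
  apply: normed_cvg; apply: series_le_cvg (hx) _ => [n|n|]; rewrite ?normr_ge0 //.
    by rewrite divr_ge0 ?exprn_ge0.
  have := @is_cvg_geometric_series R C (2^-1).
  rewrite /geometric /=; under eq_fun do rewrite exprVn.
  by apply; rewrite ger0_norm // invf_lt1 // ltr1n.
have h n : (m <= n)%N ->
    `|series x n - \sum_(0 <= i < m) x i| <= 2 * C / 2 ^+ m.
  move=> mn; rewrite /series /= (big_cat_nat (leq0n m) mn) /= addrAC subrr add0r.
  rewrite -(subnKC mn); apply: le_trans (geo_tail m (n - m) C0).
  by apply: le_trans (ler_norm_sum _ _ _) _; apply: ler_sum.
have hc : (fun n => `|series x n - \sum_(0 <= i < m) x i|) @ \oo -->
    `|limn (series x) - \sum_(0 <= i < m) x i|.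
  by apply: cvg_norm; apply: cvgB => //; exact: cvg_cst.
rewrite -(cvg_lim (@Rhausdorff R) hc).
apply: limr_le; first by apply/cvg_ex; eexists; exact: hc.
by near=> n; apply: h; near: n; exact: nbhs_infty_ge.
Unshelve. all: by end_near. Qed.

Lemma cabs_le2 (z : Cplx R) (x y : R) :
  `|complex.Re z| <= x -> `|complex.Im z| <= y -> cabs z <= x + y.
Proof. by move=> hx hy; apply: le_trans (cabs_le_ReIm _) (lerD hx hy). Qed.

Lemma Re_sum u m : complex.Re (\sum_(0 <= i < m) u i) =
  \sum_(0 <= i < m) complex.Re (u i).
Proof.
elim: m => [|m IH]; first by rewrite !big_geq.
by rewrite big_nat_recr //= cReD IH big_nat_recr.
Qed.

Lemma Im_sum u m : complex.Im (\sum_(0 <= i < m) u i) =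
  \sum_(0 <= i < m) complex.Im (u i).
Proof.
elim: m => [|m IH]; first by rewrite !big_geq.
by rewrite big_nat_recr //= cImD IH big_nat_recr.
Qed.

Lemma csum_approx u (C : R) : (forall n, cabs (u n) <= C / 2 ^+ n) ->
  forall m, cabs (csum u - \sum_(0 <= i < m) u i) <= 4 * C / 2 ^+ m.
Proof.
move=> hu m; have -> : 4 * C / 2 ^+ m = 2 * C / 2 ^+ m + 2 * C / 2 ^+ m by ring.
apply: cabs_le2.
  rewrite cReD cReN Re_sum /=; apply: real_geo_series => n.
  exact: le_trans (cabs_Re _) (hu n).
rewrite cImD cImN Im_sum /=; apply: real_geo_series => n.
exact: le_trans (cabs_Im _) (hu n).
Qed.

Lemma geo_small (C e : R) : 0 < e -> exists m : nat, C / 2 ^+ m < e.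
Proof.
move=> e0; have [C0|C0] := lerP C 0.
  by exists 0%N; rewrite expr0 divr1; lra.
exists (Num.truncn (C / e)).+1; rewrite ltr_pdivrMr ?exprn_gt0 // mulrC -ltr_pdivrMr //.
apply: lt_trans (truncnS_gt _) _.
by rewrite -natrX ltr_nat; exact: ltn_expl.
Qed.

(** Two numbers approximated by the same partial sums up to geometric errors coincide. Linearity of
    [csum] is read off from the partial sums in this way. *)
Lemma csum_unique u (C : R) (s : Cplx R) :
  geo_bounded u ->
  (forall m, cabs (s - \sum_(0 <= i < m) u i) <= C / 2 ^+ m) -> csum u = s.
Proof.
move=> [K hK] hs; apply/eqP; rewrite -subr_eq0; apply/eqP/cabs_eq0/eqP.
rewrite eq_le cabs_ge0 andbT leNgt; apply/negP => h.
have [m] := geo_small (4 * K + C) h; apply/negP; rewrite -leNgt.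
have := csum_approx hK m; have := hs m.
set S := \sum_(0 <= i < m) u i; rewrite cabs_distC => h1 h2.
by rewrite mulrDl; have := cabs_dist_trans S (csum u) s; lra.
Qed.

Lemma cabs_csum_le u (M : R) : geo_bounded u ->
  (forall m, cabs (\sum_(0 <= i < m) u i) <= M) -> cabs (csum u) <= M.
Proof.
move=> [K hK] hM; rewrite leNgt; apply/negP; rewrite -subr_gt0 => h.
have [m] := geo_small (4 * K) h; apply/negP; rewrite -leNgt.
have := csum_approx hK m; have := hM m; set S := \sum_(0 <= i < m) u i => h1 h2.
by have := cabsD (csum u - S) S; rewrite subrK; lra.
Qed.

Lemma geo_boundedD u v : geo_bounded u -> geo_bounded v ->
  geo_bounded (fun n => u n + v n).
Proof.
move=> [K hK] [L hL]; exists (K + L) => n; rewrite mulrDl.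
exact: le_trans (cabsD _ _) (lerD (hK n) (hL n)).
Qed.

Lemma geo_boundedZ c u : geo_bounded u -> geo_bounded (fun n => c * u n).
Proof.
move=> [K hK]; exists (cabs c * K) => n; rewrite cabsM -mulrA.
by apply: ler_wpM2l; rewrite ?cabs_ge0.
Qed.

Lemma csumD u v : geo_bounded u -> geo_bounded v ->
  csum (fun n => u n + v n) = csum u + csum v.
Proof.
move=> bu bv; have [K hK] := bu; have [L hL] := bv.
apply: (@csum_unique _ (4 * K + 4 * L)); first exact: geo_boundedD.
move=> m; rewrite big_split /= opprD addrACA mulrDl.
by apply: le_trans (cabsD _ _) (lerD (csum_approx hK m) (csum_approx hL m)).
Qed.

Lemma csumZ c u : geo_bounded u -> csum (fun n => c * u n) = c * csum u.
Proof.
move=> bu; have [K hK] := bu.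
apply: (@csum_unique _ (cabs c * (4 * K))); first exact: geo_boundedZ.
move=> m; rewrite -mulr_sumr -mulrBr cabsM -[leRHS]mulrA.
by apply: ler_wpM2l; rewrite ?cabs_ge0 //; exact: csum_approx.
Qed.

Lemma csumB u v : geo_bounded u -> geo_bounded v ->
  csum (fun n => u n - v n) = csum u - csum v.
Proof.
move=> bu bv; rewrite -[in RHS]mulN1r -(csumZ _ bv) -csumD //; last exact: geo_boundedZ.
by congr csum; apply/funext => n; rewrite mulN1r.
Qed.

(** Isolates the one room that is not small near a given point from the series of all the others. *)
Lemma csumD1 u k : geo_bounded u ->
  csum u = u k + csum (fun n => if n == k then 0 else u n).
Proof.
move=> bu; have [K hK] := bu.
have bk : geo_bounded (fun n => if n == k then u k else 0).
  exists (cabs (u k) * 2 ^+ k) => n; case: eqVneq => [->|_].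
    by rewrite mulfK.
  by rewrite cabs0 divr_ge0 ?exprn_ge0 // mulr_ge0 ?cabs_ge0 ?exprn_ge0.
have b' : geo_bounded (fun n => if n == k then 0 else u n).
  exists K => n; case: eqP => // _; rewrite cabs0.
  exact: le_trans (cabs_ge0 _) (hK n).
have -> : u = (fun n => (if n == k then u k else 0) + (if n == k then 0 else u n)).
  by apply/funext => n; case: eqP => [->|]; rewrite ?addr0 ?add0r.
rewrite csumD //; congr (_ + _); last first.
  by congr csum; apply/funext => n; case: eqP => // _; rewrite add0r.
rewrite eqxx addr0; apply: (@csum_unique _ (cabs (u k) * 2 ^+ k.+1)) => // m.
case: (ltnP k m) => km.
  rewrite (bigD1_seq k) ?mem_index_iota ?iota_uniq //= eqxx big1 => [|i /negPf -> //].
  rewrite addr0 subrr cabs0 divr_ge0 ?exprn_ge0 // mulr_ge0 ?cabs_ge0 ?exprn_ge0 //.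
rewrite big_nat big1 => [|i /andP[_ im]]; last first.
  by case: eqP im => // ->; rewrite ltnNge km.
rewrite subr0 -mulrA -[leLHS]mulr1 ler_wpM2l ?cabs_ge0 //.
by rewrite ler_pdivlMr ?exprn_gt0 // mul1r ler_eXn2l ?ltr1n // (leq_trans km).
Qed.

End ComplexSeries.

(** * A covering criterion *)

Section LinearApproximation.
Context {R : realType}.
Variables (h : Cplx R -> Cplx R) (a0 L : Cplx R) (eta : R).
Hypothesis eta0 : 0 < eta.
Hypothesis L0 : L != 0.
Hypothesis hL : forall a b, cabs (a - a0) <= eta -> cabs (b - a0) <= eta ->
  cabs (h a - h b - L * (a - b)) <= cabs L / 2 * cabs (a - b).

Lemma lin_approx_lb a b : cabs (a - a0) <= eta -> cabs (b - a0) <= eta ->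
  cabs L / 2 * cabs (a - b) <= cabs (h a - h b).
Proof.
move=> ha hb; have := hL ha hb.
have := cabs_lbB (L * (a - b)) (L * (a - b) - (h a - h b)).
rewrite subKr (cabs_distC _ (h a - h b)) cabsM; lra.
Qed.

Lemma lin_approx_ub a b : cabs (a - a0) <= eta -> cabs (b - a0) <= eta ->
  cabs (h a - h b) <= 3 / 2 * cabs L * cabs (a - b).
Proof.
move=> ha hb; have := hL ha hb.
have := cabsD (h a - h b - L * (a - b)) (L * (a - b)).
rewrite subrK cabsM; lra.
Qed.

Lemma lin_approx_inj a b : cabs (a - a0) <= eta -> cabs (b - a0) <= eta ->
  h a = h b -> a = b.
Proof.
move=> ha hb e; have := lin_approx_lb ha hb; rewrite e subrr cabs0 => hab.
apply/eqP; rewrite -subr_eq0; apply/eqP/cabs_eq0/eqP.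
by rewrite eq_le cabs_ge0 andbT -(pmulr_rle0 _ (x := cabs L / 2)) // divr_gt0 ?cabs_gt0.
Qed.

Lemma lin_approx_surj y : cabs (y - h a0) <= cabs L / 2 * eta ->
  exists2 a, cabs (a - a0) <= eta & h a = y.
Proof.
move=> hy; have nL := cabs_gt0 L0.
pose x := fix x n := if n is m.+1 then x m - (h (x m) - y) / L else a0.
have xS n : x n.+1 - x n = - ((h (x n) - y) / L) by rewrite /= addrC addKr.
have e2 n : (0 : R) < 2 ^+ n by rewrite exprn_gt0.
have step n : cabs (x n.+1 - x n) = cabs (h (x n) - y) / cabs L.
  by rewrite xS cabsN cabsM cabsV.
have main n : cabs (h (x n) - y) <= cabs L / 2 * eta / 2 ^+ n /\
   cabs (x n - a0) <= eta * (1 - 1 / 2 ^+ n).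
  elim: n => [|n [IH1 IH2]].
    by rewrite expr0 divr1 cabs_distC subrr cabs0 divr1 subrr mulr0.
  have st : cabs (x n.+1 - x n) <= eta / 2 ^+ n.+1.
    rewrite step ler_pdivrMr // exprS invfM.
    by apply: le_trans IH1 _; rewrite le_eqVlt; apply/orP; left; apply/eqP; ring.
  have b1 : cabs (x n.+1 - a0) <= eta * (1 - 1 / 2 ^+ n.+1).
    have := cabs_dist_trans (x n) (x n.+1) a0.
    move: st IH2; rewrite exprS invfM; set q := (2 ^+ n)^-1; lra.
  split=> //.
  have b0 m : eta * (1 - 1 / 2 ^+ m) <= eta.
    rewrite -[leRHS]mulr1; apply: ler_wpM2l; first exact: ltW.
    by rewrite gerBl divr_ge0 // ltW.
  have -> : h (x n.+1) - y = h (x n.+1) - h (x n) - L * (x n.+1 - x n).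
    by rewrite xS mulrN mulrCA mulfV //; ring.
  apply: le_trans (hL (le_trans b1 (b0 _)) (le_trans IH2 (b0 _))) _.
  rewrite -[leRHS]mulrA; apply: ler_wpM2l => //.
  by rewrite divr_ge0 // cabs_ge0.
have b0 m : cabs (x m - a0) <= eta.
  have [_ hm] := main m; apply: le_trans hm _.
  rewrite -[leRHS]mulr1; apply: ler_wpM2l; first exact: ltW.
  by rewrite gerBl divr_ge0 // ltW.
pose u n := x n.+1 - x n.
have hu n : cabs (u n) <= (eta / 2) / 2 ^+ n.
  rewrite /u step ler_pdivrMr //; have [hm _] := main n; apply: le_trans hm _.
  by rewrite le_eqVlt; apply/orP; left; apply/eqP; ring.
have su m : \sum_(0 <= i < m) u i = x m - a0.
  by rewrite /u telescope_sumr.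
have ha : cabs (csum u + a0 - a0) <= eta.
  by rewrite addrK; apply: cabs_csum_le => [|m]; [exists (eta / 2)|rewrite su].
exists (csum u + a0) => //; apply/eqP; rewrite -subr_eq0; apply/eqP/cabs_eq0/eqP.
rewrite eq_le cabs_ge0 andbT leNgt; apply/negP => h0.
(* Moving from the limit to the m-th iterate costs at most 3 |L| eta / 2^m, and the residual of that
   iterate adds |L| eta / 2^(m+1). *)
have [m] := geo_small (4 * cabs L * eta) h0; apply/negP; rewrite -leNgt.
have := csum_approx hu m; rewrite su opprB addrA => c1.
have c2 := lin_approx_ub ha (b0 m); have [c3 _] := main m.
have c4 := cabs_dist_trans (h (x m)) (h (csum u + a0)) y.
have c5 : 3 / 2 * cabs L * cabs (csum u + a0 - x m) <=
   3 / 2 * cabs L * (4 * (eta / 2) / 2 ^+ m).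
  by apply: ler_wpM2l => //; rewrite mulr_ge0 // ?cabs_ge0.
have c6 : 0 <= cabs L * eta / 2 ^+ m by rewrite divr_ge0 ?mulr_ge0 // ltW.
move: c3 c5 c6; set q := (2 ^+ m)^-1; lra.
Qed.

End LinearApproximation.

(** * Unique continuation of sections and evenly covered discs *)

Section Covering.
Context {R : realType}.

(** Connectedness of the unit interval as an induction principle: the points near which P holds and
    those near which it fails form two open sets that exhaust the interval. *)
Lemma unit_interval_ind (P : R -> Prop) : P 0 ->
  (forall t, 0 <= t <= 1 -> P t -> exists2 e, 0 < e &
     forall s, 0 <= s <= 1 -> `|s - t| < e -> P s) ->
  (forall t, 0 <= t <= 1 -> ~ P t -> exists2 e, 0 < e &
     forall s, 0 <= s <= 1 -> `|s - t| < e -> ~ P s) ->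
  P 1.
Proof.
move=> P0 Po Pc.
pose near (Q : R -> Prop) := [set t : R | exists2 e, 0 < e &
  forall s, 0 <= s <= 1 -> `|s - t| < e -> Q s].
have onear Q : open (near Q).
  rewrite openE => t [e e0 he]; apply/nbhs_ballP; exists (e / 2) => /=; first lra.
  move=> s; rewrite -ball_normE /= => hs; exists (e / 2); first lra.
  move=> v hv hvs; apply: he => //; have := ler_distD s v t.
  by rewrite (distrC s t) => h; lra.
have := @segment_connected R 0 1 (`[0, 1] `&` near P).
have i01 (t : R) : `[0, 1]%classic t <-> 0 <= t <= 1 by rewrite /= in_itv.
have e1 : `[0, 1]%classic `&` near P = `[0, 1]%classic `&` ~` near (fun t => ~ P t).
  apply/seteqP; split => t [/i01 ht].
    move=> [e e0 he]; split; first exact/i01.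
    move=> [d d0 hd]; have : `|t - t| < e by rewrite subrr normr0.
    move=> /(he t ht) Pt; have : `|t - t| < d by rewrite subrr normr0.
    by move=> /(hd t ht); apply.
  move=> nt; split; first exact/i01; apply: Po => //; apply: contrapT => nP.
  by apply: nt; exact: Pc.
move=> hc.
have e : `[0, 1]%classic `&` near P = `[0, 1]%classic.
  apply: hc.
  - exists 0; split; first by apply/i01; rewrite lexx ler01.
    by apply: Po => //; rewrite lexx ler01.
  - by exists (near P).
  - by exists (~` near (fun t => ~ P t)) => //; apply: open_closedC.
have : (`[0, 1]%classic : set R) 1 by apply/i01; rewrite lexx ler01.
rewrite -e => -[_ [d d0 hd]]; apply: hd; first by rewrite lexx ler01.
by rewrite subrr normr0.
Qed.

Variables (f : Cplx R -> Cplx R) (r0 : R).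
Hypothesis cf : forall z, ccont f z.
Hypothesis f_inj : forall z0, r0 < cabs (f z0) -> exists2 d, 0 < d &
  forall z z', cabs (z - z0) < d -> cabs (z' - z0) < d -> f z = f z' -> z = z'.

Definition disc_section (g : Cplx R -> Cplx R) (w0 : Cplx R) (r : R) :=
  forall w, cabs (w - w0) < r -> f (g w) = w /\ ccont g w.

(** Along the segment from [w1] to [w2] the agreement of the two sections is an open condition, by
    local injectivity of [f], and so is their disagreement, by continuity. *)
Lemma disc_section_unique g0 g1 w0 r :
  disc_section g0 w0 r -> disc_section g1 w0 r ->
  (forall w, cabs (w - w0) < r -> r0 < cabs w) ->
  forall w1 w2, cabs (w1 - w0) < r -> cabs (w2 - w0) < r ->
  g0 w1 = g1 w1 -> g0 w2 = g1 w2.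
Proof.
move=> h0 h1 hr w1 w2 hw1 hw2 e.
pose c (t : R) : Cplx R := w1 + t%:C%C * (w2 - w1).
have cB t : 0 <= t <= 1 -> cabs (c t - w0) < r.
  move=> /andP[t0 t1].
  have -> : c t - w0 = (1 - t)%:C%C * (w1 - w0) + t%:C%C * (w2 - w0).
    by rewrite /c rmorphB rmorph1; ring.
  apply: le_lt_trans (cabsD _ _) _; rewrite !cabsM !cabs_real.
  rewrite !ger0_norm ?subr_ge0 //.
  case: (ltrgtP t 0) t0 => // [t0 _|-> _]; last first.
    by rewrite subr0 mul1r mul0r addr0.
  by have := cabs_ge0 (w1 - w0); nra.
have cc t s : cabs (c s - c t) = `|s - t| * cabs (w2 - w1).
  by rewrite -cabs_real -cabsM /c rmorphB; congr cabs; ring.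
have cont t (d : R) : 0 < d -> exists2 e, 0 < e &
    forall s, `|s - t| < e -> cabs (c s - c t) < d.
  move=> d0; exists (d / (cabs (w2 - w1) + 1)).
    by rewrite divr_gt0 // ltr_wpDl ?cabs_ge0.
  move=> s; rewrite ltr_pdivlMr ?ltr_wpDl ?cabs_ge0 // => hs; rewrite cc.
  by apply: le_lt_trans hs; apply: ler_wpM2l => //; lra.
have -> : w2 = c 1 by rewrite /c rmorph1; ring.
apply: (unit_interval_ind (P := fun t => g0 (c t) = g1 (c t))).
- by have -> : c 0 = w1; rewrite // /c rmorph0; ring.
- move=> t ht et.
  have [f0 c0] := h0 _ (cB t ht); have [f1 c1] := h1 _ (cB t ht).
  have [d d0 hd] : exists2 d, 0 < d & forall z z', cabs (z - g0 (c t)) < d ->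
      cabs (z' - g0 (c t)) < d -> f z = f z' -> z = z'.
    by apply: f_inj; rewrite f0; apply/hr/cB.
  have [d1 d10 hd1] := c0 d d0; have [d2 d20 hd2] := c1 d d0.
  have [e' e'0 he'] : exists2 e', 0 < e' & forall s, `|s - t| < e' ->
      cabs (c s - c t) < Num.min d1 d2 by apply: cont; rewrite lt_min d10.
  exists e' => // s hs /he'; rewrite lt_min => /andP[s1 s2].
  apply: hd; [exact: hd1|rewrite et; exact: hd2|].
  by rewrite (h0 _ (cB s hs)).1 (h1 _ (cB s hs)).1.
- move=> t ht /eqP et.
  have [_ c0] := h0 _ (cB t ht); have [_ c1] := h1 _ (cB t ht).
  pose d := cabs (g0 (c t) - g1 (c t)) / 2.
  have d0 : 0 < d by rewrite divr_gt0 // cabs_gt0 // subr_eq0.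
  have [d1 d10 hd1] := c0 d d0; have [d2 d20 hd2] := c1 d d0.
  have [e' e'0 he'] : exists2 e', 0 < e' & forall s, `|s - t| < e' ->
      cabs (c s - c t) < Num.min d1 d2 by apply: cont; rewrite lt_min d10.
  exists e' => // s hs /he'; rewrite lt_min => /andP[/hd1 s1 /hd2 s2] es.
  have := cabs_dist_trans (g0 (c s)) (g0 (c t)) (g1 (c t)).
  by rewrite (cabs_distC (g0 (c t)) (g0 (c s))) {2}es => h; rewrite /d in s1 s2; lra.
Qed.

(* Right inverses on discs of radius proportional to the modulus of the centre:
   such discs overlap enough for the sheets to be exhausted. *)
Lemma covering_of_disc_sections (rho : R) : 0 <= r0 -> 0 < rho <= 1 / 2 ->
  (forall z0, r0 < cabs (f z0) -> exists2 g, g (f z0) = z0 &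
     disc_section g (f z0) (rho * cabs (f z0))) ->
  covering_over f (~` [set w | cabs w <= 2 * r0]).
Proof.
move=> r00 /andP[rho0 rho1] H.
have /choice[G hG] : forall z0, exists g, r0 < cabs (f z0) -> g (f z0) = z0 /\
    disc_section g (f z0) (rho * cabs (f z0)).
  move=> z0; case: (ltP r0 (cabs (f z0))) => h; last by exists id.
  by have [g g1 g2] := H z0 h; exists g.
move=> w0 /= /negP; rewrite -ltNge => hw0.
(* If [f z] lies within r of [w0], every point of the disc V is within 2r of [f z]. The first bound
   makes this less than rho |f z|, so that V lies in the disc of the section through [z]; the second
   keeps V outside the closed disc of radius 2 [r0]. *)
pose r := Num.min (rho * cabs w0 / 4) (cabs w0 - 2 * r0).
have r_gt0 : 0 < r by rewrite lt_min subr_gt0 hw0 andbT; nra.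
have r1 : r <= rho * cabs w0 / 4 by rewrite ge_min lexx.
have r2 : r <= cabs w0 - 2 * r0 by rewrite ge_min lexx orbT.
have rV w : cabs (w - w0) < r -> 2 * r0 < cabs w.
  by have := cabs_lbB w0 (w0 - w); rewrite subKr (cabs_distC w0); lra.
have rV' w : cabs (w - w0) < r -> r0 < cabs w by move=> /rV; lra.
pose V : set (Cplx R) := [set w | cabs (w - w0) < r].
have Gr z : cabs (f z - w0) < r -> disc_section (G z) w0 r.
  move=> hz w hw; apply: (hG z (rV' _ hz)).2.
  have := cabs_dist_trans w0 w (f z); rewrite (cabs_distC w0).
  have := cabs_lbB w0 (w0 - f z); rewrite subKr (cabs_distC w0) => h1 h2.
  have h3 : rho * (cabs w0 - r) <= rho * cabs (f z).
    by apply: ler_wpM2l; [exact: ltW|lra].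
  have h4 : rho * r <= 1 / 2 * r by apply: ler_wpM2r; [exact: ltW|].
  lra.
have uniq z1 z2 w1 w2 : cabs (f z1 - w0) < r -> cabs (f z2 - w0) < r ->
    V w1 -> V w2 -> G z1 w1 = G z2 w1 -> G z1 w2 = G z2 w2.
  by move=> h1 h2 v1 v2; apply: (disc_section_unique (Gr _ h1) (Gr _ h2) rV').
have V0 : V w0 by rewrite /V /= subrr cabs0.
(* The image of V under the section [G z0], written as a fixed point condition over V. The sheets
   are indexed by the fibre over [w0]. *)
pose W z0 : set (Cplx R) := [set z | V (f z) /\ G z0 (f z) = z].
exists V; split=> //; first exact: cabs_ball_open.
  by move=> w /rV h /=; apply/negP; rewrite -ltNge.
exists [set W z0 | z0 in [set z0 | f z0 = w0]]; split.
(* Sheets are open: for z' near z the points z' and G z0 (f z') are both near z and have the same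
   image, so local injectivity identifies them. *)
- move=> _ [z0 /= e0 <-]; rewrite openE => z [Vz Gz]; apply/nbhs_cabsP.
  have Gr0 : disc_section (G z0) w0 r by apply: Gr; rewrite e0.
  have [d d0 hd] := f_inj (rV' _ Vz).
  have [_ cG] := Gr0 _ Vz; have [d1 d10 hd1] := cG d d0.
  have /nbhs_cabsP[d2 d20 hd2] : nbhs (f z) V.
    by have := @cabs_ball_open _ w0 r; rewrite openE; apply.
  have [d3 d30 hd3] := cf z (e := Num.min d1 d2) ltac:(by rewrite lt_min d10).
  exists (Num.min d d3); first by rewrite lt_min d0.
  move=> z'; rewrite lt_min => /andP[hz1 /hd3]; rewrite lt_min => /andP[hz2 hz3].
  have Vz' := hd2 _ hz3; split=> //.
  by apply: hd => //; [rewrite -Gz; exact: hd1|exact: (Gr0 _ Vz').1].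
- move=> _ _ [z0 /= e0 <-] [z1 /= e1 <-] [z [[Vz G0] [_ G1]]].
  have E w : V w -> G z0 w = G z1 w.
    move=> Vw; apply: (uniq _ _ (f z)); rewrite ?e0 ?e1 // G0 G1 //.
  by apply/seteqP; split=> y [Vy]; rewrite ?E // => h; split=> //; rewrite E.
(* Sheets exhaust the preimage: the section through [z] meets the fibre over [w0] at [G z w0], and
   by uniqueness it is the section issued from that point. *)
- apply/seteqP; split=> z.
    move=> Vz; have [fG cG] := Gr z Vz _ V0.
    exists (W (G z w0)); first by exists (G z w0).
    split=> //; have [e1 _] := hG z (rV' _ Vz); rewrite -[RHS]e1.
    apply: (uniq _ _ w0) => //; first by rewrite fG.
    have := (hG (G z w0) ltac:(by rewrite fG; apply: rV')).1.
    by rewrite fG.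
  by move=> [_ [z0 /= e0 <-]] [].
- move=> _ [z0 /= e0 <-]; exists (G z0).
  have Gr0 : disc_section (G z0) w0 r by apply: Gr; rewrite e0.
  split=> //.
  + by move=> y Vy; have [fy _] := Gr0 _ Vy; rewrite /W /= fy.
  + by apply: continuous_subspaceT => z; apply/ccontP; exact: cf.
  + apply: continuous_in_subspaceT => w /set_mem Vw; apply/ccontP.
    exact: (Gr0 _ Vw).2.
Qed.

End Covering.

(** * Room functions *)

Section RoomFunction.
Context {R : realType}.
Implicit Types (z w u v a b q : Cplx R).

Lemma ccontV (g : Cplx R -> Cplx R) z : ccont g z -> g z != 0 ->
  ccont (fun w => (g w)^-1) z.
Proof.
move=> /ccontP cg gz; apply/ccontP.
exact: (@cvgV _ _ (nbhs z) (nbhs_filter z) _ _ gz cg).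
Qed.

Lemma caratheodory_ce z : caratheodory (@ce R) z.
Proof.
pose k : Cplx R := (2 * pi)%:C%C.
exists (fun w => if w == z then k * ce z else (ce w - ce z) / (w - z)); last first.
  move=> w; case: eqVneq => [->|wz]; first by rewrite !subrr mulr0.
  by rewrite mulfVK // subr_eq0.
move=> e e0; have p := cabs_ce_gt0 z.
have p256 : 0 < 256 * cabs (ce z) by lra.
exists (Num.min (1 / 16) (e / (256 * cabs (ce z)))).
  by rewrite lt_min; apply/andP; split; exact: divr_gt0.
move=> w; rewrite eqxx lt_min => /andP[h1].
case: eqVneq => [_ _|wz]; first by rewrite subrr cabs0.
rewrite (ltr_pdivlMr _ _ p256) => h2.
have wz0 : w - z != 0 by rewrite subr_eq0.
have -> : (ce w - ce z) / (w - z) - k * ce z =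
   ce z * (ce (w - z) - 1 - k * (w - z)) / (w - z).
  have -> : ce w = ce z * ce (w - z) by rewrite -ceD; congr ce; ring.
  by field.
rewrite !cabsM cabsV ltr_pdivrMr ?cabs_gt0 //.
have h3 := ce_sub1D_le (ltW h1); have p' := cabs_gt0 wz0.
apply: le_lt_trans (ler_wpM2l (ltW p) h3) _; nra.
Qed.

Let sh v : Cplx R := ce v - ce (- v).

Lemma caratheodoryN z : caratheodory (@GRing.opp (Cplx R)) z.
Proof. by exists (fun=> -1) => [|w]; [exact: ccont_cst|ring]. Qed.

Let caratheodory_sh z : caratheodory sh z.
Proof.
apply: caratheodoryD; first exact: caratheodory_ce.
apply: (caratheodory_comp (f := @GRing.opp (Cplx R)) (g := fun w => ce (- w))).
  apply: (caratheodory_comp (f := @ce R)); first exact: caratheodoryN.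
  exact: caratheodory_ce.
exact: caratheodoryN.
Qed.

(** The quotient 2 sinh(2 pi v)/v. At 0 its continuity is the differentiability of sinh; it supplies
    the difference quotient of [coshsqrt], at the branch point as elsewhere. *)
Lemma sinhc_exists : exists2 psi : Cplx R -> Cplx R,
  forall v, psi v * v = ce v - ce (- v) & forall v, ccont psi v.
Proof.
have [psi cpsi hpsi] := caratheodory_sh 0.
have e v : psi v * v = sh v.
  by have := hpsi v; rewrite subr0 {2}/sh oppr0 subrr subr0.
exists psi => // v.
case: (eqVneq v 0) => [-> //|v0].
have cq : ccont (fun w => sh w * w^-1) v.
  apply: ccontM; first exact: caratheodory_cont (caratheodory_sh v).
  by apply: (ccontV (g := id)) => // d d0; exists d.
move=> d d0; have [d1 d10 hd1] := cq d d0.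
have p := cabs_gt0 v0.
exists (Num.min d1 (cabs v)); first by rewrite lt_min d10.
move=> w; rewrite lt_min => /andP[/hd1 h1 h2].
have w0 : w != 0.
  by apply: contraTneq h2 => ->; rewrite sub0r cabsN ltxx.
by move: h1; rewrite -!e !mulfK.
Qed.

(* 2 cosh (2 pi sqrt q), which is even in the square root, hence entire in q. *)
Definition coshsqrt q : Cplx R := ce (sqrtc q) + ce (- sqrtc q).

Lemma coshsqrt_root r : coshsqrt (r ^+ 2) = ce r + ce (- r).
Proof.
rewrite /coshsqrt; have /eqP := sqr_sqrtc (r ^+ 2); rewrite eqf_sqr.
by case/orP => /eqP ->; rewrite // opprK addrC.
Qed.

(** With roots r of q and r0 of q0, the difference of the two hyperbolic cosines is a product of
    sinh at (r + r0)/2 and at (r - r0)/2, while q - q0 = (r + r0)(r - r0). The quotient is thus a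
    product of two values of the function from [sinhc_exists], with no special case at q0 = 0. *)
Lemma caratheodory_coshsqrt q0 : caratheodory coshsqrt q0.
Proof.
have [psi hpsi cpsi] := sinhc_exists.
pose r0 : Cplx R := sqrtc q0.
have r02 : r0 ^+ 2 = q0 := sqr_sqrtc q0.
(* Of the two roots the one nearer to [r0]: then |r - r0|^2 <= |q - q0|, so r is continuous at q0
   whatever the branch cut of [sqrtc]. *)
pose r q : Cplx R :=
  if cabs (sqrtc q - r0) <= cabs (sqrtc q + r0) then sqrtc q else - sqrtc q.
have r2 q : r q ^+ 2 = q.
  by rewrite /r; case: ifP => _; rewrite ?sqrrN; exact: sqr_sqrtc.
have rle q : cabs (r q - r0) <= cabs (r q + r0).
  rewrite /r; case: ifPn => //; rewrite -ltNge => /ltW.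
  have -> : - sqrtc q - r0 = - (sqrtc q + r0) :> Cplx R by ring.
  have -> : - sqrtc q + r0 = - (sqrtc q - r0) :> Cplx R by ring.
  by rewrite !cabsN.
have rq0 : r q0 = r0 by rewrite /r -/r0 subrr cabs0 cabs_ge0.
have rd q : cabs (r q - r0) ^+ 2 <= cabs (q - q0).
  rewrite -{2}(r2 q) -r02 subr_sqr cabsM expr2.
  by apply: ler_wpM2l; rewrite ?cabs_ge0.
have cr : ccont r q0.
  move=> e e0; exists (e ^+ 2); first by rewrite exprn_gt0.
  move=> q hq; rewrite rq0 -ltr_sqr ?nnegrE ?cabs_ge0 ?ltW //.
  exact: le_lt_trans (rd q) hq.
have cs (c : Cplx R) : ccont (fun q => (r q + c) * 2^-1) q0.
  by apply: ccontM; [apply: ccontD => //|]; exact: ccont_cst.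
exists (fun q => 4^-1 * (psi ((r q + r0) * 2^-1) * psi ((r q + - r0) * 2^-1))).
  apply: ccontM; first exact: ccont_cst.
  by apply: ccontM; [apply: (ccont_comp (f := psi) (cs r0))
                    |apply: (ccont_comp (f := psi) (cs (- r0)))]; exact: cpsi.
move=> q; rewrite -{1}(r2 q) -{1}r02 !coshsqrt_root.
set s := (r q + r0) * 2^-1; set d := (r q + - r0) * 2^-1.
have -> : q - q0 = 4 * (s * d) by rewrite /s /d -{1}(r2 q) -r02; field.
transitivity ((psi s * s) * (psi d * d)); last by field.
rewrite !hpsi.
have es : r q = s + d by rewrite /s /d; field.
have ed : r0 = s - d by rewrite /s /d; field.
by rewrite es ed !opprD opprK !ceD; ring.
Qed.

(* Equal to e a + e b - 1 - e z for the roots a, b of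
   u ^+ 2 - (z - i N) u - (N - 1), see [room_roots]; the constant makes it
   small both for |z| much smaller and for |z| much larger than N. *)
Definition room (N : nat) z : Cplx R :=
  let w := z - Complex 0 N%:R in
  ce (w / 2) * coshsqrt ((w / 2) ^+ 2 + (N%:R - 1)) - 1 - ce z.

Lemma room_roots (N : nat) z a b :
  a + b = z - Complex 0 N%:R -> a * b = 1 - N%:R ->
  room N z = ce a + ce b - 1 - ce z.
Proof.
move=> hs hp; rewrite /room -hs.
have -> : ((a + b) / 2) ^+ 2 + (N%:R - 1) = ((a - b) / 2) ^+ 2.
  have -> : N%:R = 1 - a * b :> Cplx R by rewrite hp; ring.
  by field.
rewrite coshsqrt_root mulrDr -!ceD; congr (ce _ + ce _ - 1 - _); by field.
Qed.

(** Since ab = 1 - N is real and at most 0, (1 - N) Re a = |a|^2 Re b; hence the real parts of the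
    two roots cannot both be negative. *)
Lemma room_roots_exist (N : nat) z : (0 < N)%N -> exists a b : Cplx R,
  [/\ a + b = z - Complex 0 N%:R, a * b = 1 - N%:R & 0 <= complex.Re a].
Proof.
move=> N0; pose w := z - Complex 0 N%:R : Cplx R.
pose q : Cplx R := (w / 2) ^+ 2 + (N%:R - 1).
have q2 := sqr_sqrtc q; set r : Cplx R := sqrtc q in q2.
have hs : (w / 2 + r) + (w / 2 - r) = w by field.
have hp : (w / 2 + r) * (w / 2 - r) = 1 - N%:R.
  have -> : (w / 2 + r) * (w / 2 - r) = (w / 2) ^+ 2 - r ^+ 2 by ring.
  by rewrite q2 /q; ring.
case: (lerP 0 (complex.Re (w / 2 + r))) => h.
  by exists (w / 2 + r), (w / 2 - r).
case: (lerP 0 (complex.Re (w / 2 - r))) => h'.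
  by exists (w / 2 - r), (w / 2 + r); split => //; [rewrite -[RHS]hs addrC|rewrite -[RHS]hp mulrC].
exfalso; set a := w / 2 + r in h hp; set b := w / 2 - r in h' hp.
have hN : 1 - N%:R = (1 - N%:R : R)%:C%C :> Cplx R.
  by rewrite rmorphB rmorph1 rmorph_nat.
have h1 : (1 - N%:R : R) = complex.Re a * complex.Re b - complex.Im a * complex.Im b.
  by have e := cReM a b; rewrite hp hN in e; exact: e.
have h2 : (0 : R) = complex.Re a * complex.Im b + complex.Im a * complex.Re b.
  by have e := cImM a b; rewrite hp hN in e; exact: e.
have N1 : 1 <= N%:R :> R by rewrite ler1n.
have e : complex.Re a * (1 - N%:R) = complex.Re b * cabs a ^+ 2.
  rewrite cabs_sqr h1.
  apply/eqP; rewrite -subr_eq0; apply/eqP.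
  transitivity (- complex.Im a *
    (complex.Re a * complex.Im b + complex.Im a * complex.Re b)); first by ring.
  by rewrite -h2 mulr0.
have p : 0 < cabs a ^+ 2.
  by rewrite exprn_gt0 // cabs_gt0 //; apply: contraTneq h => ->; rewrite ltxx.
have : complex.Re b * cabs a ^+ 2 < 0 by rewrite pmulr_llt0.
by rewrite -e; apply/negP; rewrite -leNgt; apply: mulr_le0; [exact: ltW|lra].
Qed.

Lemma caratheodory_room (N : nat) z : caratheodory (room N) z.
Proof.
have c1 u : caratheodory (fun z => (z + - Complex 0 N%:R) * 2^-1) u.
  apply: caratheodoryM; last exact: caratheodory_cst.
  by apply: caratheodoryD; [exact: caratheodory_id|exact: caratheodory_cst].
apply: caratheodoryD; last first.
  apply: (caratheodory_comp (f := @GRing.opp (Cplx R))); first exact: caratheodory_ce.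
  exact: caratheodoryN.
apply: caratheodoryD; last exact: caratheodory_cst.
apply: caratheodoryM.
  exact: (caratheodory_comp (f := @ce R) (c1 z) (caratheodory_ce _)).
pose g z : Cplx R := ((z + - Complex 0 N%:R) * 2^-1) * ((z + - Complex 0 N%:R) * 2^-1) + (N%:R - 1).
have cg : caratheodory g z.
  by apply: caratheodoryD; [apply: caratheodoryM|exact: caratheodory_cst].
exact: (caratheodory_comp cg (caratheodory_coshsqrt _)).
Qed.

End RoomFunction.

(** * The roots when |z| is far from the scale of the room *)

Section FarRoots.
Context {R : realType}.
Implicit Types (z w u v a b : Cplx R).

Definition root_pair (N : nat) z a b :=
  a + b = z - Complex 0 N%:R /\ a * b = 1 - N%:R.

Lemma root_pairC N z a b : root_pair N z a b -> root_pair N z b a.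
Proof. by case=> h1 h2; split; [rewrite addrC|rewrite mulrC]. Qed.

Lemma cabs_nat (n : nat) : cabs (n%:R : Cplx R) = n%:R.
Proof. by rewrite -[n%:R](rmorph_nat (real_complex R)) cabs_real ger0_norm. Qed.

Lemma cabs_inat (x : R) : 0 <= x -> cabs (Complex 0 x : Cplx R) = x.
Proof. by move=> x0; rewrite /cabs /= expr0n add0r sqrtr_sqr ger0_norm. Qed.

Lemma cabs_1subn (n : nat) : (0 < n)%N -> cabs (1 - n%:R : Cplx R) = n%:R - 1.
Proof.
by move=> n0; rewrite cabs_distC -(natrB _ n0) cabs_nat natrB.
Qed.

Lemma root_pair_abs N z a b : (0 < N)%N -> root_pair N z a b ->
  cabs a * cabs b = N%:R - 1.
Proof. by move=> N0 [_ h]; rewrite -cabsM h cabs_1subn. Qed.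

(** The quadratic polynomial of z evaluated at the root b' of that of z'. As long as b' stays far
    from a, it makes the small root a Lipschitz function of z. *)
Lemma root_pair_sub N z z' a b a' b' : root_pair N z a b -> root_pair N z' a' b' ->
  (b - b') * (b' - a) = (z - z') * b'.
Proof.
move=> [h1 h2] [h1' h2'].
have e1 : z = a + b + Complex 0 N%:R by rewrite h1 subrK.
have e2 : z' = a' + b' + Complex 0 N%:R by rewrite h1' subrK.
have e3 : a' * b' = a * b by rewrite h2 h2'.
transitivity (a * b' + b * b' - b' * b' - a * b); first by ring.
by rewrite e1 e2 -e3; ring.
Qed.

(* At z = 0 the roots are -i and -i (N - 1). *)
Lemma root_pair_in N z a b : root_pair N z a b ->
  (b + Complex 0 1) * (b + Complex 0 (N%:R - 1)) = z * b.
Proof.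
move=> [h1 h2].
have e1 : z = a + b + Complex 0 N%:R by rewrite h1 subrK.
have e2 : Complex 0 N%:R = Complex 0 1 + Complex 0 (N%:R - 1) :> Cplx R.
  by apply: cplx_ext; rewrite ?cReD ?cImD /=; ring.
have e3 : Complex 0 1 * Complex 0 (N%:R - 1) = 1 - N%:R :> Cplx R.
  have -> : 1 - N%:R = (1 - N%:R : R)%:C%C :> Cplx R.
    by rewrite rmorphB rmorph1 rmorph_nat.
  by apply: cplx_ext; rewrite ?cReM ?cImM /=; ring.
transitivity (b * b + b * (Complex 0 1 + Complex 0 (N%:R - 1)) +
   Complex 0 1 * Complex 0 (N%:R - 1)); first by ring.
by rewrite e3 -h2 -e2 e1; ring.
Qed.

(** The moduli of the roots have product N - 1 and sum at least N - |z|. A first lower bound for the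
    larger root bounds the smaller one, which improves the lower bound in turn; two rounds suffice.
    Then [root_pair_in], whose second factor is at least 99 N / 100 in modulus, puts b near -i. *)
Lemma far_in_root N z : 1000 <= N%:R :> R -> cabs z <= N%:R / 100 ->
  exists a b, [/\ root_pair N z a b, cabs b <= 11 / 10, 9 / 10 * N%:R <= cabs a &
    cabs (b + Complex 0 1) <= 2 * cabs z / N%:R].
Proof.
move=> hN hz; have N0 : (0 < N)%N by rewrite -(ltr_nat R); lra.
have [a [b [rp ba]]] : exists a b, root_pair N z a b /\ cabs b <= cabs a.
  have [a [b [h1 h2 _]]] := room_roots_exist z N0.
  have rp : root_pair N z a b by [].
  case: (lerP (cabs b) (cabs a)) => h; first by exists a, b.
  by exists b, a; split; [exact: root_pairC|exact: ltW].
set n := N%:R in hN hz *.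
have hab : cabs a * cabs b = n - 1 := root_pair_abs N0 rp.
have hs : n - cabs z <= cabs a + cabs b.
  apply: le_trans (cabsD a b); rewrite rp.1 cabs_distC.
  by have := cabs_lbB (Complex 0 n) z; rewrite (@cabs_inat n) //; lra.
have b0 := cabs_ge0 b; have a0 := cabs_ge0 a; have z0 := cabs_ge0 z.
have a1 : 495 / 1000 * n <= cabs a by lra.
have key (c d : R) : 0 < c -> c * n <= cabs a -> n - 1 <= c * n * d -> cabs b <= d.
  move=> c0 h1 h2; rewrite -(ler_pM2l (x := c * n)); last by rewrite mulr_gt0 //; lra.
  by apply: le_trans h2; rewrite -hab; apply: ler_wpM2r.
have b1 : cabs b <= 203 / 100 by apply: key a1 _; lra.
have a2 : 98 / 100 * n <= cabs a by lra.
have b2 : cabs b <= 11 / 10 by apply: key a2 _; lra.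
exists a, b; split=> //; first by lra.
rewrite ler_pdivlMr; last by lra.
have := congr1 (@cabs R) (root_pair_in rp); rewrite !cabsM -/n.
have := cabs_lbD (Complex 0 (n - 1)) b; rewrite (@cabs_inat (n - 1)); last lra.
rewrite (addrC (Complex 0 (n - 1)) b).
set B := cabs (b + Complex 0 1); set C := cabs (b + _) => h1 h2.
have h3 : B * (99 / 100 * n) <= B * C by apply: ler_wpM2l; [exact: cabs_ge0|lra].
have h4 : cabs z * cabs b <= cabs z * (11 / 10) by apply: ler_wpM2l.
lra.
Qed.

Lemma far_out_root N z : 1000 <= N%:R :> R -> 100 * N%:R <= cabs z ->
  exists a b, [/\ root_pair N z a b, cabs b <= 12 / 10 * N%:R / cabs z &
     9 / 10 * cabs z <= cabs a].
Proof.
move=> hN hz; have N0 : (0 < N)%N by rewrite -(ltr_nat R); lra.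
have [a [b [rp ba]]] : exists a b, root_pair N z a b /\ cabs b <= cabs a.
  have [a [b [h1 h2 _]]] := room_roots_exist z N0.
  have rp : root_pair N z a b by [].
  case: (lerP (cabs b) (cabs a)) => h; first by exists a, b.
  by exists b, a; split; [exact: root_pairC|exact: ltW].
set n := N%:R in hN hz *.
have hab : cabs a * cabs b = n - 1 := root_pair_abs N0 rp.
have hs : cabs z - n <= cabs a + cabs b.
  apply: le_trans (cabsD a b); rewrite rp.1.
  by have := cabs_lbB z (Complex 0 n); rewrite (@cabs_inat n) //; lra.
have b0 := cabs_ge0 b; have a0 := cabs_ge0 a.
have a1 : 495 / 1000 * cabs z <= cabs a by lra.
have key (c d : R) : 0 < c -> c * cabs z <= cabs a -> n - 1 <= c * cabs z * d ->
    cabs b <= d.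
  move=> c0 h1 h2; rewrite -(ler_pM2l (x := c * cabs z)); last by rewrite mulr_gt0 //; lra.
  by apply: le_trans h2; rewrite -hab; apply: ler_wpM2r.
have b1 : cabs b <= 1 by apply: key a1 _; lra.
have a2 : 98 / 100 * cabs z <= cabs a by lra.
exists a, b; split=> //; last by lra.
have z0 : 0 < cabs z by lra.
rewrite ler_pdivlMr // mulrC -ler_pdivlMl //.
apply: key a2 _; first by lra.
by rewrite -mulrA mulVKf ?gt_eqF //; lra.
Qed.

(** The exponent u is b + i on the inner region and b on the outer one, so e(u) = e(b) and e(a) =
    e(z) e(-u) on both. It is small on either side, and [root_pair_sub] makes it Lipschitz even
    though the roots are merely chosen point by point. *)
Lemma room_far (N : nat) : 1000 <= N%:R :> R -> exists u : Cplx R -> Cplx R, [/\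
  forall z, cabs z <= N%:R / 100 \/ 100 * N%:R <= cabs z ->
    room N z = ce z * (ce (- u z) - 1) + (ce (u z) - 1),
  forall z, cabs z <= N%:R / 100 -> cabs (u z) <= 2 * cabs z / N%:R,
  forall z z', cabs z <= N%:R / 100 -> cabs z' <= N%:R / 100 ->
    cabs (u z - u z') <= 2 / N%:R * cabs (z - z'),
  forall z, 100 * N%:R <= cabs z -> cabs (u z) <= 2 * N%:R / cabs z &
  forall z z', 100 * N%:R <= cabs z -> 100 * N%:R <= cabs z' ->
    cabs (u z - u z') <= 2 * N%:R / (cabs z * cabs z') * cabs (z - z')].
Proof.
move=> hN.
pose I : Cplx R := Complex 0 1.
have ceI : ce I = 1 := ce_inat 1.
have ceiN : ce (- Complex 0 N%:R : Cplx R) = 1 by rewrite ceN ce_inat invr1.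
pose P z v := exists a b, [/\ root_pair N z a b,
   ce b = ce v, (cabs z <= N%:R / 100 -> [/\ v = b + I,
     cabs b <= 11 / 10, 9 / 10 * N%:R <= cabs a &
     cabs (b + I) <= 2 * cabs z / N%:R]) &
   (100 * N%:R <= cabs z -> [/\ v = b, cabs b <= 12 / 10 * N%:R / cabs z &
     9 / 10 * cabs z <= cabs a])].
have /choice[u hu] : forall z, exists v,
    cabs z <= N%:R / 100 \/ 100 * N%:R <= cabs z -> P z v.
  move=> z; case: (lerP (cabs z) (N%:R / 100)) => h1.
    have [a [b [rp h2 h3 h4]]] := far_in_root hN h1.
    exists (b + I) => _; exists a, b; split=> //; first by rewrite ceD ceI mulr1.
    by move=> h; exfalso; lra.
  (* Between the two regions u takes the dummy value 0. *)
  case: (lerP (100 * N%:R) (cabs z)) => h2; last by exists 0; case=> h; exfalso; lra.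
  have [a [b [rp h3 h4]]] := far_out_root hN h2.
  by exists b => _; exists a, b; split=> // h; exfalso; lra.
exists u; split.
- move=> z /hu[a [b [[h1 h2] h3 _ _]]].
  rewrite (room_roots h1 h2) h3.
  have -> : a = z + (- Complex 0 N%:R) + (- b) by rewrite -h1; ring.
  by rewrite !ceD ceiN !ceN h3; ring.
- move=> z hz; have [a [b [_ _ /(_ hz)[-> _ _ h] _]]] := hu z (or_introl hz).
  exact: h.
- move=> z z' hz hz'.
  have [a [b [rp _ /(_ hz)[-> h1 h2 _] _]]] := hu z (or_introl hz).
  have [a' [b' [rp' _ /(_ hz')[-> h1' h2' _] _]]] := hu z' (or_introl hz').
  have -> : b + I - (b' + I) = b - b' by ring.
  have := congr1 (@cabs R) (root_pair_sub rp rp'); rewrite !cabsM => e.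
  have h3 := cabs_lbB a b'; rewrite cabs_distC in h3.
  have p1 := cabs_ge0 (b - b'); have p2 := cabs_ge0 (z - z').
  have -> : 2 / N%:R * cabs (z - z') = 2 * cabs (z - z') / N%:R by ring.
  rewrite ler_pdivlMr; last by lra.
  nra.
- move=> z hz; have [a [b [_ _ _ /(_ hz)[-> h _]]]] := hu z (or_intror hz).
  apply: le_trans h _; rewrite ler_pM2r ?invr_gt0; last by lra.
  by apply: ler_wpM2r => //; lra.
- move=> z z' hz hz'.
  have [a [b [rp _ _ /(_ hz)[-> h1 h2]]]] := hu z (or_intror hz).
  have [a' [b' [rp' _ _ /(_ hz')[-> h1' h2']]]] := hu z' (or_intror hz').
  have := congr1 (@cabs R) (root_pair_sub rp rp'); rewrite !cabsM => e.
  have h3 := cabs_lbB a b'; rewrite cabs_distC in h3.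
  have p1 := cabs_ge0 (b - b'); have p2 := cabs_ge0 (z - z').
  have z0 : 0 < cabs z by lra.
  have z0' : 0 < cabs z' by lra.
  have h4 : cabs b' <= 12 / 1000.
    by apply: le_trans h1' _; rewrite ler_pdivrMr //; lra.
  have h5 : 8 / 10 * cabs z * cabs (b - b') <= cabs (z - z') * cabs b'.
    by rewrite -e mulrC; apply: ler_wpM2l => //; lra.
  have h6 : cabs b' * cabs z' <= 12 / 10 * N%:R by rewrite -ler_pdivlMr.
  have -> : 2 * N%:R / (cabs z * cabs z') * cabs (z - z') =
    2 * N%:R * cabs (z - z') / (cabs z * cabs z') by ring.
  rewrite ler_pdivlMr ?mulr_gt0 //.
  have h7 : 8 / 10 * cabs z * cabs (b - b') * cabs z' <=
      cabs (z - z') * cabs b' * cabs z' by apply: ler_wpM2r => //; exact: ltW.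
  have h8 : cabs (z - z') * (cabs b' * cabs z') <=
      cabs (z - z') * (12 / 10 * N%:R) by apply: ler_wpM2l.
  have h9 : 0 <= cabs (z - z') * N%:R by rewrite mulr_ge0.
  lra.
Qed.

End FarRoots.

(** * The function and its derivative *)

Section DistanceWeights.
Context {R : realType}.

Definition index_dist (j k : nat) := ((j - k) + (k - j))%N.

Lemma sum_dist_le k m : \sum_(0 <= j < m) (2 ^+ index_dist j k)^-1 <= 3 :> R.
Proof.
have e2 i : 0 < (2 : R) ^+ i by rewrite exprn_gt0.
(* Strengthened for the induction: up to [k] the partial sum is at most the next weight, and beyond
   [k] it is at most 3 minus the tail still to come. *)
suff h : \sum_(0 <= j < m) (2 ^+ index_dist j k)^-1 <=
   if (m <= k)%N then 1 / 2 ^+ (k - m) else 3 - 2 / 2 ^+ (m - k) :> R.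
  apply: le_trans h _; case: ifP => _; last by rewrite gerBl divr_ge0 // ltW.
  rewrite ler_pdivrMr //; have : 1 <= (2 : R) ^+ (k - m) by rewrite exprn_ege1 // ler1n.
  lra.
elim: m => [|m IH]; first by rewrite big_geq // leq0n divr_ge0 // ltW.
rewrite big_nat_recr //=; apply: le_trans (lerD IH (lexx _)) _.
case: (ltnP m k) => mk.
  rewrite (ltnW mk) /index_dist (eqP (ltnW mk)) add0n.
  have -> : (k - m = (k - m.+1).+1)%N by rewrite subnSK.
  rewrite exprS invfM; have : 0 < ((2 : R) ^+ (k - m.+1))^-1 by rewrite invr_gt0.
  by set q := _^-1; lra.
rewrite /index_dist (eqP mk) addn0 subSn //.
case: (ltnP k m) => km; last first.
  have -> : m = k by apply/eqP; rewrite eqn_leq mk km.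
  by rewrite subnn expr0 expr1; lra.
rewrite exprS invfM; set q := _^-1; lra.
Qed.

(** Decay in |j - k| is decay in j up to the factor 2^k, which gives summability; the sum itself is
    bounded independently of k. *)
Lemma index_dist_geo (C : R) (k : nat) (u : nat -> Cplx R) : 0 <= C ->
  (forall j, cabs (u j) <= C / 2 ^+ index_dist j k) ->
  (forall j, cabs (u j) <= (C * 2 ^+ k) / 2 ^+ j) /\ cabs (csum u) <= 3 * C.
Proof.
move=> C0 hu.
have h1 j : cabs (u j) <= (C * 2 ^+ k) / 2 ^+ j.
  apply: le_trans (hu j) _; rewrite -mulrA; apply: ler_wpM2l => //.
  rewrite -(@ler_pM2r _ (2 ^+ j)) ?exprn_gt0 // divfK ?expf_neq0 ?pnatr_eq0 //.
  rewrite mulrC ler_pdivrMr ?exprn_gt0 // -exprD ler_eXn2l ?ltr1n //.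
  by rewrite /index_dist; lia.
split=> //; apply: cabs_csum_le; first by eexists; exact: h1.
move=> m; apply: (@le_trans _ _ (C * \sum_(0 <= j < m) (2 ^+ index_dist j k)^-1)).
  rewrite mulr_sumr; elim: m => [|m IH]; first by rewrite !big_geq // cabs0.
  rewrite !big_nat_recr //=.
  by apply: le_trans (cabsD _ _) (lerD IH (hu m)).
by rewrite mulrC; apply: ler_wpM2r => //; exact: sum_dist_le.
Qed.

End DistanceWeights.

(** * The scales N_k and the annuli around them *)

Section Scales.
Context {R : realType}.
Variable B : nat.
Variable K : R.
Hypothesis HK : 1000 <= K.
Hypothesis HB : K <= B%:R.
Implicit Types (z w u v a b : Cplx R).

Definition height (k : nat) : nat := (B ^ k.*2.+1)%N.

Let b : R := B%:R.
Let n k : R := (height k)%:R.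

Let b_ge : K <= b. Proof. exact: HB. Qed.
Let b_gt0 : 0 < b. Proof. by have := b_ge; have := HK; lra. Qed.
Let bX_ge1 m : 1 <= b ^+ m.
Proof. by rewrite exprn_ege1 //; have := b_ge; have := HK; lra. Qed.
Let bX_gt0 m : 0 < b ^+ m. Proof. exact: exprn_gt0. Qed.

Lemma heightE k : n k = b ^+ k.*2.+1.
Proof. by rewrite /n /height natrX. Qed.

Let n_ge_b k : b <= n k.
Proof. by rewrite heightE exprS ler_peMr // ltW. Qed.

Lemma height_ge k : K <= n k.
Proof. exact: le_trans b_ge (n_ge_b k). Qed.

Lemma height_gt0 k : (0 < height k)%N.
Proof. by rewrite -(ltr_nat R) -/(n k); have := height_ge k; have := HK; lra. Qed.

(** The rings between B^(2k) and B^(2k+2), the innermost one filled in to a disc, cover the plane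
    and have N_k in their logarithmic middle; every other height is a factor B away from their
    edges. The factors 2 leave space for neighbourhoods of points of [core_annulus]. *)
Definition annulus k z :=
  cabs z <= 2 * b ^+ k.*2.+2 /\ ((0 < k)%N -> b ^+ k.*2 / 2 <= cabs z).

Definition core_annulus k z :=
  cabs z <= b ^+ k.*2.+2 /\ ((0 < k)%N -> b ^+ k.*2 <= cabs z).

Lemma core_annulus_exists z : exists k, core_annulus k z.
Proof.
have ex : exists k, cabs z <= b ^+ k.*2.+2.
  exists (Num.truncn (cabs z)); apply: le_trans (ltW (truncnS_gt _)) _.
  set m := Num.truncn _; apply: (@le_trans _ _ (2 ^+ m.*2.+2)).
    rewrite -natrX ler_nat; apply: ltnW; apply: leq_ltn_trans (ltn_expl m.*2.+2 (leqnn 2)).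
    by rewrite !ltnS -addnn leqW // leq_addr.
  by rewrite lerXn2r // ?nnegrE //; have := b_ge; have := HK; lra.
case: (ex_minnP ex) => k hk hmin; exists k; split=> // k0.
rewrite leNgt; apply/negP => h; case: k => [//|k] in hk hmin k0 h *.
by have := hmin k (ltW h); rewrite ltnn.
Qed.

Lemma core_annulusW k z w : core_annulus k z -> cabs (w - z) <= 1 / 2 -> annulus k w.
Proof.
move=> [h1 h2] h; split.
  have := cabsD z (w - z); rewrite [z + _]addrC subrK.
  by have := bX_ge1 k.*2.+2; lra.
move=> /h2; have := cabs_lbB z (z - w); rewrite subKr (cabs_distC z w).
by have := bX_ge1 k.*2; lra.
Qed.

(** Bounds the speed of the far exponents on annulus k: 1/N_k accounts for the larger rooms, N_k/|z
    w| for the smaller ones. For k = 0 there are no smaller rooms and z may vanish, so the second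
    term is switched off. *)
Definition lip_weight k z w : R := 1 / n k + (0 < k)%N%:R * n k / (cabs z * cabs w).

(** B^(2m-1) is the gap between the edge of an annulus and a height m scales away. One factor B of
    it is kept to give the small factor 1/K, the others give the decay 2^-m. *)
Let pow_big m : (0 < m)%N -> b * 2 ^+ m / 2 <= b ^+ m.*2.-1.
Proof.
case: m => // m _; rewrite doubleS /= (exprS b) (exprSr 2).
have -> : b * (2 ^+ m * 2) / 2 = b * 2 ^+ m by field.
apply: ler_wpM2l; first exact: ltW.
apply: (@le_trans _ _ (b ^+ m)).
  by rewrite lerXn2r // ?nnegrE //; have := b_ge; have := HK; lra.
by rewrite ler_weXn2l //; [have := b_ge; have := HK; lra|rewrite -addnn leq_addr].
Qed.

Let height_shift j m : (0 < m)%N -> n (j + m) = n j * (b * b ^+ m.*2.-1).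
Proof. by move=> m0; rewrite !heightE -exprS -exprD; congr (_ ^+ _); lia. Qed.

(** On annulus k a room of index j < k is seen from its outer region and one of index j > k from its
    inner region. *)
Lemma far_exponent k : exists u : nat -> Cplx R -> Cplx R, forall j, j != k ->
  [/\ forall z, annulus k z ->
        room (height j) z = ce z * (ce (- u j z) - 1) + (ce (u j z) - 1),
      forall z, annulus k z -> cabs (u j z) <= 8 / (K) / 2 ^+ index_dist j k &
      forall z w, annulus k z -> annulus k w ->
        cabs (u j z - u j w) <= 2 / (K) / 2 ^+ index_dist j k * lip_weight k z w * cabs (z - w)].
Proof.
have /choice[u hu] := fun j => @room_far R (height j) ltac:(by have := height_ge j; have := HK; rewrite /n; lra).
exists u => j jk; have [h1 h2 h3 h4 h5] := hu j; rewrite -/(n j) in h1 h2 h3 h4 h5.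
have nj : 0 < n j by have := height_ge j; have := HK; lra.
have nk : 0 < n k by have := height_ge k; have := HK; lra.
have bg := b_ge; have K0 : 0 < K by have := HK; lra.
have lam0 z w : 1 / n k <= lip_weight k z w.
  by rewrite lerDl divr_ge0 ?mulr_ge0 ?cabs_ge0 ?ler0n // ltW.
have lam1 z w : (0 < k)%N -> n k / (cabs z * cabs w) <= lip_weight k z w.
  by move=> k0; rewrite /lip_weight k0 !mul1r lerDr invr_ge0 ltW.
case: (ltngtP j k) jk => // jk _.
- pose m := (k - j)%N; have m0 : (0 < m)%N by rewrite subn_gt0.
  have ek : k = (j + m)%N by rewrite subnKC // ltnW.
  have dm : index_dist j k = m by rewrite /index_dist (eqP (ltnW jk)).
  have k0 : (0 < k)%N by exact: leq_ltn_trans jk.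
  have e1 : n k = n j * (b * b ^+ m.*2.-1) by rewrite {1}ek height_shift.
  have e2 : b ^+ k.*2 = n j * b ^+ m.*2.-1.
    rewrite heightE -exprD; congr (_ ^+ _).
    by clear -jk m0 ek; lia.
  have p2 : 1 <= (2 : R) ^+ m by rewrite exprn_ege1 // ler1n.
  have pm := pow_big m0; set Q := b ^+ m.*2.-1 in pm e1 e2.
  have e3 : K * 2 ^+ m <= b * 2 ^+ m by apply: ler_wpM2r; lra.
  have far z : annulus k z -> n j * (K * 2 ^+ m / 4) <= cabs z.
    move=> [_ /(_ k0)]; apply: le_trans; rewrite e2 -[leRHS]mulrA.
    by apply: ler_wpM2l; [exact: ltW|lra].
  have hK := HK; have hK2 : K <= K * 2 ^+ m by rewrite ler_peMr // ltW.
  have hQ : 2 ^+ m <= Q.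
    have : 2 * 2 ^+ m <= K * 2 ^+ m by apply: ler_wpM2r; lra.
    by move=> hK3; lra.
  have hKQ : K * 2 ^+ m <= b * Q by apply: ler_pM => //; rewrite ltW // exprn_gt0.
  have far' z : annulus k z -> 100 * n j <= cabs z.
    move=> /far; apply: le_trans; rewrite mulrC; apply: ler_wpM2l; [exact: ltW|lra].
  split=> [z hz|z hz|z w hz hw].
  + by apply: h1; right; exact: far'.
  + apply: le_trans (h4 z (far' z hz)) _; rewrite dm.
    have zp : 0 < cabs z by have := far' z hz; lra.
    rewrite ler_pdivrMr // [leRHS]mulrAC ler_pdivlMr; last by lra.
    rewrite [leRHS]mulrAC ler_pdivlMr //.
    have := far z hz; lra.
  + apply: le_trans (h5 z w (far' z hz) (far' w hw)) _; apply: ler_wpM2r; rewrite ?cabs_ge0 //.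
    rewrite dm; have zp : 0 < cabs z by have := far' z hz; lra.
    have wp : 0 < cabs w by have := far' w hw; lra.
    apply: (@le_trans _ _ (2 / (K) / 2 ^+ m * (n k / (cabs z * cabs w)))); last first.
      by apply: ler_wpM2l; [rewrite !divr_ge0 //; lra|exact: lam1].
    rewrite mulrA; apply: ler_wpM2r; first by rewrite invr_ge0 mulr_ge0 // ltW.
    rewrite [leRHS]mulrAC ler_pdivlMr; last by lra.
    rewrite [leRHS]mulrAC ler_pdivlMr //.
    have h6 : n j * (K * 2 ^+ m) <= n j * (b * Q).
      by apply: ler_wpM2l hKQ; exact: ltW.
    by rewrite e1; lra.
- pose m := (j - k)%N; have m0 : (0 < m)%N by rewrite subn_gt0.
  have ej : j = (k + m)%N by rewrite subnKC // ltnW.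
  have dm : index_dist j k = m by rewrite /index_dist (eqP (ltnW jk)) addn0.
  have e1 : n j = n k * (b * b ^+ m.*2.-1) by rewrite {1}ej height_shift.
  have e2 : b ^+ k.*2.+2 = n k * b.
    by rewrite heightE -exprSr.
  have p2 : 1 <= (2 : R) ^+ m by rewrite exprn_ege1 // ler1n.
  have pm := pow_big m0; set Q := b ^+ m.*2.-1 in pm e1.
  have e3 : K * 2 ^+ m <= b * 2 ^+ m by apply: ler_wpM2r; lra.
  have hK := HK; have hK2 : K <= K * 2 ^+ m by rewrite ler_peMr // ltW.
  have hQ : 2 ^+ m <= Q.
    have : 2 * 2 ^+ m <= K * 2 ^+ m by apply: ler_wpM2r; lra.
    by move=> hK3; lra.
  have hKQ : K * 2 ^+ m <= b * Q by apply: ler_pM => //; rewrite ltW // exprn_gt0.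
  have far z : annulus k z -> cabs z * (K * 2 ^+ m / 4) <= n j.
    move=> [hz _]; rewrite e2 in hz.
    apply: (@le_trans _ _ (2 * (n k * b) * (K * 2 ^+ m / 4))).
      by apply: ler_wpM2r; lra.
    have : n k * b * (K * 2 ^+ m / 2) <= n k * b * Q.
      by apply: ler_wpM2l; [rewrite mulr_ge0 // ltW|lra].
    by rewrite e1; lra.
  have far' z : annulus k z -> cabs z <= n j / 100.
    move=> /far; have z0 := cabs_ge0 z.
    have : cabs z * 100 <= cabs z * (K * 2 ^+ m / 4).
      by apply: ler_wpM2l => //; lra.
    lra.
  split=> [z hz|z hz|z w hz hw].
  + by apply: h1; left; exact: far'.
  + apply: le_trans (h2 z (far' z hz)) _; rewrite dm.
    rewrite ler_pdivrMr // [leRHS]mulrAC ler_pdivlMr; last by lra.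
    rewrite [leRHS]mulrAC ler_pdivlMr //.
    have := far z hz; lra.
  + apply: le_trans (h3 z w (far' z hz) (far' w hw)) _; apply: ler_wpM2r; rewrite ?cabs_ge0 //.
    rewrite dm; apply: (@le_trans _ _ (2 / (K) / 2 ^+ m * (1 / n k))); last first.
      by apply: ler_wpM2l; [rewrite !divr_ge0 //; lra|exact: lam0].
    rewrite mulrA mulr1 ler_pdivlMr // mulrAC ler_pdivrMr // [leRHS]mulrAC ler_pdivlMr; last by lra.
    rewrite [leRHS]mulrAC ler_pdivlMr //.
    have h6 : n k * (K * 2 ^+ m) <= n k * (b * Q).
      by apply: ler_wpM2l hKQ; exact: ltW.
    by rewrite e1; lra.
Qed.

End Scales.

(** * Termwise differentiation *)

Section SeriesDerivative.
Context {R : realType}.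

Lemma ccont_sum (D : nat -> Cplx R -> Cplx R) z m :
  (forall j, ccont (D j) z) -> ccont (fun w => \sum_(0 <= j < m) D j w) z.
Proof.
move=> h; elim: m => [|m IH].
  by move=> e e0; exists 1 => // w _; rewrite !big_geq // subrr cabs0.
have -> : (fun w => \sum_(0 <= j < m.+1) D j w) =
    (fun w => \sum_(0 <= j < m) D j w + D m w).
  by apply/funext => w; rewrite big_nat_recr.
exact: ccontD IH (h m).
Qed.

(** The Lipschitz bounds dominate the difference quotients of the terms by a geometric series, away
    from z directly and at z by continuity. Their sum therefore converges uniformly near z and is
    continuous there. *)
Lemma caratheodory_csum (D : nat -> Cplx R -> Cplx R) z (C r : R) : 0 < r ->
  (forall w, cabs (w - z) < r -> geo_bounded (fun j => D j w)) ->
  (forall j, caratheodory (D j) z) ->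
  (forall j w, cabs (w - z) < r -> cabs (D j w - D j z) <= C / 2 ^+ j * cabs (w - z)) ->
  caratheodory (fun w => csum (fun j => D j w)) z.
Proof.
move=> r0 hg hc hl.
have /choice[phi hphi] : forall j, exists p : Cplx R -> Cplx R,
    ccont p z /\ forall w, D j w - D j z = p w * (w - z).
  by move=> j; have [p cp hp] := hc j; exists p.
have C0 : 0 <= C.
  have rp : 0 < r / 2 by lra.
  have := hl 0%N (z + (r / 2)%:C%C); rewrite [z + _]addrC addrK cabs_real expr0 divr1.
  rewrite (gtr0_norm rp) => h.
  have : r / 2 < r by lra.
  move=> /h; have := cabs_ge0 (D 0%N ((r / 2)%:C%C + z) - D 0%N z) => h1 h2.
  have : 0 <= C * (r / 2) by lra.
  by rewrite pmulr_lge0.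
have e2 j : 0 < (2 : R) ^+ j by rewrite exprn_gt0.
have b1 j w : w != z -> cabs (w - z) < r -> cabs (phi j w) <= C / 2 ^+ j.
  move=> wz hw; have := hl j w hw; rewrite (hphi j).2 cabsM ler_pM2r //.
  by apply: cabs_gt0; rewrite subr_eq0.
have b2 j : cabs (phi j z) <= C / 2 ^+ j.
  rewrite leNgt; apply/negP; rewrite -subr_gt0 => h.
  have [d d0 hd] := (hphi j).1 _ h.
  pose s := Num.min d r / 2; have s0 : 0 < s by rewrite divr_gt0 // lt_min d0.
  have sd : s < Num.min d r by rewrite /s; have : 0 < Num.min d r; [rewrite lt_min d0|lra].
  move: sd; rewrite lt_min => /andP[sd sr].
  pose w := z + s%:C%C : Cplx R.
  have ws : cabs (w - z) = s by rewrite /w [z + _]addrC addrK cabs_real gtr0_norm.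
  have wz : w != z.
    by rewrite -subr_eq0; apply/eqP => e; move: s0; rewrite -ws e cabs0 ltxx.
  have := hd w; rewrite ws => /(_ sd); have := b1 j w wz; rewrite ws => /(_ sr).
  have := cabs_lbB (phi j z) (phi j z - phi j w); rewrite subKr.
  by rewrite (cabs_distC (phi j z)); lra.
have b3 j w : cabs (w - z) < r -> cabs (phi j w) <= C / 2 ^+ j.
  by move=> hw; case: (eqVneq w z) => [->|wz]; [exact: b2|exact: b1].
have g3 w : cabs (w - z) < r -> geo_bounded (fun j => phi j w).
  by move=> hw; exists C => j; exact: b3.
pose F w := csum (fun j => D j w).
have rz : cabs (z - z) < r by rewrite subrr cabs0.
have FE w : cabs (w - z) < r -> F w - F z = csum (fun j => phi j w) * (w - z).
  move=> hw; rewrite /F -csumB; [|exact: hg|exact: hg].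
  rewrite mulrC -csumZ; last exact: g3.
  by congr csum; apply/funext => j; rewrite (hphi j).2 mulrC.
(* The quotients of the terms are controlled only within distance r of z, whereas the quotient of
   the sum must be defined everywhere. *)
pose Phi w := if w == z then csum (fun j => phi j z) else (F w - F z) / (w - z).
exists Phi; last first.
  move=> w; rewrite /Phi; case: eqVneq => [->|wz]; first by rewrite !subrr mulr0.
  by rewrite divfK // subr_eq0.
move=> e e0.
have PhiE w : cabs (w - z) < r -> Phi w = csum (fun j => phi j w).
  move=> hw; rewrite /Phi; case: eqVneq => [-> //|wz].
  by rewrite FE // mulfK // subr_eq0.
have e30 : 0 < e / 3 by lra.
have [m hm] := geo_small (4 * C) e30.
have [d d0 hd] := ccont_sum m (fun j => (hphi j).1) e30.
exists (Num.min d r); first by rewrite lt_min d0.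
move=> w; rewrite lt_min => /andP[/hd h1 hw].
rewrite !PhiE //.
have h2 := csum_approx (fun j => b3 j w hw) m.
have h3 := csum_approx (fun j => b3 j z rz) m.
set Sw := \sum_(0 <= j < m) phi j w in h1 h2; set Sz := \sum_(0 <= j < m) phi j z in h1 h3.
set Fw := csum _ in h2 *; set Fz := csum _ in h3 *.
have := cabs_dist_trans Sw Fw Fz; have := cabs_dist_trans Sz Sw Fz.
by rewrite (cabs_distC Sz Fz); lra.
Qed.

End SeriesDerivative.

(** * The function on one annulus, and its differentiability *)

Section TheFunction.
Context {R : realType}.
Variables (B : nat) (K : R).
Hypothesis HK : 1000 <= K.
Hypothesis HB : K <= B%:R.
Implicit Types (z w u v a b : Cplx R).

Local Notation height := (height B).
Local Notation annulus := (annulus B).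
Local Notation lam := (lip_weight B).
Let n k : R := (height k)%:R.

Definition roomed_exp z : Cplx R := ce z + csum (fun j => room (height j) z).

Let K0 : 0 < K. Proof. by have := HK; lra. Qed.

Let pow2_gt0 j : 0 < (2 : R) ^+ j. Proof. exact: exprn_gt0. Qed.

(** What e(u) - 1 and e(-u) - 1 inherit from the far exponents: [ce_lip] with modulus bound 2 has
    constant 32, which turns 8/K and 2/K into 256/K and 64/K. *)
Definition small_family k (d : nat -> Cplx R -> Cplx R) :=
  (forall j z, annulus k z -> cabs (d j z) <= 256 / K / 2 ^+ index_dist j k) /\
  (forall j z w, annulus k z -> annulus k w ->
     cabs (d j z - d j w) <= 64 / K / 2 ^+ index_dist j k * lam k z w * cabs (z - w)).

Lemma lip_weight_ge0 k z w : 0 <= lam k z w.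
Proof.
by rewrite addr_ge0 // divr_ge0 ?mulr_ge0 ?cabs_ge0 ?ler0n.
Qed.

Lemma small_family_sum k d z w : small_family k d -> annulus k z -> annulus k w ->
  [/\ geo_bounded (fun j => d j z), cabs (csum (fun j => d j z)) <= 768 / K &
   cabs (csum (fun j => d j z) - csum (fun j => d j w)) <=
     192 / K * lam k z w * cabs (z - w)].
Proof.
move=> [h1 h2] hz hw.
have [g1 s1] := index_dist_geo (divr_ge0 (ler0n _ 256) (ltW K0)) (fun j => h1 j z hz).
have [g2 _] := index_dist_geo (divr_ge0 (ler0n _ 256) (ltW K0)) (fun j => h1 j w hw).
have q0 : 0 <= 64 / K * lam k z w * cabs (z - w).
  by rewrite !mulr_ge0 ?cabs_ge0 ?lip_weight_ge0 ?invr_ge0 ?ler0n // ltW.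
have [g3 s3] : (forall j, cabs (d j z - d j w) <=
   (64 / K * lam k z w * cabs (z - w)) * 2 ^+ k / 2 ^+ j) /\
   cabs (csum (fun j => d j z - d j w)) <= 3 * (64 / K * lam k z w * cabs (z - w)).
  apply: index_dist_geo => // j; apply: le_trans (h2 j z w hz hw) _.
  by rewrite le_eqVlt; apply/orP; left; apply/eqP; ring.
split; first by eexists; exact: g1.
- by apply: le_trans s1 _; lra.
- rewrite -csumB; [|by eexists; exact: g1|by eexists; exact: g2].
  by apply: le_trans s3 _; rewrite !mulrA; lra.
Qed.

Lemma cabs_ce_small u : cabs u <= 1 / 16 -> cabs (ce u) <= 2.
Proof.
move=> hu; rewrite cabs_ce.
have h : `|2 * pi * complex.Re u| <= 1 / 2.
  rewrite normrM (gtr0_norm tau_gt0).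
  have := le_trans (cabs_Re u) hu; have := normr_ge0 (complex.Re u).
  by have := @tau_le8 R; have := @tau_gt0 R; nra.
have := expR_sub1D_le h; have := h; rewrite !ler_norml => /andP[h1 h2] /andP[h3 h4].
by nra.
Qed.

(** The families are e(-u_j) - 1 and e(u_j) - 1, set to 0 at j = k so that they can be summed over
    all indices. *)
Lemma far_terms k : exists dm dp : nat -> Cplx R -> Cplx R,
  [/\ small_family k dm, small_family k dp &
    forall z, annulus k z -> [/\ dm k z = 0, dp k z = 0 &
      forall j, j != k -> room (height j) z = ce z * dm j z + dp j z]].
Proof.
have [u hu] := far_exponent HK HB k.
have p2 j : 1 <= (2 : R) ^+ j by rewrite exprn_ege1 // ler1n.
have iK : K^-1 <= 1 / 1000.
  by rewrite -[leLHS]mul1r (ler_pdivrMr _ _ K0); have := HK; lra.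
have iK0 : 0 < K^-1 by rewrite invr_gt0.
have us j z : j != k -> annulus k z -> cabs (u j z) <= 1 / 16.
  move=> jk hz; have [_ h _] := hu j jk; apply: le_trans (h z hz) _.
  rewrite ler_pdivrMr //; have := p2 (index_dist j k); lra.
have lipu u1 u2 : cabs u1 <= 1 / 16 -> cabs u2 <= 1 / 16 ->
    cabs (ce u1 - 1 - (ce u2 - 1)) <= 32 * cabs (u1 - u2).
  move=> h1 h2; have := ce_lip (cabs_ce_small h1) (cabs_ce_small h2).
  have -> : ce u1 - 1 - (ce u2 - 1) = ce u1 - ce u2 by ring.
  lra.
have nn (x : R) j : 0 <= x -> 0 <= x / K / 2 ^+ j.
  by move=> x0; rewrite !divr_ge0 // ltW.
pose dd (s : Cplx R) j z := if j == k then 0 else ce (s * u j z) - 1.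
have fam s : cabs s = 1 -> small_family k (dd s).
  move=> s1; have su v : cabs (s * v) = cabs v by rewrite cabsM s1 mul1r.
  split=> [j z hz|j z w hz hw]; rewrite /dd; case: ifPn => jk.
  - by rewrite cabs0; apply: nn; exact: ler0n.
  - have [_ h _] := hu j jk; have h1 := h z hz; have h2 := us j z jk hz.
    have := @lipu (s * u j z) 0; rewrite su cabs0 ce0 subrr !subr0 su => h3.
    apply: le_trans (h3 _ _) _ => //.
    have -> : 256 / K / 2 ^+ index_dist j k = 32 * (8 / K / 2 ^+ index_dist j k) by ring.
    by rewrite ler_pM2l.
  - rewrite subrr cabs0 !mulr_ge0 ?cabs_ge0 ?lip_weight_ge0 ?invr_ge0 ?ler0n // ltW //.
  - have [_ _ h] := hu j jk; have h1 := h z w hz hw.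
    apply: le_trans (lipu _ _ _ _) _; rewrite ?su; [exact: us|exact: us|].
    rewrite -mulrBr su.
    have -> : 64 / K / 2 ^+ index_dist j k * lam k z w * cabs (z - w) =
       32 * (2 / K / 2 ^+ index_dist j k * lam k z w * cabs (z - w)) by ring.
    by rewrite ler_pM2l.
exists (dd (-1)), (dd 1); split; [by apply: fam; rewrite cabsN cabs1|by apply: fam; rewrite cabs1|].
move=> z hz; rewrite /dd eqxx; split=> // j jk.
by have [h _ _] := hu j jk; rewrite (negPf jk) h // mulN1r mul1r.
Qed.

Lemma lip_weight_bound k z w : core_annulus B k z -> cabs (w - z) <= 1 / 2 ->
  lam k w z <= 1 + 2 * n k.
Proof.
move=> hz hw; have hn := height_ge HK HB k; rewrite -/(n k) in hn.
have h1 : 1 / n k <= 1 by rewrite ler_pdivrMr; have := HK; lra.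
apply: lerD; first exact: h1.
case: k hz h1 hn => [|k] hz h1 hn; first by rewrite !mul0r mulr_ge0 // ler0n.
case: hz => _ /(_ isT) hz.
have b1 : 1 <= B%:R ^+ k.+1.*2 :> R by rewrite exprn_ege1 //; have := HK; have := HB; lra.
have z1 : 1 <= cabs z by lra.
have w1 : 1 / 2 <= cabs w.
  by have := cabs_lbB z (z - w); rewrite subKr (cabs_distC z w); lra.
have zw : 1 / 2 <= cabs w * cabs z.
  by rewrite -[leLHS]mulr1; apply: ler_pM.
rewrite mul1r ler_pdivrMr; last by lra.
by have := HK; nra.
Qed.

Lemma geo_room z : geo_bounded (fun j => room (height j) z).
Proof.
have [k hk] := core_annulus_exists HK HB z.
have hz : annulus k z by apply: (core_annulusW HK HB hk); rewrite subrr cabs0.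
have [dm [dp [fm fp /(_ z hz)[m0 p0 hr]]]] := far_terms k.
have [gm _ _] := small_family_sum fm hz hz.
have [gp _ _] := small_family_sum fp hz hz.
have gk : geo_bounded (fun j => if j == k then room (height k) z else 0).
  exists (cabs (room (height k) z) * 2 ^+ k) => j; case: eqP => [->|_].
    by rewrite mulfK // expf_neq0.
  by rewrite cabs0 divr_ge0 ?mulr_ge0 ?cabs_ge0 // ltW.
suff -> : (fun j => room (height j) z) = (fun j =>
    (if j == k then room (height k) z else 0) + (ce z * dm j z + dp j z)).
  exact: geo_boundedD gk (geo_boundedD (geo_boundedZ (ce z) gm) gp).
apply/funext => j; case: (eqVneq j k) => [->|jk]; last by rewrite add0r hr.
by rewrite m0 p0 mulr0 !addr0.
Qed.

Lemma roomed_exp_region k : exists dm dp : Cplx R -> Cplx R, forall z, annulus k z ->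
  [/\ roomed_exp z = ce z + room (height k) z + (ce z * dm z + dp z),
      cabs (dm z) <= 768 / K, cabs (dp z) <= 768 / K &
      forall w, annulus k w ->
        cabs (dm z - dm w) <= 192 / K * lam k z w * cabs (z - w) /\
        cabs (dp z - dp w) <= 192 / K * lam k z w * cabs (z - w)].
Proof.
have [dm [dp [fm fp hr]]] := far_terms k.
exists (fun z => csum (fun j => dm j z)), (fun z => csum (fun j => dp j z)) => z hz.
have [gm bm lm] := small_family_sum fm hz hz.
have [gp bp lp] := small_family_sum fp hz hz.
split=> // [|w hw]; last first.
  by have [_ _ ?] := small_family_sum fm hz hw; have [_ _ ?] := small_family_sum fp hz hw.
rewrite /roomed_exp (csumD1 k (geo_room z)) addrA; congr (_ + _).
have [m0 p0 hj] := hr z hz.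
rewrite -csumZ // -csumD //; last exact: geo_boundedZ.
congr csum; apply/funext => j; case: (eqVneq j k) => [->|jk]; last exact: hj.
by rewrite m0 p0 mulr0 addr0.
Qed.

(** Termwise differentiation: the near room contributes through its own quotient, the far rooms
    through their Lipschitz bounds. The constants may depend on z and k here, so the crude
    [lip_weight_bound] and the factor 2^k are harmless. *)
Lemma roomed_exp_caratheodory z : caratheodory roomed_exp z.
Proof.
apply: caratheodoryD; first exact: caratheodory_ce.
have [k hk] := core_annulus_exists HK HB z.
have hz : annulus k z by apply: (core_annulusW HK HB hk); rewrite subrr cabs0.
have [dm [dp [fm fp hr]]] := far_terms k.
have [m0 p0 hrz] := hr z hz.
have [phi cphi hphi] := caratheodory_room (height k) z.
have [d d0 hd] := cphi 1 ltr01.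
pose M := 2 * cabs (ce z); have M0 : 0 < M by rewrite mulr_gt0 // cabs_ce_gt0.
pose L := 1 + 2 * n k; have L0 : 0 <= L.
  by rewrite /L; have := height_ge HK HB k; rewrite -/(n k); have := HK; lra.
pose C1 := 16 * M * (256 / K) + M * (64 / K * L) + 64 / K * L.
have q0 : 0 < 1 / K by rewrite divr_gt0.
have C10 : 0 <= C1.
  have M0' := ltW M0; have K0' : 0 <= K^-1 by rewrite invr_ge0 ltW.
  have c64 : 0 <= 64 / K * L by rewrite mulr_ge0 //; lra.
  have c256 : 0 <= 256 / K by lra.
  have c16 : 0 <= 16 * M by lra.
  exact: addr_ge0 (addr_ge0 (mulr_ge0 c16 c256) (mulr_ge0 M0' c64)) c64.
have A0 := cabs_ge0 (phi z).
pose r := Num.min (1 / 16) d.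
have r0 : 0 < r by rewrite lt_min d0 andbT; lra.
apply: (@caratheodory_csum _ _ _ ((C1 + cabs (phi z) + 1) * 2 ^+ k) r) => //.
- by move=> w _; exact: geo_room.
- by move=> j; exact: caratheodory_room.
move=> j w; rewrite lt_min => /andP[hw1 hw2].
have wz := cabs_ge0 (w - z).
case: (eqVneq j k) => [->|jk].
  rewrite mulfK ?expf_neq0 ?pnatr_eq0 // hphi cabsM; apply: ler_wpM2r => //.
  by have := cabsD (phi w - phi z) (phi z); rewrite subrK; have := hd w hw2; lra.
have hw : annulus k w by apply: (core_annulusW HK HB hk); lra.
have [_ _ hrw] := hr w hw.
rewrite hrz // hrw //.
have -> : ce w * dm j w + dp j w - (ce z * dm j z + dp j z) =
  (ce w - ce z) * dm j w + ce z * (dm j w - dm j z) + (dp j w - dp j z) by ring.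
have lb : lam k w z <= L by apply: lip_weight_bound hk _; lra.
have Mz : cabs (ce z) <= M by rewrite /M; have := cabs_ce_gt0 z; lra.
have Mw : cabs (ce w) <= M.
  have -> : w = z + (w - z) by ring.
  rewrite ceD cabsM mulrC; apply: ler_pM; rewrite ?cabs_ge0 //.
  by apply: cabs_ce_small; lra.
have t1 : cabs ((ce w - ce z) * dm j w) <=
    16 * M * cabs (w - z) * (256 / K / 2 ^+ index_dist j k).
  rewrite cabsM; apply: ler_pM; rewrite ?cabs_ge0 //; first exact: ce_lip.
  exact: fm.1.
have lipL e : small_family k e -> cabs (e j w - e j z) <=
    64 / K / 2 ^+ index_dist j k * L * cabs (w - z).
  move=> [_ h]; apply: le_trans (h j w z hw hz) _; apply: ler_wpM2r => //.
  by apply: ler_wpM2l => //; rewrite !divr_ge0 ?ler0n // ltW.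
have t2 : cabs (ce z * (dm j w - dm j z)) <=
    M * (64 / K / 2 ^+ index_dist j k * L * cabs (w - z)).
  by rewrite cabsM; apply: ler_pM; rewrite ?cabs_ge0 //; exact: (lipL dm fm).
have t3 := lipL dp fp.
apply: (@le_trans _ _ (C1 / 2 ^+ index_dist j k * cabs (w - z))).
  apply: le_trans (cabsD _ _) _; apply: le_trans (lerD (cabsD _ _) (lexx _)) _.
  rewrite /C1; set q := (2 ^+ _)^-1 in t1 t2 t3 *; set k' := K^-1 in t1 t2 t3 *.
  lra.
apply: ler_wpM2r => //.
have dd : (2 ^+ index_dist j k)^-1 <= 2 ^+ k / 2 ^+ j :> R.
  have h : (j <= k + index_dist j k)%N by clear; rewrite /index_dist; lia.
  by rewrite ler_pdivlMr // mulrC ler_pdivrMr // -exprD ler_eXn2l ?ltr1n.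
have : C1 * (2 ^+ index_dist j k)^-1 <= C1 * (2 ^+ k / 2 ^+ j) by apply: ler_wpM2l.
have : 0 <= (cabs (phi z) + 1) * (2 ^+ k / 2 ^+ j).
  by rewrite mulr_ge0 ?divr_ge0 ?addr_ge0 // ltW.
rewrite -mulrA; set q := 2 ^+ k / 2 ^+ j; lra.
Qed.

Lemma roomed_exp_entire : entire roomed_exp.
Proof. by move=> z; apply: caratheodory_derivable; exact: roomed_exp_caratheodory. Qed.

End TheFunction.

(** * Charts of the rooms *)

Section RoomChart.
Context {R : realType}.
Variable N : nat.
Hypothesis HN : 1000 <= N%:R :> R.
Implicit Types (z w u v a b : Cplx R).

Let n : R := N%:R.
Let n_ge : 1000 <= n. Proof. exact: HN. Qed.
Let N0 : (0 < N)%N. Proof. by rewrite -(ltr_nat R); have := HN; lra. Qed.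

Definition conj_root a : Cplx R := (1 - N%:R) / a.
Definition room_chart a : Cplx R := Complex 0 N%:R + a + conj_root a.

Lemma chart_root_pair a : a != 0 -> root_pair N (room_chart a) a (conj_root a).
Proof.
move=> a0; split; first by rewrite /room_chart; ring.
by rewrite /conj_root mulrC divfK.
Qed.

Lemma root_pair_chart z a b : a != 0 -> root_pair N z a b ->
  z = room_chart a /\ b = conj_root a.
Proof.
move=> a0 [h1 h2]; have eb : b = conj_root a.
  by rewrite /conj_root -h2 (mulrC a b) mulfK.
have e : z = a + b + Complex 0 N%:R by rewrite h1 subrK.
by split=> //; rewrite /room_chart -eb e; ring.
Qed.

Lemma cabs_conj_root a : cabs (conj_root a) = (n - 1) / cabs a.
Proof. by rewrite /conj_root cabsM cabsV cabs_1subn. Qed.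

Lemma Re_root_pair z a b : root_pair N z a b ->
  complex.Re b * cabs a ^+ 2 = (1 - n) * complex.Re a.
Proof.
move=> [_ hp].
have hN : 1 - N%:R = (1 - N%:R : R)%:C%C :> Cplx R.
  by rewrite rmorphB rmorph1 rmorph_nat.
have h1 : (1 - N%:R : R) = complex.Re a * complex.Re b - complex.Im a * complex.Im b.
  by have e := cReM a b; rewrite hp hN in e; exact: e.
have h2 : (0 : R) = complex.Re a * complex.Im b + complex.Im a * complex.Re b.
  by have e := cImM a b; rewrite hp hN in e; exact: e.
rewrite cabs_sqr /n h1; apply/eqP; rewrite -subr_eq0; apply/eqP.
transitivity (complex.Im a *
    (complex.Re a * complex.Im b + complex.Im a * complex.Re b)); first by ring.
by rewrite -h2 mulr0.
Qed.

(** A root in the right half-plane has its partner in the left one. Since e(z) = e(a) e(b), an error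
    relative to e(z) is one relative to e(a). *)
Lemma cabs_ce_conj_le1 z a b : root_pair N z a b -> 0 <= complex.Re a ->
  cabs (ce b) <= 1 /\ cabs (ce z) <= cabs (ce a).
Proof.
move=> rp ha; have e := Re_root_pair rp.
have b0 : complex.Re b <= 0.
  case: (eqVneq a 0) => [a0|a0].
    have := root_pair_abs N0 rp; rewrite a0 cabs0 mul0r; have := HN; lra.
  rewrite -(pmulr_lle0 _ (x := cabs a ^+ 2)) ?exprn_gt0 ?cabs_gt0 // e.
  by apply: mulr_le0_ge0 => //; have := n_ge; lra.
have c1 : cabs (ce b) <= 1.
  by rewrite cabs_ce expR_le1 mulr_ge0_le0 // ltW // tau_gt0.
split=> //; have -> : z = a + b + Complex 0 N%:R by rewrite rp.1 subrK.
rewrite !ceD ce_inat mulr1 cabsM -[leRHS]mulr1; apply: ler_wpM2l => //; exact: cabs_ge0.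
Qed.

Section RightHalfPlane.
Variable a : Cplx R.
Hypothesis ha : 4 <= complex.Re a.

Lemma chart_cabs_ge4 : 4 <= cabs a.
Proof. exact: le_trans (le_trans ha (ler_norm _)) (cabs_Re a). Qed.

Let a4 := chart_cabs_ge4.
Let ap : 0 < cabs a. Proof. by have := a4; lra. Qed.

Lemma chart_neq0 : a != 0.
Proof. by apply: contraTneq ap => ->; rewrite cabs0 ltxx. Qed.

Let rp := chart_root_pair chart_neq0.

(** If |a| <= N/4 both roots have modulus at most N/4, so z stays at distance at least N/2 from 0.
    Otherwise |a| is so large that Re b >= - Re a / 2, and Re z >= 2. *)
Lemma chart_ge : 1 <= cabs (room_chart a) /\ n / 4 <= cabs (room_chart a) * cabs a.
Proof.
have hn := n_ge; have h4 := a4.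
have hab := root_pair_abs N0 rp; rewrite -/n in hab.
have b0 := cabs_ge0 (conj_root a).
have [h|h] := lerP (cabs a) (n / 4).
  have hb : cabs (conj_root a) <= n / 4 by nra.
  have h1 : n / 2 <= cabs (room_chart a).
    have := cabs_lbD (Complex 0 n) (a + conj_root a).
    rewrite addrA (@cabs_inat R n); last by lra.
    by have := cabsD a (conj_root a); rewrite /room_chart -/n; lra.
  by split; [lra|nra].
have hr := Re_root_pair rp.
have hz : complex.Re (room_chart a) = complex.Re a + complex.Re (conj_root a).
  by rewrite /room_chart !cReD /= add0r.
have h2 : 2 * (n - 1) <= cabs a ^+ 2 by rewrite expr2; nra.
have h1 : 2 <= complex.Re (room_chart a).
  have hx := ha; rewrite hz; set x := complex.Re a in hr hx *; set y := complex.Re _ in hr *.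
  have : - (x / 2) <= y.
    rewrite -(ler_pM2r (x := cabs a ^+ 2)) ?exprn_gt0 // hr.
    have : (2 * (n - 1)) * x <= cabs a ^+ 2 * x by apply: ler_wpM2r => //; lra.
    lra.
  lra.
have h3 : 2 <= cabs (room_chart a).
  exact: le_trans (le_trans h1 (ler_norm _)) (cabs_Re _).
by split; [lra|nra].
Qed.

(** Here - 2 pi Re b dominates N/|a|^2, because Re a >= 4, and t exp(-t) <= 1. This compensates the
    speed (N - 1)/|a|^2 of b. *)
Lemma chart_decay : cabs (ce (conj_root a)) * (n / cabs a ^+ 2) <= 1.
Proof.
have hr := Re_root_pair rp; rewrite cabs_ce.
have hn := n_ge; have p2 : 0 < cabs a ^+ 2 by rewrite exprn_gt0.
have hx := ha; set y := complex.Re _ in hr *; set x := complex.Re a in hr hx *.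
have t4 := @tau_ge4 R.
pose t := - (2 * pi * y).
have ht : n / cabs a ^+ 2 <= t.
  rewrite ler_pdivrMr // /t.
  have -> : - (2 * pi * y) * cabs a ^+ 2 = 2 * pi * (n - 1) * x.
    transitivity (- (2 * pi) * (y * cabs a ^+ 2)); first by ring.
    by rewrite hr; ring.
  have : 4 * (n - 1) <= 2 * pi * (n - 1) by apply: ler_wpM2r; lra.
  by nra.
have e1 : 1 + t <= expR t := expR_ge1Dx t.
have -> : expR (2 * pi * y) = (expR t)^-1 by rewrite -expRN /t opprK.
by rewrite mulrC ler_pdivrMr ?expR_gt0 // mul1r; lra.
Qed.

End RightHalfPlane.

Lemma conj_root_sub a a' : a != 0 -> a' != 0 ->
  cabs (conj_root a - conj_root a') = (n - 1) / (cabs a * cabs a') * cabs (a - a').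
Proof.
move=> a0 a'0.
have -> : conj_root a - conj_root a' = - (conj_root a * (a - a') / a').
  by rewrite /conj_root; field; rewrite a0 a'0.
rewrite cabsN (cabsM (conj_root a * _)) (cabsM (conj_root a)) cabsV.
by rewrite cabs_conj_root invfM; ring.
Qed.

Lemma chart_sub a a' : a != 0 -> a' != 0 ->
  cabs (room_chart a - room_chart a') <= (1 + n / (cabs a * cabs a')) * cabs (a - a').
Proof.
move=> a0 a'0.
have -> : room_chart a - room_chart a' = (a - a') + (conj_root a - conj_root a').
  by rewrite /room_chart; ring.
apply: le_trans (cabsD _ _) _; rewrite conj_root_sub // [leRHS]mulrDl mul1r lerD2l.
apply: ler_wpM2r; first exact: cabs_ge0.
by apply: ler_wpM2r; [rewrite invr_ge0 mulr_ge0 ?cabs_ge0|lra].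
Qed.

Lemma ccont_chart a : a != 0 -> ccont room_chart a.
Proof.
move=> a0; apply: ccontD.
  by apply: ccontD; [exact: ccont_cst|move=> e e0; exists e].
apply: ccontM; first exact: ccont_cst.
by apply: (ccontV (g := id)) => // e e0; exists e.
Qed.

Lemma root_near a0 z (eta : R) : 0 < eta -> a0 != 0 ->
  cabs (z - room_chart a0) * cabs a0 <= eta ^+ 2 ->
  exists a b, root_pair N z a b /\ cabs (a - a0) <= eta.
Proof.
move=> eta0 a00 hz.
have [a [b [h1 h2 _]]] := room_roots_exist z N0.
have rp : root_pair N z a b by [].
have [h1' h2'] := chart_root_pair a00.
have e : (a - a0) * (b - a0) = - (z - room_chart a0) * a0.
  have e1 : z = a + b + Complex 0 N%:R by rewrite h1 subrK.
  transitivity (a * b - (a + b) * a0 + a0 * a0); first by ring.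
  rewrite h2 -h2' {1}e1.
  have -> : room_chart a0 = a0 + conj_root a0 + Complex 0 N%:R by rewrite h1' subrK.
  by ring.
have := congr1 (@cabs R) e; rewrite !cabsM cabsN => e'.
rewrite -e' in hz.
case: (lerP (cabs (a - a0)) eta) => h3; first by exists a, b.
case: (lerP (cabs (b - a0)) eta) => h4.
  by exists b, a; split=> //; exact: root_pairC.
by exfalso; nra.
Qed.

End RoomChart.

(** * In a chart the function is nearly linear on small discs *)

Section ChartLinearization.
Context {R : realType}.
Variables (B : nat) (K : R).
(* That is 10 ^ 6 <= K, without a large unary numeral. *)
Hypothesis HK6 : 1000 <= K / 1000.
Hypothesis HB : K <= B%:R.
Implicit Types (z w u v a b : Cplx R).

Local Notation height := (height B).
Local Notation annulus := (annulus B).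
Local Notation core_annulus := (core_annulus B).
Local Notation lam := (lip_weight B).
Local Notation F := (@roomed_exp R B).
Local Notation chart k := (room_chart (height k)).
Local Notation conj_root k := (conj_root (height k)).
Let n k : R := (height k)%:R.

Lemma scale_ge : 1000 <= K. Proof. by have := HK6; lra. Qed.
Let HK := scale_ge.
Let K0 : 0 < K. Proof. by have := HK; lra. Qed.
Let hn k : 1000 <= n k. Proof. exact: le_trans HK (height_ge HK HB k). Qed.

Lemma annulus_near k z w : core_annulus k z ->
  cabs (w - z) <= cabs z / 4 + 1 / 4 -> annulus k w.
Proof.
have bX m : 1 <= B%:R ^+ m :> R.
  by rewrite exprn_ege1 //; have := HB; have := HK; lra.
move=> [h1 h2] h; split.
  have := cabsD z (w - z); rewrite [z + _]addrC subrK.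
  by have := bX k.*2.+2; lra.
move=> /h2; have := cabs_lbB z (z - w); rewrite subKr (cabs_distC z w).
by have := bX k.*2; lra.
Qed.

(** The radius 1/2000 makes the Taylor remainder and the variation of the derivative over the disc
    contribute at most 0.512 and 0.128 times E |a - a'|. *)
Lemma ce_linearization (E : R) a0 a a' : E = cabs (ce a0) ->
  cabs (a - a0) <= 1 / 2000 -> cabs (a' - a0) <= 1 / 2000 ->
  cabs (ce a - ce a' - (2 * pi)%:C%C * ce a0 * (a - a')) <=
  2 / 3 * (E * cabs (a - a')).
Proof.
move=> eE h h'; have E0 : 0 <= E by rewrite eE cabs_ge0.
have D0 := cabs_ge0 (a - a').
have ball u : cabs (u - a0) <= 1 / 2000 -> cabs (ce u) <= 2 * E.
  move=> hu; have -> : u = (u - a0) + a0 by ring.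
  rewrite ceD cabsM eE; apply: ler_wpM2r; first exact: cabs_ge0.
  by apply: cabs_ce_small; apply: le_trans hu _; lra.
have aE' := ball _ h'.
have aa' : cabs (a - a') <= 1 / 1000.
  by have := cabs_dist_trans a0 a a'; rewrite (cabs_distC a0); lra.
set D := cabs (a - a') in D0 aa' *.
pose kap : Cplx R := (2 * pi)%:C%C; rewrite -/kap.
have ckap : cabs kap = 2 * pi by rewrite cabs_real gtr0_norm // tau_gt0.
have -> : ce a - ce a' - kap * ce a0 * (a - a') =
   ce a' * (ce (a - a') - 1 - kap * (a - a')) + kap * (ce a' - ce a0) * (a - a').
  have -> : ce a = ce a' * ce (a - a') by rewrite -ceD; congr ce; ring.
  by ring.
have g1 : cabs (ce (a - a') - 1 - kap * (a - a')) <= 256 * D ^+ 2.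
  by apply: ce_sub1D_le; rewrite -/D; lra.
have g2 : cabs (ce a' - ce a0) <= 16 * (2 * E) * cabs (a' - a0).
  by apply: ce_lip => //; rewrite -eE; lra.
apply: le_trans (cabsD _ _) _; rewrite !cabsM ckap -/D.
have g3 : cabs (ce a') * cabs (ce (a - a') - 1 - kap * (a - a')) <= 2 * E * (256 * D ^+ 2).
  by apply: ler_pM; rewrite ?cabs_ge0.
have g4 : E * D * D <= E * D * (1 / 1000) by apply: ler_wpM2l => //; exact: mulr_ge0.
have g6 : cabs (ce a' - ce a0) <= 16 * (2 * E) * (1 / 2000).
  by apply: le_trans g2 _; apply: ler_wpM2l => //; lra.
have g5 : 2 * pi * cabs (ce a' - ce a0) * D <= 8 * (16 * (2 * E) * (1 / 2000)) * D.
  apply: ler_wpM2r => //; apply: ler_pM; rewrite ?cabs_ge0 //; first exact: ltW tau_gt0.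
  exact: tau_le8.
by rewrite expr2 in g3; have ED := mulr_ge0 E0 D0; clear -g3 g4 g5 ED; lra.
Qed.

(** The error budget, with t standing for 2 pi: 2/3 + 1/20 + 1/8 + 1/20 is less than 2, half of the
    lower bound 4 for t. *)
Lemma chart_lin_total (E D t x0 x1 x3 x4 : R) : 0 <= E * D -> 4 <= t ->
  x0 <= 2 / 3 * (E * D) -> x1 <= 1 / 20 * (E * D) -> x3 <= 1 / 8 * (E * D) ->
  x4 <= 1 / 20 * (E * D) -> x0 + x1 + (x3 + x4) <= t * E / 2 * D.
Proof.
move=> ED t4 h0 h1 h3 h4.
by have : 4 * (E * D) <= t * (E * D); [exact: ler_wpM2r|lra].
Qed.

Let eta : R := 1 / 2000.

Section Ball.
Variables (k : nat) (a0 : Cplx R).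
Hypothesis ha0 : 5 <= complex.Re a0.
Hypothesis hk : core_annulus k (chart k a0).
Let E := cabs (ce a0).

Lemma ball_Re a : cabs (a - a0) <= eta -> 4 <= complex.Re a.
Proof.
move=> h; have := le_trans (cabs_Re (a - a0)) h.
rewrite cReD cReN ler_norml /eta => /andP[h1 h2].
by have := ha0; lra.
Qed.

Let ha0' : 4 <= complex.Re a0. Proof. by have := ha0; lra. Qed.

Let nz a : cabs (a - a0) <= eta -> a != 0.
Proof. by move=> /ball_Re; exact: chart_neq0. Qed.

(** The chart may stretch by a factor of order N, but [chart_ge] bounds the displacement by a small
    multiple of 1 + |z0|, z0 being the image of [a0]. *)
Lemma chart_ball_annulus a : cabs (a - a0) <= eta -> annulus k (chart k a).
Proof.
move=> h; apply: annulus_near hk _.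
have h4 := chart_cabs_ge4 (ball_Re h); have h4' := chart_cabs_ge4 ha0'.
apply: le_trans (chart_sub (hn k) (nz h) (chart_neq0 ha0')) _.
have [h1 h2] := chart_ge (hn k) ha0'; rewrite -/(n k) in h2 *.
have : n k / (cabs a * cabs a0) <= cabs (chart k a0).
  rewrite ler_pdivrMr; last by rewrite mulr_gt0 //; lra.
  have : 4 * (cabs (chart k a0) * cabs a0) <= cabs a * (cabs (chart k a0) * cabs a0).
    by apply: ler_wpM2r => //; rewrite mulr_ge0 ?cabs_ge0.
  lra.
move=> h5; apply: (@le_trans _ _ ((1 + cabs (chart k a0)) * eta)).
  by apply: ler_pM; rewrite ?cabs_ge0 // ?lerD2l // addr_ge0 // divr_ge0 ?mulr_ge0 ?cabs_ge0.
by rewrite /eta; lra.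
Qed.

Let ce_ball a : cabs (a - a0) <= eta -> cabs (ce a) <= 2 * E.
Proof.
move=> h; have -> : a = (a - a0) + a0 by ring.
rewrite ceD cabsM; apply: ler_wpM2r; first exact: cabs_ge0.
by apply: cabs_ce_small; apply: le_trans h _; rewrite /eta; lra.
Qed.

(** The far exponents keep a bounded speed in the coordinate a. The product of the weight with the
    stretching 1 + N/|a a'| is at most 1 + 4 + 16; the last term uses the bound N/4 of [chart_ge] at
    both points. *)
Lemma lip_weight_chart a a' : cabs (a - a0) <= eta -> cabs (a' - a0) <= eta ->
  lam k (chart k a) (chart k a') * cabs (chart k a - chart k a') <=
  21 * cabs (a - a').
Proof.
move=> h h'.
have h4 := chart_cabs_ge4 (ball_Re h); have h4' := chart_cabs_ge4 (ball_Re h').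
have [z1 za] := chart_ge (hn k) (ball_Re h).
have [z1' za'] := chart_ge (hn k) (ball_Re h').
rewrite -/(n k) in za za'.
set z := chart k a in z1 za *; set z' := chart k a' in z1' za' *.
have hz := chart_ball_annulus h; have hz' := chart_ball_annulus h'.
rewrite -/z in hz; rewrite -/z' in hz'.
have hnk := hn k.
set X := cabs a * cabs a'; have X16 : 16 <= X by rewrite /X; nra.
set Z := cabs z * cabs z'; have Z1 : 1 <= Z by rewrite /Z; nra.
have XZ : n k ^+ 2 <= 16 * (Z * X).
  have -> : Z * X = (cabs z * cabs a) * (cabs z' * cabs a') by rewrite /Z /X; ring.
  have : (n k / 4) * (n k / 4) <= (cabs z * cabs a) * (cabs z' * cabs a').
    by apply: ler_pM => //; lra.
  by rewrite expr2; lra.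
have hs := chart_sub (hn k) (nz h) (nz h'); rewrite -/z -/z' -/X -/(n k) in hs.
apply: (@le_trans _ _ (lam k z z' * ((1 + n k / X) * cabs (a - a')))).
  by apply: ler_wpM2l => //; exact: lip_weight_ge0.
rewrite mulrA; apply: ler_wpM2r; first exact: cabs_ge0.
have iX : X^-1 <= 1 / 16 by rewrite -[leLHS]mul1r ler_pdivrMr; lra.
have q1 : 1 / n k * (1 + n k / X) <= 1.
  rewrite mulrAC mul1r ler_pdivrMr; last by lra.
  have : n k * X^-1 <= n k * (1 / 16) by apply: ler_wpM2l => //; lra.
  lra.

have q2 : (0 < k)%N%:R * n k / Z * (1 + n k / X) <= 20.
  case: (posnP k) => [->|k0]; first by rewrite !mul0r.
  (* For k >= 1 the height B^(2k+1) is at most B^(4k), and both points have modulus at least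
     B^(2k)/2. *)
  have n4 : n k <= 4 * Z.
    have bX m : 1 <= B%:R ^+ m :> R.
      by rewrite exprn_ege1 //; have := HB; have := HK; lra.
    have := hz.2 k0; have := hz'.2 k0; have := bX k.*2.
    set q := B%:R ^+ k.*2 => q1' w1 w2.
    have : n k <= q * q.
      rewrite /q -exprD /n heightE ler_weXn2l //; last by move: k0; clear; lia.
      by have := HB; have := HK; lra.
    have : q / 2 * (q / 2) <= Z by apply: ler_pM => //; lra.
    lra.
  have Z0 : 0 < Z by lra.
  have X0 : 0 < X by lra.
  have e1 : n k / Z <= 4 by rewrite ler_pdivrMr.
  have e2 : n k / Z * (n k / X) <= 16.
    have -> : n k / Z * (n k / X) = n k ^+ 2 / (Z * X) by rewrite (invfM Z X); ring.
    by rewrite ler_pdivrMr // mulr_gt0.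
  by rewrite mul1r mulrDr mulr1; lra.
rewrite /lip_weight mulrDl -/(n k) -/Z; lra.
Qed.

Let tau0 : 0 < 2 * pi :> R. Proof. exact: tau_gt0. Qed.

(** The Lipschitz bound uses the larger of the two moduli of e(b); [chart_decay] is applied at the
    point where it is attained, |a| and |a'| being comparable. *)
Lemma conj_ball_sub a a' : cabs (a - a0) <= eta -> cabs (a' - a0) <= eta ->
  cabs (ce (conj_root k a) - ce (conj_root k a')) <= 32 * cabs (a - a').
Proof.
move=> h h'.
have h4 := chart_cabs_ge4 (ball_Re h); have h4' := chart_cabs_ge4 (ball_Re h').
have d1 := chart_decay (hn k) (ball_Re h); have d2 := chart_decay (hn k) (ball_Re h').
rewrite -/(n k) in d1 d2; have hnk := hn k.
have aa' : cabs (a - a') <= 2 * eta.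
  by have := cabs_dist_trans a0 a a'; rewrite (cabs_distC a0); lra.
have x1 : cabs a <= 2 * cabs a'.
  by have := cabs_lbB a (a - a'); rewrite subKr /eta in aa' *; lra.
have x2 : cabs a' <= 2 * cabs a.
  have := cabs_lbB a' (a' - a); rewrite subKr (cabs_distC a').
  by rewrite /eta in aa' *; lra.
set M := Num.max (cabs (ce (conj_root k a))) (cabs (ce (conj_root k a'))).
have M1 : cabs (ce (conj_root k a)) <= M by rewrite le_max lexx.
have M2 : cabs (ce (conj_root k a')) <= M by rewrite le_max lexx orbT.
apply: le_trans (ce_lip M1 M2) _.
rewrite conj_root_sub ?(nz h) ?(nz h') // -/(n k) mulrA; apply: ler_wpM2r.
  exact: cabs_ge0.
set x := cabs a in h4 d1 x1 x2 *; set x' := cabs a' in h4' d2 x1 x2 *.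
have xp : 0 < x by lra.
have xp' : 0 < x' by lra.
have m1 : (n k - 1) / (x * x') <= 2 * (n k / x ^+ 2).
  rewrite mulrA ler_pdivrMr ?mulr_gt0 // mulrAC ler_pdivlMr ?exprn_gt0 //.
  have : x * x <= x * (2 * x') by apply: ler_wpM2l => //; lra.
  have : (n k - 1) * (x * x) <= n k * (x * x) by apply: ler_wpM2r; [nra|lra].
  move=> u1 u2; have : n k * (x * x) <= n k * (x * (2 * x')) by apply: ler_wpM2l => //; lra.
  by rewrite expr2; lra.
have m2 : (n k - 1) / (x * x') <= 2 * (n k / x' ^+ 2).
  rewrite mulrA ler_pdivrMr ?mulr_gt0 // mulrAC ler_pdivlMr ?exprn_gt0 //.
  have : x' * x' <= x' * (2 * x) by apply: ler_wpM2l => //; lra.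
  have : (n k - 1) * (x' * x') <= n k * (x' * x') by apply: ler_wpM2r; [nra|lra].
  move=> u1 u2; have : n k * (x' * x') <= n k * (x' * (2 * x)) by apply: ler_wpM2l => //; lra.
  by rewrite expr2; lra.
suff : M * ((n k - 1) / (x * x')) <= 2 by lra.
rewrite /M; case: (leP (cabs (ce (conj_root k a)))) => _.
  apply: le_trans (ler_wpM2l (cabs_ge0 _) m2) _; lra.
apply: le_trans (ler_wpM2l (cabs_ge0 _) m1) _; lra.
Qed.

(** Makes absolute Lipschitz errors, such as the 32 of [conj_ball_sub], negligible against the
    derivative of e at [a0]. *)
Lemma cabs_ce_center_ge : 1000 <= E.
Proof.
rewrite /E cabs_ce.
have h : 20 <= 2 * pi * complex.Re a0.
  by have := @tau_ge4 R; have := ha0; nra.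
apply: (@le_trans _ _ (expR 20)); last by rewrite ler_expR.
have -> : 20 = 4%:R * 5 :> R by lra.
rewrite expRM_natl; have e5 : 6 <= expR 5 :> R by have := expR_ge1Dx (5 : R); lra.
apply: (@le_trans _ _ (6 ^+ 4)); last by rewrite lerXn2r // ?nnegrE; lra.
by rewrite !exprS expr0; lra.
Qed.

(** After the cancellation of e(z) four differences remain: those of e(a), of e(b), of e(z) [dm] and
    of [dp]. Only the first has a linear part; the rest are errors, with the shares fixed in
    [chart_lin_total]. *)
Lemma chart_lin a a' : cabs (a - a0) <= eta -> cabs (a' - a0) <= eta ->
  cabs (F (chart k a) - F (chart k a') - (2 * pi)%:C%C * ce a0 * (a - a')) <=
  cabs ((2 * pi)%:C%C * ce a0) / 2 * cabs (a - a').
Proof.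
move=> h h'.
have [dm [dp hd]] := roomed_exp_region HK HB k.
have hz := chart_ball_annulus h; have hz' := chart_ball_annulus h'.
have [fz mz pz lip] := hd _ hz; have [fz' mz' pz' _] := hd _ hz'.
have [lm lp] := lip _ hz'.
have [s1 p1] := chart_root_pair (height k) (nz h).
have [s2 p2] := chart_root_pair (height k) (nz h').
rewrite fz fz' (room_roots s1 p1) (room_roots s2 p2).
have ez : ce (chart k a) = ce a * ce (conj_root k a).
  by rewrite /room_chart !ceD ce_inat mul1r.
have ez' : ce (chart k a') = ce a' * ce (conj_root k a').
  by rewrite /room_chart !ceD ce_inat mul1r.
have lc := lip_weight_chart h h'.
have cj := conj_ball_sub h h'.
have E0 := cabs_ce_center_ge; have iK : K^-1 <= 1 / 1000 / 1000.
  by rewrite -[leLHS]mul1r ler_pdivrMr //; have := HK6; lra.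
have D0 := cabs_ge0 (a - a'); set D := cabs (a - a') in lc cj D0 *.
have DE : 1000 * D <= E * D by apply: ler_wpM2r.
set b := conj_root k a in ez cj *; set b' := conj_root k a' in ez' cj *.
set z := chart k a in ez lm lp lc mz pz *; set z' := chart k a' in ez' lm lp lc mz' pz' *.
have aE := ce_ball h; have aE' := ce_ball h'.
have [b1 _] := cabs_ce_conj_le1 (hn k) (conj s1 p1) (le_trans (ler0n _ 4) (ball_Re h)).
have [b1' _] := cabs_ce_conj_le1 (hn k) (conj s2 p2) (le_trans (ler0n _ 4) (ball_Re h')).
rewrite -/b in b1; rewrite -/b' in b1'.
pose kap : Cplx R := (2 * pi)%:C%C.
have ckap : cabs kap = 2 * pi by rewrite cabs_real gtr0_norm.
have T0 := ce_linearization (erefl E) h h'; rewrite -/kap -/D in T0.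
have T1 : cabs (ce b - ce b') <= 1 / 20 * (E * D) by lra.
have T2 : cabs (ce z - ce z') <= 96 * (E * D).
  rewrite ez ez'.
  have -> : ce a * ce b - ce a' * ce b' = ce a * (ce b - ce b') + ce b' * (ce a - ce a') by ring.
  apply: le_trans (cabsD _ _) _; rewrite !cabsM.
  have g1 : cabs (ce a) * cabs (ce b - ce b') <= 2 * E * (32 * D).
    by apply: ler_pM; rewrite ?cabs_ge0.
  have g2 : cabs (ce b') * cabs (ce a - ce a') <= 1 * (16 * (2 * E) * D).
    by apply: ler_pM; rewrite ?cabs_ge0 //; exact: ce_lip.
  have ED : 0 <= E * D by rewrite mulr_ge0 // cabs_ge0.
  by lra.
have lK : 192 / K * lam k z z' * cabs (z - z') <= 1 / 100 * D.
  have : K^-1 * (lam k z z' * cabs (z - z')) <= 1 / 1000 / 1000 * (21 * D).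
    apply: ler_pM => //; first by rewrite invr_ge0 ltW.
    by rewrite mulr_ge0 ?cabs_ge0 //; exact: lip_weight_ge0.
  by move=> q0; lra.
have T3 : cabs (ce z * dm z - ce z' * dm z') <= 1 / 8 * (E * D).
  have -> : ce z * dm z - ce z' * dm z' =
    (ce z - ce z') * dm z + ce z' * (dm z - dm z') by ring.
  apply: le_trans (cabsD _ _) _; rewrite !cabsM.
  have g1 : cabs (ce z - ce z') * cabs (dm z) <= 96 * (E * D) * (1 / 1000).
    apply: ler_pM; rewrite ?cabs_ge0 //; apply: le_trans mz _.
    by lra.
  have g2 : cabs (ce z') * cabs (dm z - dm z') <= 2 * E * (1 / 100 * D).
    apply: ler_pM; rewrite ?cabs_ge0 //; last exact: le_trans lm lK.
    rewrite ez' cabsM -[leRHS]mulr1; apply: ler_pM; rewrite ?cabs_ge0 //.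
  by lra.
have T4 : cabs (dp z - dp z') <= 1 / 20 * (E * D).
  by apply: le_trans lp _; apply: le_trans lK _; lra.
have -> : ce z + (ce a + ce b - 1 - ce z) + (ce z * dm z + dp z) -
   (ce z' + (ce a' + ce b' - 1 - ce z') + (ce z' * dm z' + dp z')) -
   (2 * pi)%:C%C * ce a0 * (a - a') =
   (ce a - ce a' - kap * ce a0 * (a - a')) + (ce b - ce b') +
   ((ce z * dm z - ce z' * dm z') + (dp z - dp z')) by rewrite /kap; ring.
apply: le_trans (cabsD _ _) _; apply: le_trans (lerD (cabsD _ _) (cabsD _ _)) _.
rewrite cabsM -/kap ckap -/E.
by apply: chart_lin_total; rewrite ?tau_ge4 // mulr_ge0 // cabs_ge0.
Qed.

End Ball.
End ChartLinearization.

(** * Singular values, growth and area *)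

Section SingularValues.
Context {R : realType}.
Variables (B : nat) (K : R).
Hypothesis HK6 : 1000 <= K / 1000.
Hypothesis HB : K <= B%:R.
Implicit Types (z w u v a b : Cplx R).

Local Notation height := (height B).
Local Notation annulus := (annulus B).
Local Notation core_annulus := (core_annulus B).
Local Notation F := (@roomed_exp R B).
Local Notation chart k := (room_chart (height k)).
Let n k : R := (height k)%:R.
Let HK : 1000 <= K := scale_ge HK6.
Let hn k : 1000 <= n k. Proof. exact: le_trans HK (height_ge HK HB k). Qed.

Lemma core_annulus_sub k z : core_annulus k z -> annulus k z.
Proof. by move=> h; apply: (core_annulusW HK HB h); rewrite subrr cabs0. Qed.

Lemma roomed_exp_bounds k z a b : annulus k z -> root_pair (height k) z a b ->
  0 <= complex.Re a -> cabs (F z - ce a) <= cabs (ce a) / 1000 + 3.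
Proof.
move=> hz rp ha; have [dm [dp hd]] := roomed_exp_region HK HB k.
have [-> mz pz _] := hd _ hz.
have [b1 z1] := cabs_ce_conj_le1 (hn k) rp ha.
rewrite (room_roots rp.1 rp.2).
have K768 : 768 / K <= 1 / 1000.
  by rewrite ler_pdivrMr; have := HK6; lra.
have -> : ce z + (ce a + ce b - 1 - ce z) + (ce z * dm z + dp z) - ce a =
  (ce b - 1) + (ce z * dm z + dp z) by ring.
apply: le_trans (cabsD _ _) _; apply: le_trans (lerD (cabsB _ _) (cabsD _ _)) _.
rewrite cabs1 cabsM.
have : cabs (ce z) * cabs (dm z) <= cabs (ce a) * (1 / 1000).
  by apply: ler_pM; rewrite ?cabs_ge0 //; exact: le_trans mz K768.
lra.
Qed.

(** A value of F above it in modulus forces Re a >= 5: for Re a < 5, [roomed_exp_bounds] gives at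
    most (1 + 1/1000) exp(10 pi) + 3. *)
Definition threshold : R := 2 * expR (2 * pi * 5) + 3.

Lemma threshold_ge0 : 0 <= threshold.
Proof. by rewrite /threshold; have := expR_gt0 (2 * pi * 5 : R); lra. Qed.

Lemma large_value_chart z : threshold < cabs (F z) -> exists k a,
  [/\ core_annulus k z, 5 <= complex.Re a, z = chart k a &
      cabs (F z) <= 3 * cabs (ce a)].
Proof.
move=> hz; have [k hk] := core_annulus_exists HK HB z.
have N0 : (0 < height k)%N := height_gt0 HK HB k.
have [a [b [h1 h2 ha]]] := room_roots_exist z N0.
have rp : root_pair (height k) z a b by [].
have hb := roomed_exp_bounds (core_annulus_sub hk) rp ha.
have up : cabs (F z) <= cabs (ce a) * (1 + 1 / 1000) + 3.
  by have := cabsD (F z - ce a) (ce a); rewrite subrK; lra.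
have a5 : 5 <= complex.Re a.
  rewrite leNgt; apply/negP => a5; move: hz; apply/negP; rewrite -leNgt.
  apply: le_trans up _; rewrite /threshold.
  have : cabs (ce a) <= expR (2 * pi * 5).
    by rewrite cabs_ce ler_expR; apply: ler_wpM2l; [exact: ltW tau_gt0|exact: ltW].
  by have := expR_gt0 (2 * pi * 5 : R); lra.
have a0 : a != 0 by apply: contraTneq a5 => ->; rewrite -ltNge /=; lra.
have [ez _] := root_pair_chart a0 rp.
exists k, a; split=> //.
have e20 : 20 <= 2 * pi * complex.Re a by have := @tau_ge4 R; nra.
have : 20 <= cabs (ce a).
  by rewrite cabs_ce; apply: le_trans (expR_ge1Dx _); lra.
lra.
Qed.

Lemma derivative_neq0 a : (2 * pi)%:C%C * ce a != 0 :> Cplx R.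
Proof.
apply/eqP => /(congr1 (@cabs R)).
rewrite cabs0 cabsM cabs_real gtr0_norm ?tau_gt0 // => h.
by have := mulr_gt0 (@tau_gt0 R) (cabs_ce_gt0 a); rewrite h ltxx.
Qed.

(** By [root_near] every point near z0 is the image of some a near [a0], so it is enough that F
    composed with the chart is injective there. *)
Lemma roomed_exp_local_inj z0 : threshold < cabs (F z0) -> exists2 d, 0 < d &
  forall z z', cabs (z - z0) < d -> cabs (z' - z0) < d -> F z = F z' -> z = z'.
Proof.
move=> /large_value_chart[k [a0 [hk a5 ez0 _]]].
have a4 : 4 <= complex.Re a0 by lra.
have an0 := chart_neq0 a4; have p := cabs_gt0 an0.
pose eta : R := 1 / 2000; have eta0 : 0 < eta by rewrite /eta; lra.
have near z : cabs (z - z0) < eta ^+ 2 / cabs a0 ->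
    exists2 a, cabs (a - a0) <= eta & z = chart k a.
  rewrite ltr_pdivlMr // => /ltW; rewrite {1}ez0.
  move=> /(root_near (hn k) eta0 an0) [a [b [rp ha]]]; exists a => //.
  by have [] := root_pair_chart (chart_neq0 (ball_Re a5 ha)) rp.
exists (eta ^+ 2 / cabs a0); first by rewrite divr_gt0 // exprn_gt0.
move=> z z' /near[a ha ->] /near[a' ha' ->] e.
have hk' : core_annulus k (chart k a0) by rewrite -ez0.
have L0 := derivative_neq0 a0.
pose h a := F (chart k a); pose L : Cplx R := (2 * pi)%:C%C * ce a0.
have lin u v : cabs (u - a0) <= eta -> cabs (v - a0) <= eta ->
   cabs (h u - h v - L * (u - v)) <= cabs L / 2 * cabs (u - v).
  by move=> hu hv; exact: (chart_lin HK6 HB a5 hk').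
by rewrite (lin_approx_inj L0 lin ha ha' e).
Qed.

Lemma roomed_exp_disc_section z0 : threshold < cabs (F z0) ->
  exists2 g, g (F z0) = z0 &
    disc_section F g (F z0) (1 / 4000 * cabs (F z0)).
Proof.
move=> hz0; have [k [a0 [hk a5 ez0 hle]]] := large_value_chart hz0.
have hk' : core_annulus k (chart k a0) by rewrite -ez0.
have a4 : 4 <= complex.Re a0 by lra.
pose eta : R := 1 / 2000; have eta0 : 0 < eta by rewrite /eta; lra.
pose h a := F (chart k a); pose L : Cplx R := (2 * pi)%:C%C * ce a0.
have E0 := cabs_ce_gt0 a0; have t4 := @tau_ge4 R.
have nL : cabs L = 2 * pi * cabs (ce a0).
  by rewrite cabsM cabs_real gtr0_norm ?tau_gt0.
have nL0 : 4 * cabs (ce a0) <= cabs L by rewrite nL; apply: ler_wpM2r => //; exact: ltW.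
have L0 : L != 0 := derivative_neq0 a0.
have lin u v : cabs (u - a0) <= eta -> cabs (v - a0) <= eta ->
   cabs (h u - h v - L * (u - v)) <= cabs L / 2 * cabs (u - v).
  by move=> hu hv; exact: (chart_lin HK6 HB a5 hk').
(* The image of the disc of radius 1/2000 contains a disc of radius |L|/4000, at least |e(a0)|/1000,
   hence at least |F(z0)|/3000 by the last clause of [large_value_chart]. *)
have hr w : cabs (w - F z0) < 1 / 4000 * cabs (F z0) ->
    cabs (w - h a0) <= cabs L / 2 * eta.
  by rewrite /h -ez0 /eta; lra.
have /choice[inv hinv] : forall w, exists a,
    cabs (w - F z0) < 1 / 4000 * cabs (F z0) ->
    cabs (a - a0) <= eta /\ h a = w.
  move=> w; case: (ltP (cabs (w - F z0)) (1 / 4000 * cabs (F z0))) => hw.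
    by have [a h1 h2] := lin_approx_surj eta0 L0 lin (hr w hw); exists a.
  by exists 0.
have c0 : cabs (a0 - a0) <= eta by rewrite subrr cabs0 ltW.
have fz0 : 0 < cabs (F z0) := le_lt_trans threshold_ge0 hz0.
exists (fun w => chart k (inv w)).
  have [h1 h2] : cabs (inv (F z0) - a0) <= eta /\ h (inv (F z0)) = F z0.
    by apply: hinv; rewrite subrr cabs0; lra.
  by rewrite (lin_approx_inj L0 lin h1 c0) // h2 /h -ez0.
move=> w hw; have [h1 h2] := hinv w hw; split; first exact: h2.
apply: (ccont_comp (f := chart k) (g := inv)); last first.
  by apply: ccont_chart; exact: chart_neq0 (ball_Re a5 h1).
move=> e e0.
exists (Num.min (e * (cabs L / 2)) (1 / 4000 * cabs (F z0) - cabs (w - F z0))).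
  by rewrite lt_min subr_gt0 hw andbT mulr_gt0 // divr_gt0 // cabs_gt0.
move=> w'; rewrite lt_min => /andP[hw1 hw2].
have hw' : cabs (w' - F z0) < 1 / 4000 * cabs (F z0).
  by have := cabs_dist_trans w w' (F z0); lra.
have [h1' h2'] := hinv w' hw'.
have := lin_approx_lb lin h1' h1; rewrite h2 h2' => h3.
have L2 : 0 < cabs L / 2 by rewrite divr_gt0 // cabs_gt0.
by rewrite -(ltr_pM2l L2) (mulrC _ e); exact: le_lt_trans h3 hw1.
Qed.

Lemma roomed_exp_covering :
  covering_over F (~` [set w | cabs w <= 2 * threshold]).
Proof.
apply: (@covering_of_disc_sections _ _ threshold _ _ (1 / 4000)).
- by move=> z; apply: caratheodory_cont; exact: (roomed_exp_caratheodory HK HB).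
- exact: roomed_exp_local_inj.
- exact: threshold_ge0.
- by apply/andP; split; lra.
- exact: roomed_exp_disc_section.
Qed.

Lemma closed_cabs_le (r : R) : closed [set w : Cplx R | cabs w <= r].
Proof.
have -> : [set w : Cplx R | cabs w <= r] = ~` [set w | r < cabs w].
  by apply/seteqP; split => w /=; [move=> h; apply/negP; rewrite -leNgt|
     move=> /negP; rewrite -leNgt].
apply: open_closedC; rewrite openE => w /= hw; apply/nbhs_cabsP.
exists (cabs w - r); first by rewrite subr_gt0.
by move=> v hv /=; have := cabs_lbB w (w - v); rewrite subKr (cabs_distC w); lra.
Qed.

Lemma roomed_exp_singular_values w : singular_values F w -> cabs w <= 2 * threshold.
Proof.
move=> /(_ [set w | cabs w <= 2 * threshold]); apply; split.
  exact: closed_cabs_le.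
exact: roomed_exp_covering.
Qed.

Lemma bounded_cabs (A : set (Cplx R)) (r : R) : (forall w, A w -> cabs w <= r) ->
  bounded_set A.
Proof.
move=> h; exists r%:C%C; split; first by rewrite complex_real.
move=> M hM w /h hw; rewrite /= cabs_normr.
by apply: le_trans (ltW hM); rewrite lecR.
Qed.

End SingularValues.

(** * Polynomials near infinity *)

Section Polynomials.
Context {R : realType}.

Lemma poly_lower_bound (p : {poly Cplx R}) : p != 0 ->
  exists m r : R, 0 < m /\ forall z, r < cabs z -> m <= cabs p.[z].
Proof.
elim/poly_ind: p => [|q c IH]; first by rewrite eqxx.
move=> p0; case: (eqVneq q 0) => [q0|/IH[m [r [m0 hm]]]].
  exists (cabs c), 0; move: p0; rewrite q0 mul0r add0r polyC_eq0 => c0.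
  by split; [exact: cabs_gt0|move=> z _; rewrite hornerC].
exists 1, (Num.max r ((1 + cabs c) / m)); split=> // z.
rewrite gt_max ltr_pdivrMr // => /andP[hz1 hz2].
rewrite hornerMXaddC; apply: le_trans (cabs_lbD _ _); rewrite cabsM.
have := ler_wpM2r (cabs_ge0 z) (hm z hz1); lra.
Qed.

Lemma poly_unbounded (p : {poly Cplx R}) (M : R) : (1 < size p)%N ->
  exists r : R, forall z, r < cabs z -> M < cabs p.[z].
Proof.
elim/poly_ind: p => [|q c _]; first by rewrite size_poly0.
case: (eqVneq q 0) => [->|q0 _].
  by rewrite mul0r add0r size_polyC; case: (c == 0).
have [m [r [m0 hm]]] := poly_lower_bound q0.
exists (Num.max (Num.max 0 r) ((M + cabs c) / m)) => z.
rewrite !gt_max ltr_pdivrMr // => /andP[/andP[z0 hz1] hz2].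
rewrite hornerMXaddC; apply: lt_le_trans (cabs_lbD _ _); rewrite cabsM.
have := ler_wpM2r (cabs_ge0 z) (hm z hz1); lra.
Qed.

End Polynomials.

(** * Order of growth and transcendence *)

Section Growth.
Context {R : realType}.
Variables (B : nat) (K : R).
Hypothesis HK6 : 1000 <= K / 1000.
Hypothesis HB : K <= B%:R.
Implicit Types (z w u v a b : Cplx R).

Local Notation height := (height B).
Local Notation annulus := (annulus B).
Local Notation core_annulus := (core_annulus B).
Local Notation F := (@roomed_exp R B).
Local Notation chart k := (room_chart (height k)).
Let n k : R := (height k)%:R.
Let HK : 1000 <= K := scale_ge HK6.
Let hn k : 1000 <= n k. Proof. exact: le_trans HK (height_ge HK HB k). Qed.

(** On annulus k the height is at most B|z| once |z| >= 1, so the root a is at most 4B|z| in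
    modulus. The 5 in the exponent absorbs the constant factor 5. *)
Lemma roomed_exp_exp_bound : exists2 C : R, 1 <= C &
  forall z, 1 <= cabs z -> cabs (F z) <= expR (C * cabs z).
Proof.
pose b : R := B%:R; have b1 : 1000 <= b by rewrite /b; have := HK; have := HB; lra.
pose C := 2 * pi * (4 * b) + 5.
have t0 := @tau_gt0 R.
have p4 : 0 <= 2 * pi * (4 * b) by apply: mulr_ge0; [exact: ltW|lra].
exists C; first by rewrite /C; lra.
move=> z z1; have [k hk] := core_annulus_exists HK HB z.
have N0 : (0 < height k)%N := height_gt0 HK HB k.
have hz := core_annulus_sub HK6 HB hk.
have [a [c [h1 h2 ha]]] := room_roots_exist z N0.
have rp : root_pair (height k) z a c by [].
have hb := roomed_exp_bounds HK6 HB hz rp ha.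
have nb : n k <= b * cabs z.
  rewrite /n heightE exprS; apply: ler_wpM2l; first lra.
  case: (posnP k) => [->|k0]; first by rewrite expr0.
  exact: hk.2.
have hac : cabs a * cabs c = n k - 1 := root_pair_abs N0 rp.
have hnk := hn k.
have a_le : cabs a <= 4 * b * cabs z.
  case: (lerP (cabs a) 1) => a1.
    apply: le_trans a1 _; have : 1 * 1 <= b * cabs z by apply: ler_pM; lra.
    lra.
  have c1 : cabs c <= n k.
    have : 1 * cabs c <= cabs a * cabs c by apply: ler_wpM2r; [exact: cabs_ge0|lra].
    lra.
  have ea : a = z - Complex 0 (n k) - c by rewrite -h1; ring.
  have := cabsB (z - Complex 0 (n k)) c; rewrite -ea.
  have := cabsB z (Complex 0 (n k)); rewrite (@cabs_inat R (n k)); last lra.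
  have : cabs z <= b * cabs z by apply: ler_peMl; [exact: cabs_ge0|lra].
  lra.
have ce_le : cabs (ce a) <= expR (2 * pi * (4 * b) * cabs z).
  rewrite cabs_ce ler_expR -[leRHS]mulrA; apply: ler_wpM2l; first exact: ltW.
  by apply: le_trans a_le; exact: le_trans (ler_norm _) (cabs_Re a).
have up : cabs (F z) <= 5 * expR (2 * pi * (4 * b) * cabs z).
  have := cabsD (F z - ce a) (ce a); rewrite subrK.
  have : 1 <= expR (2 * pi * (4 * b) * cabs z).
    rewrite -[leLHS]expR0 ler_expR; apply: mulr_ge0; last lra.
    by apply: mulr_ge0; [exact: ltW|lra].
  lra.
apply: le_trans up _.
have -> : C * cabs z = 2 * pi * (4 * b) * cabs z + 5 * cabs z by rewrite /C; ring.
rewrite expRD mulrC; apply: ler_wpM2l; first exact: expR_ge0.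
by apply: le_trans (expR_ge1Dx _); lra.
Qed.

Lemma roomed_exp_order : (growth_order F < +oo)%E.
Proof.
have [C C1 hC] := roomed_exp_exp_bound.
(* For |z| > C + 1 the bound exp(C|z|) gives log(C|z|) <= 2 log|z|. *)
apply: (@le_lt_trans _ _ 2%:E); last by rewrite ltry.
apply: (@le_trans _ _ (ereal_sup ((fun z =>
   (logp (logp (cabs (F z))) / ln (cabs z))%:E) @` [set z | C + 1 < cabs z]))).
  apply: ereal_inf_lbound; exists [set z | C + 1 < cabs z] => //.
  by exists (C + 1).
apply: ge_ereal_sup => _ [z /= hz <-]; rewrite lee_fin.
have z1 : 1 < cabs z by lra.
have l0 : 0 < ln (cabs z) by rewrite ln_gt0.
rewrite ler_pdivrMr //.
have hlogp (x : R) y : 0 <= y -> x <= expR y -> logp x <= y.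
  move=> y0 xy; rewrite /logp ge_max y0 /=.
  case: (ltrP 0 x) => x0; last by rewrite ln0 // ltW.
  by rewrite -(expRK y) ler_ln // posrE expR_gt0.
have Cz : 0 <= C * cabs z by rewrite mulr_ge0 ?cabs_ge0; lra.
apply: (hlogp _ _ _); first by rewrite mulr_ge0 // ltW.
apply: (@le_trans _ _ (C * cabs z)); first by apply: (hlogp _ _ _) => //; apply: hC; lra.
rewrite expRM_natl lnK ?posrE; last by lra.
by rewrite expr2; apply: ler_wpM2r; [exact: cabs_ge0|lra].
Qed.

Definition room_point k (x : R) : Cplx R := chart k x%:C%C.

Lemma room_pointE k (x : R) : x != 0 ->
  room_point k x = Complex (x - (n k - 1) / x) (n k).
Proof.
move=> x0; rewrite /room_point /room_chart /conj_root.
have -> : (1 - (height k)%:R) / x%:C%C = (- ((n k - 1) / x))%:C%C :> Cplx R.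
  rewrite -[(height k)%:R](rmorph_nat (real_complex R)) -(rmorph1 (real_complex R)) -rmorphB.
  rewrite -fmorphV -rmorphM; congr (_%:C%C); rewrite -mulNr opprB //.
by apply: cplx_ext; rewrite !(cReD, cImD) /= ?add0r ?addr0.
Qed.

Lemma annulus_of_height k z : n k / 2 <= cabs z -> cabs z <= 2 * n k -> annulus k z.
Proof.
have b1 : 1 <= B%:R :> R by have := HB; have := HK; lra.
have b0 : 0 <= B%:R ^+ k.*2 :> R by rewrite exprn_ge0 //; lra.
rewrite /n heightE => h1 h2; split.
  apply: le_trans h2 _; apply: ler_wpM2l => //.
  by rewrite [leRHS]exprS ler_peMl // exprn_ge0 //; lra.
move=> _; apply: le_trans h1; rewrite exprS; apply: ler_wpM2r; first lra.
by rewrite ler_peMl.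
Qed.

Lemma roomed_exp_room_value k (x : R) : 4 <= x <= 100 ->
  cabs (F (room_point k x) - ce x%:C%C) <= cabs (ce (x%:C%C : Cplx R)) / 1000 + 3 /\
  n k <= cabs (room_point k x).
Proof.
move=> /andP[x4 x100]; have x0 : x != 0 by apply/eqP; lra.
have e := room_pointE k x0; have hnk := hn k.
have lo : n k <= cabs (room_point k x).
  have := cabs_Im (room_point k x); rewrite e /=; apply: le_trans.
  exact: ler_norm.
split=> //; have xc0 : (x%:C%C : Cplx R) != 0.
  by apply/eqP => -[] /eqP; rewrite (negPf x0).
have ra : 0 <= complex.Re (x%:C%C : Cplx R) by rewrite /=; lra.
apply: (roomed_exp_bounds HK6 HB _ (chart_root_pair (height k) xc0) ra).
apply: annulus_of_height; rewrite -/(room_point k x); first by lra.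
have hx : (n k - 1) / x <= (n k - 1) / 4.
  by apply: ler_wpM2l; [lra|rewrite lef_pV2 // posrE; lra].
have hx0 : 0 <= (n k - 1) / x by apply: divr_ge0; lra.
apply: le_trans (cabs_le_ReIm _) _; rewrite e /= (@ger0_norm _ (n k)); last lra.
have : `|x - (n k - 1) / x| <= n k by rewrite ler_norml; apply/andP; split; lra.
lra.
Qed.

Lemma height_unbounded (r : R) : exists k, r < n k.
Proof.
exists (Num.truncn r); apply: lt_trans (truncnS_gt _) _.
have B1 : (1 < B)%N by rewrite -(ltr_nat R); have := HB; have := HK; lra.
rewrite /n ltr_nat; set k := Num.truncn r.
apply: leq_ltn_trans (ltn_expl k.*2.+1 B1).
by rewrite ltnS -addnn leq_addr.
Qed.

(** The points [room_point k 7] tend to infinity while F stays bounded on them, which a nonconstant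
    polynomial cannot do; the values in room 0 at 7 and 9 exclude a constant. *)
Lemma roomed_exp_transcendental : transcendental_entire F.
Proof.
split; first exact: (roomed_exp_entire HK HB).
move=> [p hp].
have [v7 _] := @roomed_exp_room_value 0%N 7 ltac:(apply/andP; split; lra).
have [v9 _] := @roomed_exp_room_value 0%N 9 ltac:(apply/andP; split; lra).
have t4 := @tau_ge4 R.
set e7 := cabs (ce _) in v7; set e9 := cabs (ce _) in v9.
have e7_ge : 20 <= e7.
  rewrite /e7 cabs_ce /=; apply: le_trans (expR_ge1Dx _).
  by have : 28 <= 2 * pi * 7 :> R; lra.
have e97 : 5 * e7 <= e9.
  rewrite /e9 /e7 !cabs_ce /=.
  have -> : 2 * pi * 9 = 2 * pi * 2 + 2 * pi * 7 :> R by ring.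
  rewrite expRD; apply: ler_wpM2r; first exact: expR_ge0.
  by apply: le_trans (expR_ge1Dx _); lra.
have u7 k : cabs (F (room_point k 7)) <= e7 / 1000 + 3 + e7.
  have [v _] := @roomed_exp_room_value k 7 ltac:(apply/andP; split; lra).
  have := cabsD (F (room_point k 7) - ce (7%:C%C : Cplx R)) (ce (7%:C%C : Cplx R)).
  by rewrite subrK -/e7; rewrite -/e7 in v; lra.
have l9 : e9 - (e9 / 1000 + 3) <= cabs (F (room_point 0 9)).
  have := cabs_lbB (ce (9%:C%C : Cplx R)) (ce (9%:C%C : Cplx R) - F (room_point 0 9)).
  by rewrite subKr (cabs_distC (ce _)) -/e9; lra.
case: (leqP (size p) 1) => sp.
  have e : F (room_point 0 7) = F (room_point 0 9).
    by rewrite !hp (size1_polyC sp) !hornerC.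
  by have := u7 0%N; rewrite e; lra.
have [r hr] := poly_unbounded (e7 / 1000 + 3 + e7) sp.
have [k hk] := height_unbounded r.
have [_ w] := @roomed_exp_room_value k 7 ltac:(apply/andP; split; lra).
have := hr (room_point k 7) (lt_le_trans hk w); rewrite -hp.
by apply/negP; rewrite -leNgt; exact: u7.
Qed.

End Growth.

(** * Integrals bounded below by disjoint steps *)

Section IntegralLowerBound.
Local Open Scope ereal_scope.

(* The set A need not be measurable: the integral of a nonnegative function is
   a supremum over the simple functions below it. *)
Lemma integral_ge_sum d (T : measurableType d) (R : realType)
    (mu : {measure set T -> \bar R}) (A : set T) (g : T -> \bar R)
    (Q : nat -> set T) (c : nat -> R) (m : nat) :
  (forall x, A x -> 0 <= g x) -> (forall k, measurable (Q k)) ->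
  (forall k, (0 <= c k)%R) -> trivIset setT Q ->
  (forall k x, Q k x -> A x /\ (c k)%:E <= g x) ->
  \sum_(0 <= k < m) (c k)%:E * mu (Q k) <= \int[mu]_(x in A) g x.
Proof.
move=> g0 mQ c0 dQ hQ.
pose h k (x : T) : \bar R := (c k)%:E * (\1_(Q k) x)%:E.
have mI k : measurable_fun [set: T] (EFin \o (\1_(Q k) : T -> R)).
  by apply/measurable_EFinP; exact: measurable_indic.
have h0 k x : 0 <= h k x by rewrite mule_ge0 // lee_fin.
have mh k : measurable_fun setT (h k) by apply: measurable_funeM; exact: mI.
have -> : \sum_(0 <= k < m) (c k)%:E * mu (Q k) =
    \int[mu]_x (\sum_(0 <= k < m) h k x).
  rewrite ge0_integral_sum //; apply: eq_bigr => k _.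
  rewrite (@ge0_integralZl_EFin _ _ _ mu setT measurableT (EFin \o \1_(Q k))) //.
    by rewrite integral_indic // setIT.
  by move=> x _; rewrite lee_fin.
rewrite ge0_integralE; last by move=> x _; exact: sume_ge0.
(* Simple functions below the sum of the steps are among those below g extended by 0, so the suprema
   compare. *)
rewrite ge0_integralE //; apply: ereal_sup_le => _ [s hs <-]; exists s => // x.
apply: le_trans (hs x) _; rewrite patch_setT /patch.
case: ifPn => [/set_mem Ax|nA]; last first.
  rewrite big1 // => k _; rewrite /h indicE.
  case: (boolP (x \in Q k)) => [/set_mem /hQ[Ax _]|_]; last by rewrite mule0.
  by move: nA; rewrite mem_set.
have [[k Qk]|nQ] := pselect (exists k, Q k x); last first.
  rewrite big1 ?g0 // => k _; rewrite /h indicE memNset ?mule0 // => Qk.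
  by apply: nQ; exists k.
apply: (@le_trans _ _ (c k)%:E); last by have [] := hQ k x Qk.
have hj j : j != k -> h j x = 0.
  move=> jk; rewrite /h indicE memNset ?mule0 // => Qj.
  by move/eqP: jk; apply; apply: (dQ j k) => //; exists x.
case: (ltnP k m) => km.
  rewrite (bigD1_seq k) ?mem_index_iota ?iota_uniq //= big1 ?adde0; last first.
    by move=> j /hj.
  by rewrite /h indicE mem_set // mule1.
rewrite big_nat big1 ?lee_fin // => j /andP[_ jm]; apply: hj.
by apply: contraTneq jm => ->; rewrite -leqNgt.
Qed.

End IntegralLowerBound.

(** * Connected exteriors and compact frames in the plane *)

Section PlaneTopology.
Context {R : realType}.
Implicit Types (z w : Cplx R).

Lemma segment_in_component (A : set (Cplx R)) z w :
  (forall t : R, 0 <= t <= 1 -> A ((1 - t)%:C%C * z + t%:C%C * w)) ->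
  connected_component A z w.
Proof.
move=> hA; pose c (t : R) : Cplx R := (1 - t)%:C%C * z + t%:C%C * w.
have i01 (t : R) : `[0, 1]%classic t <-> 0 <= t <= 1 by rewrite /= in_itv.
have cc : continuous c.
  move=> t; apply/(@cvg_cabsP R R (nbhs t) (nbhs_filter t) c (c t)) => e e0.
  have d0 : 0 < e / (cabs (w - z) + 1).
    by rewrite divr_gt0 // ltr_wpDl // cabs_ge0.
  apply/nbhs_ballP; exists (e / (cabs (w - z) + 1)) => // s.
  rewrite -ball_normE /= distrC => hs.
  have -> : c s - c t = (s - t)%:C%C * (w - z) by rewrite /c !rmorphB rmorph1; ring.
  rewrite cabsM cabs_real; move: hs.
  rewrite ltr_pdivlMr; last by rewrite ltr_wpDl // cabs_ge0.
  by apply: le_lt_trans; apply: ler_wpM2l => //; lra.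
have h : connected (c @` `[0, 1]%classic).
  apply: connected_continuous_connected; first exact: segment_connected.
  exact: continuous_subspaceT.
have := @connected_component_max _ A (c @` `[0, 1]%classic) z.
apply => //.
- by exists 0; [apply/i01; rewrite lexx ler01|rewrite /c subr0 rmorph1 rmorph0; ring].
- by move=> _ [t /i01 ht <-]; exact: hA.
- by exists 1; [apply/i01; rewrite lexx ler01|rewrite /c subrr rmorph1 rmorph0; ring].
Qed.

Lemma rectangle_compact (x1 x2 y1 y2 : R) :
  compact [set z : Cplx R | x1 <= complex.Re z <= x2 /\ y1 <= complex.Im z <= y2].
Proof.
have -> : [set z : Cplx R | x1 <= complex.Re z <= x2 /\ y1 <= complex.Im z <= y2] =
    (fun p : R * R => Complex p.1 p.2 : Cplx R) @` (`[x1, x2] `*` `[y1, y2]).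
  apply/seteqP; split => z.
    by case: z => x y /= [hx hy]; exists (x, y); rewrite //= !in_itv.
  by move=> [[x y] /= []]; rewrite !in_itv /= => hx hy <-.
apply: continuous_compact; last by apply: compact_setX; exact: segment_compact.
apply: continuous_subspaceT => p.
apply/(@cvg_cabsP R _ (nbhs p) (nbhs_filter p)) => e e0.
case: p => x y; exists (ball x (e / 2), ball y (e / 2)) => /=.
  by split; apply: nbhsx_ballx; lra.
move=> [x' y'] /= []; rewrite -!ball_normE /= => hx hy.
change (cabs (Complex x' y' - Complex x y : Cplx R) < e).
apply: le_lt_trans (cabs_le_ReIm _) _ => /=.
by rewrite distrC in hx; rewrite distrC in hy; lra.
Qed.

(** The exterior of a square instead of a disc: it is a union of four half-planes, each of them
    convex. *)
Definition outside (r : R) z := r < `|complex.Re z| \/ r < `|complex.Im z|.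

(** Every point is joined to the corner (r + 1, r + 1) by at most two segments, each inside one
    half-plane. *)
Lemma outside_connected (A : set (Cplx R)) (r : R) z w : 0 <= r ->
  (forall v, outside r v -> A v) -> outside r z -> outside r w ->
  connected_component A z w.
Proof.
move=> r0 hA hz hw.
have conv (x y t : R) : 0 <= t -> t <= 1 -> r < x -> r < y -> r < (1 - t) * x + t * y.
  move=> t0 t1 hx hy; have hm : r < Num.min x y by rewrite lt_min hx.
  have : (1 - t) * Num.min x y <= (1 - t) * x.
    by apply: ler_wpM2l; [lra|rewrite ge_min lexx].
  have : t * Num.min x y <= t * y by apply: ler_wpM2l => //; rewrite ge_min lexx orbT.
  lra.
have convN (x y t : R) : 0 <= t -> t <= 1 -> x < - r -> y < - r ->
    r < - ((1 - t) * x + t * y).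
  move=> t0 t1 hx hy; have -> : - ((1 - t) * x + t * y) = (1 - t) * - x + t * - y by ring.
  by apply: conv => //; rewrite ltrNr.
have seg (u v : Cplx R) : (r < complex.Re u /\ r < complex.Re v) \/
   (complex.Re u < - r /\ complex.Re v < - r) \/
   (r < complex.Im u /\ r < complex.Im v) \/
   (complex.Im u < - r /\ complex.Im v < - r) -> connected_component A u v.
  move=> h; apply: segment_in_component => t /andP[t0 t1]; apply: hA.
  have -> : outside r ((1 - t)%:C%C * u + t%:C%C * v) =
    (r < `|(1 - t) * complex.Re u + t * complex.Re v| \/
     r < `|(1 - t) * complex.Im u + t * complex.Im v|).
    by rewrite /outside cReD cImD !cReM !cImM /= !mul0r !subr0 !addr0.
  case: h => [[h1 h2]|[[h1 h2]|[[h1 h2]|[h1 h2]]]]; [left|left|right|right].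
  - by apply: lt_le_trans (ler_norm _); exact: conv.
  - by rewrite -normrN; apply: lt_le_trans (ler_norm _); exact: convN.
  - by apply: lt_le_trans (ler_norm _); exact: conv.
  - by rewrite -normrN; apply: lt_le_trans (ler_norm _); exact: convN.
pose q : Cplx R := Complex (r + 1) (r + 1).
have toq u : outside r u -> connected_component A q u.
  move=> hu; apply: connected_component_sym.
  have [hRe|[hRe|[hIm|hIm]]] : r < complex.Re u \/ complex.Re u < - r \/
      r < complex.Im u \/ complex.Im u < - r.
    by case: hu; rewrite ltr_normr => /orP[] h;
      [left|right; left|right; right; left|right; right; right]; rewrite 1?ltrNr.
  - by apply: seg; left => /=; split => //; lra.
  - apply: (@connected_component_trans (Cplx R) A (Complex (- (r + 1)) (r + 1))).
      by apply: seg; right; left => /=; split => //; lra.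
    by apply: seg; right; right; left => /=; split; lra.
  - by apply: seg; right; right; left => /=; split => //; lra.
  - apply: (@connected_component_trans (Cplx R) A (Complex (r + 1) (- (r + 1)))).
      by apply: seg; right; right; right => /=; split => //; lra.
    by apply: seg; left => /=; split; lra.
apply: (@connected_component_trans (Cplx R) A q); last exact: toq.
by apply: connected_component_sym; exact: toq.
Qed.

Definition frame (s1 s2 : R) : set (Cplx R) := [set z |
  (s1 <= `|complex.Re z| \/ s1 <= `|complex.Im z|) /\
  (`|complex.Re z| <= s2 /\ `|complex.Im z| <= s2)].

Lemma frame_compact (s1 s2 : R) : 0 <= s1 -> compact (frame s1 s2).
Proof.
move=> s10; pose rect (x1 x2 y1 y2 : R) :=
  [set z : Cplx R | x1 <= complex.Re z <= x2 /\ y1 <= complex.Im z <= y2].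
have -> : frame s1 s2 =
    (rect s1 s2 (- s2) s2 `|` rect (- s2) (- s1) (- s2) s2) `|`
    (rect (- s2) s2 s1 s2 `|` rect (- s2) s2 (- s2) (- s1)).
  apply/seteqP; split => z.
    move=> [h []]; rewrite !ler_norml => hx hy; have /andP[x1 x2] := hx.
    have /andP[y1 y2] := hy.
    case: h; rewrite ler_normr => /orP[] h; [left; left|left; right|right; left|right; right];
      by split => //; apply/andP; split => //; rewrite lerNr.
  move=> [[]|[]] [/andP[x1 x2] /andP[y1 y2]]; split;
    rewrite ?ler_norml ?ler_normr; first [by split; apply/andP; split; lra
      |by left; apply/orP; left|by left; apply/orP; right; rewrite lerNr
      |by right; apply/orP; left|by right; apply/orP; right; rewrite lerNr].
by apply: compactU; apply: compactU; exact: rectangle_compact.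
Qed.

End PlaneTopology.

(** * Squares inside the rooms and their logarithmic area *)

Section RoomBoxes.
Context {R : realType}.
Variables (B : nat) (K : R).
Hypothesis HK6 : 1000 <= K / 1000.
Hypothesis HB : K <= B%:R.
Implicit Types (z w u v a b : Cplx R).

Local Notation height := (height B).
Local Notation F := (@roomed_exp R B).
Local Notation room_point := (@room_point R B).
Local Notation thr := (@threshold R).
Let n k : R := (height k)%:R.
Let HK : 1000 <= K := scale_ge HK6.
Let hn k : 1000 <= n k. Proof. exact: le_trans HK (height_ge HK HB k). Qed.

(** The other root b0 at the centre is real, about -N/7, while Re a >= 0; so |a - b0| >= (N - 1)/7,
    and (a - 7)(a - b0) = (z - psi(7)) a forces |a - 7| < 1/2. *)
Lemma room_point_near_root k z : cabs (z - room_point k 7) <= (n k - 1) / 200 ->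
  exists a b, root_pair (height k) z a b /\ 13 / 2 <= complex.Re a <= 15 / 2.
Proof.
move=> hz; have N0 : (0 < height k)%N := height_gt0 HK HB k.
have hnk := hn k.
have [a [b [h1 h2 ha]]] := room_roots_exist z N0.
have rp : root_pair (height k) z a b by [].
pose a0 : Cplx R := 7%:C%C; pose b0 : Cplx R := conj_root (height k) a0.
have a00 : a0 != 0 by apply/eqP => -[]; lra.
have [h1' h2'] := chart_root_pair (height k) a00.
have e : (a - a0) * (a - b0) = (z - room_point k 7) * a.
  have e1 : z = a + b + Complex 0 (n k) by rewrite h1 subrK.
  have e2 : room_point k 7 = a0 + b0 + Complex 0 (n k) by rewrite h1' subrK.
  have e3 : a0 * b0 = a * b by rewrite h2 h2'.
  transitivity (a * a - (a0 + b0) * a + a0 * b0); first by ring.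
  by rewrite e3 e1 e2; ring.
exists a, b; split=> //.
have reb0 : complex.Re b0 = - ((n k - 1) / 7).
  have -> : b0 = (- ((n k - 1) / 7))%:C%C.
    rewrite /b0 /conj_root /a0 -[(height k)%:R](rmorph_nat (real_complex R)).
    rewrite -(rmorph1 (real_complex R)) -rmorphB -fmorphV -rmorphM.
    by congr (_%:C%C); rewrite -mulNr opprB.
  by [].
have lb : (n k - 1) / 7 <= cabs (a - b0).
  apply: le_trans (le_trans _ (ler_norm _)) (cabs_Re _).
  by rewrite cReD cReN reb0; lra.
have := congr1 (@cabs R) e; rewrite !cabsM => e'.
have aa : cabs a <= cabs (a - a0) + 7.
  have := cabsD (a - a0) a0; rewrite subrK /a0 cabs_real ger0_norm //; lra.
set x := cabs (a - a0) in e' aa; have x0 : 0 <= x := cabs_ge0 _.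
have q1 : x * ((n k - 1) / 7) <= (n k - 1) / 200 * (x + 7).
  apply: (@le_trans _ _ (x * cabs (a - b0))); first exact: ler_wpM2l.
  by rewrite e'; apply: ler_pM; rewrite ?cabs_ge0.
have q2 : (n k - 1) * (x / 7) <= (n k - 1) * ((x + 7) / 200) by lra.
have q3 : x / 7 <= (x + 7) / 200.
  by move: q2; rewrite ler_pM2l //; lra.
have := cabs_Re (a - a0); rewrite cReD cReN /= ler_norml => /andP[g1 g2].
by apply/andP; split; rewrite -/x in g1 g2; lra.
Qed.

Definition frame_outer : R := 2 * expR (2 * pi * (15 / 2)) + 3.

(** With Re a between 13/2 and 15/2, |e(a)| is at least 16 exp(10 pi), which clears 5 times the
    threshold. *)
Lemma room_box k z : cabs (z - room_point k 7) <= (n k - 1) / 200 ->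
  [/\ n k / 2 <= cabs z, cabs z <= 2 * n k, 5 * thr <= cabs (F z) &
      cabs (F z) <= frame_outer].
Proof.
move=> hz; have hnk := hn k; have t0 := @tau_gt0 R; have t4 := @tau_ge4 R.
have p7 : room_point k 7 = Complex (7 - (n k - 1) / 7) (n k).
  by apply: room_pointE; apply/eqP; lra.
have z1 : n k / 2 <= cabs z.
  have := cabs_lbB (room_point k 7) (room_point k 7 - z).
  rewrite subKr (cabs_distC _ z).
  have : n k <= cabs (room_point k 7).
    by have := cabs_Im (room_point k 7); rewrite p7 /= ger0_norm //; lra.
  lra.
have z2 : cabs z <= 2 * n k.
  have c2 : cabs (room_point k 7) <= n k / 2 + n k.
    apply: le_trans (cabs_le_ReIm _) _; rewrite p7 /= (@ger0_norm _ (n k)); last lra.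
    by rewrite lerD2r ler_norml; apply/andP; split; lra.
  by have := cabsD (z - room_point k 7) (room_point k 7); rewrite subrK; lra.
have [a [b [rp /andP[a1 a2]]]] := room_point_near_root hz.
have hf : cabs (F z - ce a) <= cabs (ce a) / 1000 + 3.
  apply: (roomed_exp_bounds HK6 HB _ rp); last lra.
  exact: (annulus_of_height HK6 HB).
have l1 : expR (2 * pi * (13 / 2)) <= cabs (ce a).
  by rewrite cabs_ce ler_expR; apply: ler_wpM2l => //; exact: ltW.
have l2 : cabs (ce a) <= expR (2 * pi * (15 / 2)).
  by rewrite cabs_ce ler_expR; apply: ler_wpM2l => //; exact: ltW.
have e5 : 21 <= expR (2 * pi * 5) :> R.
  by apply: le_trans (expR_ge1Dx _); lra.
have e16 : 16 * expR (2 * pi * 5) <= expR (2 * pi * (13 / 2)) :> R.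
  have -> : 2 * pi * (13 / 2) = 2 * pi * (3 / 2) + 2 * pi * 5 :> R by field.
  rewrite expRD; apply: ler_wpM2r; first exact: expR_ge0.
  apply: (@le_trans _ _ (expR (3 + 3))); last by rewrite ler_expR; lra.
  have e3 : 4 <= expR 3 :> R by apply: le_trans (expR_ge1Dx _); lra.
  by rewrite expRD; have : 4 * 4 <= expR 3 * expR 3 :> R; [apply: ler_pM; lra|lra].
split=> //.
- have := cabs_lbB (ce a) (ce a - F z); rewrite subKr (cabs_distC (ce a)).
  by rewrite /threshold; lra.
- have := cabsD (F z - ce a) (ce a); rewrite subrK /frame_outer; lra.
Qed.

Let s k : R := (n k - 1) / 400.
Let x k : R := 7 - (n k - 1) / 7.

Definition box k : set (measurableTypeR R * measurableTypeR R) :=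
  `[x k - s k, x k + s k]%classic `*` `[n k - s k, n k + s k]%classic.

Lemma boxP k p : box k p -> cabs (Complex p.1 p.2 - room_point k 7) <= (n k - 1) / 200.
Proof.
move=> [] /=; rewrite !in_itv /= => /andP[h1 h2] /andP[h3 h4].
have -> : room_point k 7 = Complex (x k) (n k) by apply: room_pointE; apply/eqP; lra.
apply: le_trans (cabs_le_ReIm _) _ => /=.
have : `|p.1 - x k| <= s k by rewrite ler_norml; apply/andP; split; lra.
have : `|p.2 - n k| <= s k by rewrite ler_norml; apply/andP; split; lra.
by rewrite /s; lra.
Qed.

Lemma height_separated i j : (i < j)%N -> 2 * n i <= n j.
Proof.
move=> ij; rewrite /n !heightE.
have b2 : 2 <= B%:R :> R by have := HB; have := HK; lra.
apply: (@le_trans _ _ (B%:R ^+ i.*2.+2)).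
  by rewrite [leRHS]exprS; apply: ler_wpM2r => //; rewrite exprn_ge0 //; lra.
by rewrite ler_weXn2l //; [lra|move: ij; clear; lia].
Qed.

Lemma box_trivIset : trivIset setT box.
Proof.
have lt i j p : (i < j)%N -> box i p -> box j p -> False.
  move=> ij [_ /=]; rewrite in_itv /= => /andP[_ h1] [_ /=].
  rewrite in_itv /= => /andP[h2 _].
  by have := height_separated ij; have := hn i; have := hn j; rewrite /s in h1 h2; lra.
move=> i j _ _ [p [bi bj]]; case: (ltngtP i j) => // ij.
- by case: (lt _ _ _ ij bi bj).
- by case: (lt _ _ _ ij bj bi).
Qed.

Lemma box_measurable k : measurable (box k).
Proof. by apply: measurableX; exact: measurable_itv. Qed.

Lemma box_measure k :
  ((@lebesgue_measure R \x @lebesgue_measure R) (box k) = (2 * s k * (2 * s k))%:E)%E.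
Proof.
have s0 : 0 < s k by rewrite /s; have := hn k; lra.
rewrite product_measure1E; [|exact: measurable_itv|exact: measurable_itv].
have L (y : R) : lebesgue_measure (`[y - s k, y + s k]%classic : set R) = (2 * s k)%:E.
  rewrite lebesgue_measure_itv /= lte_fin.
  have -> : y - s k < y + s k by lra.
  by rewrite -EFinB; congr (_%:E); ring.
by rewrite EFinM -{1}(L (x k)) -(L (n k)).
Qed.

(** Every box has area 4 s^2 and integrand at least 1/(4 N^2); since s >= N/800, it contributes at
    least (1/800)^2, whatever k. *)
Lemma roomed_exp_no_area_property : ~ area_property F.
Proof.
move=> hA.
have thr0 : 3 <= thr by rewrite /threshold; have := expR_gt0 (2 * pi * 5 : R); lra.
pose q : Cplx R := Complex (2 * thr + 1) 0.
pose W := connected_component (~` singular_values F) q.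
have out v : outside (2 * thr) v -> (~` singular_values F) v.
  move=> hv /= /(roomed_exp_singular_values HK6 HB) hs.
  by case: hv; [have := cabs_Re v|have := cabs_Im v]; lra.
have outW v : outside (2 * thr) v -> W v.
  move=> hv; apply: (outside_connected (r := 2 * thr)) => //; first lra.
  by left; rewrite /q /= ger0_norm; lra.
have hW : unbounded_component (~` singular_values F) W.
  split; first by exists q => //; apply: out; left; rewrite /q /= ger0_norm; lra.
  move=> [M [Mr hM]].
  have [r eM] := complex_realP _ Mr.
  pose t : R := Num.max (r + 1) (2 * thr) + 1.
  have t1 : r + 1 <= Num.max (r + 1) (2 * thr) by rewrite le_max lexx.
  have t2 : 2 * thr <= Num.max (r + 1) (2 * thr) by rewrite le_max lexx orbT.
  have : W t%:C%C by apply: outW; left => /=; rewrite ger0_norm /t; lra.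
  move=> /(hM (r + 1)%:C%C); rewrite eM ltcR => /(_ ltac:(lra)).
  by rewrite /= cabs_normr lecR cabs_real ger0_norm /t; lra.
(* On the boxes |F| >= 5 [thr], so the real or the imaginary part of F is at least half of that; 5/2
   exceeds the 2 of the square known to contain the singular values. *)
pose C := frame (5 / 2 * thr) frame_outer.
have hC : compact C by apply: frame_compact; lra.
have CW : C `<=` W.
  by move=> v [h _]; apply: outW; case: h => h; [left|right]; lra.
have := hA W C hW hC CW; rewrite /log_area; set I := (\int[_]_(p in _) _)%E.
have key m : ((m%:R * (1 / 800) ^+ 2)%:E <= I)%E.
  pose c k : R := (4 * n k ^+ 2)^-1.
  have c0 k : 0 <= c k by rewrite invr_ge0 mulr_ge0 // exprn_ge0 // /n.
  have := @integral_ge_sum _ _ R (lebesgue_measure \x lebesgue_measure)%E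
    [set p : measurableTypeR R * measurableTypeR R |
      ((F @^-1` C) `\` [set z | cabs z < 1]) (Complex p.1 p.2)]
    (fun p => ((cabs (Complex p.1 p.2 : Cplx R) ^+ 2)^-1)%:E) box c m.
  rewrite -/I => h; apply: le_trans (h _ box_measurable c0 box_trivIset _).
  - rewrite (eq_bigr (fun k => (c k * (2 * s k * (2 * s k)))%:E)); last first.
      by move=> k _; rewrite EFinM; congr (_ * _)%E; exact: box_measure.
    rewrite sumEFin lee_fin.
    have -> : m%:R * (1 / 800) ^+ 2 = \sum_(0 <= k < m) (1 / 800) ^+ 2 :> R.
      by rewrite sumr_const_nat subn0 mulr_natl.
    apply: ler_sum => k _; have hnk := hn k.
    have n2 : 0 < 4 * n k ^+ 2 by rewrite mulr_gt0 // exprn_gt0 //; lra.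
    rewrite /c [leRHS]mulrC ler_pdivlMr //.
    have : (n k / 800) * (n k / 800) <= s k * s k by apply: ler_pM; rewrite /s; lra.
    by rewrite !expr2; lra.
  - by move=> p _; rewrite lee_fin invr_ge0 sqr_ge0.
  - move=> k p /boxP /room_box[h1 h2 h3 h4]; have hnk := hn k.
    set z : Cplx R := Complex p.1 p.2 in h1 h2 h3 h4 *; split.
      split; last by apply/negP; rewrite -leNgt; lra.
      split; last by split; apply: le_trans h4; [exact: cabs_Re|exact: cabs_Im].
      have := cabs_le_ReIm (F z).
      by case: (lerP (5 / 2 * thr) `|complex.Re (F z)|) => hr; [left|right; lra].
    have z0 : 0 < cabs z by lra.
    have z2 : 0 < cabs z ^+ 2 by rewrite exprn_gt0.
    have zn : cabs z ^+ 2 <= 4 * n k ^+ 2.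
      have : cabs z * cabs z <= (2 * n k) * (2 * n k) by apply: ler_pM => //; lra.
      by rewrite !expr2; lra.
    by rewrite lee_fin /c lef_pV2 ?posrE //; exact: lt_le_trans zn.
move=> Ioo; have I0 := key 0%N; rewrite mul0r in I0.
have Ifin : I \is a fin_num by rewrite ge0_fin_numE.
have g0 : 0 < (1 / 800) ^+ 2 :> R by apply: exprn_gt0; lra.
have [m hm] : exists m : nat, fine I < m%:R * (1 / 800) ^+ 2.
  exists (Num.truncn (fine I / (1 / 800) ^+ 2)).+1.
  by rewrite -(ltr_pdivrMr _ _ g0); exact: truncnS_gt.
by have := key m; rewrite -(fineK Ifin) lee_fin leNgt hm.
Qed.

End RoomBoxes.

Theorem theorem1p8 (R : realType) :
  exists f : Cplx R -> Cplx R,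
    [/\ class_B f, (growth_order f < +oo)%E & ~ area_property f].
Proof.
pose K : R := 1000 * 1000.
have HK6 : 1000 <= K / 1000 by rewrite /K; lra.
pose B := (Num.truncn K).+1.
have HB : K <= B%:R by apply/ltW/truncnS_gt.
exists (@roomed_exp R B); split.
- split; first exact: (roomed_exp_transcendental HK6 HB).
  by apply: bounded_cabs => w; exact: (roomed_exp_singular_values HK6 HB).
- exact: (roomed_exp_order HK6 HB).
- exact: (roomed_exp_no_area_property HK6 HB).
Qed.
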